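(* Let $f\in L^\infty(0,1)$ with $0\le f\le 1$ a.e. on $[0,1]$, let $F:\mathbb{R}\to[0,\infty)$ satisfy (F1)--(F4), let $\lambda>0$, and let $u\in BV(0,1)$ be the unique minimizer of $K$ in $BV(0,1)$. Then: (a) If $t_0\in(0,1)$ is a point at which some representative of $f$ is continuous, then the good representative of $u$ is continuous at $t_0$. (b) If there is an interval $[a,b]\subset(0,1)$ such that $f\in\mathrm{Lip}(a,b)=W^{1,\infty}(a,b)$, then $u\in C^2(a,b)$. (c) Suppose $f\in W^{1,1}(0,1)$ and define $$\omega_\infty:=\lim_{p\to\infty}\big(pF'(p)-F(p)\big)\in(0,\infty].$$ If $\lambda\left(\frac12+\|\dot f\|_{L^1(0,1)}\right)<\omega_\infty$, then $u\in C^{1,1}([0,1])$.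
   Context: Conditions on $F:\mathbb{R}\to[0,\infty)$ (for all $p\in\mathbb{R}$, with constants $\nu_1,\nu_2>0$, $\nu_3\in\mathbb{R}$): (F1) $F\in C^2(\mathbb{R})$, $F(-p)=F(p)$, $F(0)=0$; (F2) $|F'(p)|\le\nu_1$; (F3) $F(p)\ge\nu_2|p|-\nu_3$; (F4) $F''(p)>0$. Set $\lambda_\infty=\lambda_\infty(F):=\lim_{p\to\infty}F'(p)$, a positive number. For $w\in BV(0,1)$ write the distributional derivative as $Dw=\dot w\,\mathcal{L}^1+D^sw$ (Lebesgue decomposition with respect to Lebesgue measure $\mathcal{L}^1$; $\dot w$ is the density of the absolutely continuous part and $D^sw$ the singular part, $|D^sw|$ its total variation measure), and $$K[w]:=\int_0^1F(\dot w)\,dt+\lambda_\infty|D^sw|(0,1)+\frac{\lambda}{2}\int_0^1(w-f)^2\,dt.$$ Under (F1)--(F4), $K$ has a unique minimizer in $BV(0,1)$. Every $BV$-function is identified with its good representative, which is continuous outside an at most countable set of jump points and has left and right limits at all points. $C^{1,1}([0,1])$ is the space of $C^1$ functions on $[0,1]$ with Lipschitz continuous derivative. *)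

(* Defs.v *)
From HB Require Import structures.
From mathcomp Require Import all_boot all_order all_algebra.
From mathcomp Require Import all_classical all_reals all_analysis.
Import Order.TTheory GRing.Theory Num.Theory.
Import numFieldNormedType.Exports.

Set Implicit Arguments.
Unset Strict Implicit.
Unset Printing Implicit Defensive.

Local Open Scope ring_scope.
Local Open Scope classical_set_scope.

Notation I01 := (`]0%R, 1%R[%classic).

(** Signed measures are charges on the whole line, but only their values on
    measurable subsets of ]0, 1[ are ever used. *)

Section Charges.
Context {R : realType}.
Local Notation mu := (@lebesgue_measure R).
Implicit Type nu : {charge set (measurableTypeR R) -> \bar R}.

Definition hahn_pos nu := projT1 (cid (Hahn_decomposition nu)).

Definition hahn_neg nu :=
  projT1 (cid (projT2 (cid (Hahn_decomposition nu)))).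

Definition hahn_posneg nu : hahn_decomposition nu (hahn_pos nu) (hahn_neg nu) :=
  projT2 (cid (projT2 (cid (Hahn_decomposition nu)))).

Definition variation_charge nu : set (measurableTypeR R) -> \bar R :=
  charge_variation (hahn_posneg nu).

Definition integral_charge nu (D : set R) (phi : R -> R) : \bar R :=
  (\int[jordan_pos (hahn_posneg nu)]_(x in D) (phi x)%:E -
   \int[jordan_neg (hahn_posneg nu)]_(x in D) (phi x)%:E)%E.

Definition singular01 nu : Prop :=
  exists N : set (measurableTypeR R),
    [/\ measurable N, mu N = 0%E & variation_charge nu (I01 `\` N) = 0%E].

(** nu = g L^1 + s on ]0, 1[ with g integrable and s singular. *)
Definition lebesgue_decomposition nu (g : R -> R)
    (s : {charge set (measurableTypeR R) -> \bar R}) : Prop :=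
  [/\ mu.-integrable I01 (EFin \o g),
      singular01 s &
      forall A : set (measurableTypeR R), measurable A -> A `<=` I01 ->
        nu A = (\int[mu]_(x in A) (g x)%:E + s A)%E].

(** The pair (density of the absolutely continuous part, singular part); the
    choice is immaterial, the decomposition being unique on ]0, 1[ up to
    null sets for the density. *)
Definition lebesgue_parts nu :
    (R -> R) * {charge set (measurableTypeR R) -> \bar R} :=
  xget ((cst 0 : R -> R, czero : {charge set (measurableTypeR R) -> \bar R})
          : {classic (R -> R) * {charge set (measurableTypeR R) -> \bar R}})
    [set p | lebesgue_decomposition nu p.1 p.2].

End Charges.

Section BV.
Context {R : realType}.
Local Notation mu := (@lebesgue_measure R).
Implicit Types (w f phi : R -> R).

(** C_c^oo(0, 1), each function being extended by 0 to the line. *)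
Definition test_function phi : Prop :=
  [/\ forall n x, derivable (derive1n n phi) x 1,
      compact (closure [set x | phi x != 0]) &
      closure [set x | phi x != 0] `<=` I01].

Definition distributional_derivative w
    (nu : {charge set (measurableTypeR R) -> \bar R}) : Prop :=
  forall phi, test_function phi ->
    (\int[mu]_(x in I01) (w x * derive1 phi x)%:E =
     - integral_charge nu I01 phi)%E.

Definition BV w : Prop :=
  mu.-integrable I01 (EFin \o w) /\
  exists nu : {charge set (measurableTypeR R) -> \bar R},
    distributional_derivative w nu.

(** Dw; for w in BV the choice is unique on ]0, 1[. *)
Definition Dmeas w : {charge set (measurableTypeR R) -> \bar R} :=
  xget ((czero : {charge set (measurableTypeR R) -> \bar R})
          : {classic {charge set (measurableTypeR R) -> \bar R}})
    [set nu | distributional_derivative w nu].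

Definition BVdot w : R -> R := (lebesgue_parts (Dmeas w)).1.

Definition BVsing w : {charge set (measurableTypeR R) -> \bar R} :=
  (lebesgue_parts (Dmeas w)).2.

Definition weak_derivative f (fdot : R -> R) : Prop :=
  mu.-integrable I01 (EFin \o fdot) /\
  forall phi, test_function phi ->
    (\int[mu]_(x in I01) (f x * derive1 phi x)%:E =
     - \int[mu]_(x in I01) (fdot x * phi x)%:E)%E.

(** f belongs to W^{1,1}(0, 1), with weak derivative fdot. *)
Definition W11 f (fdot : R -> R) : Prop :=
  mu.-integrable I01 (EFin \o f) /\ weak_derivative f fdot.

Definition ae_eq01 (v w : R -> R) : Prop :=
  {ae mu, forall x : R, I01 x -> v x = w x}.

(** The values of a good representative at its jump points are left free. *)
Definition jump_point (v : R -> R) (t : R) : Prop :=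
  lim (v x @[x --> t^'-]) <> lim (v x @[x --> t^'+]).

Definition good_representative w (v : R -> R) : Prop :=
  [/\ ae_eq01 v w,
      forall t : R, I01 t ->
        cvg (v x @[x --> t^'-]) /\ cvg (v x @[x --> t^'+]),
      countable [set t : R | I01 t /\ jump_point v t] &
      forall t : R, I01 t -> ~ jump_point v t ->
        {for t, continuous v}].

(** Meaningful for open A only, v^`() being a two-sided derivative. *)
Definition C2_on (A : set R) (v : R -> R) : Prop :=
  [/\ forall t : R, A t -> derivable v t 1,
      forall t : R, A t -> derivable (v^`()) t 1 &
      forall t : R, A t -> {for t, continuous (v^`()^`())}].

(** C^{1,1}([0, 1]), the derivative being one-sided at the end points. *)
Definition C11 (v : R -> R) : Prop :=
  exists dv : R -> R,
    [/\ forall t : R, `[0, 1] t ->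
          (v s - v t) / (s - t) @[s --> within `[0, 1] t^'] --> dv t,
        {within `[0, 1], continuous dv} &
        [lipschitz dv t | t in `[0, 1]]].

End BV.

Section Energy.
Context {R : realType}.
Local Notation mu := (@lebesgue_measure R).
Implicit Types (F f u w : R -> R) (lambda : R).

Definition F1 F : Prop :=
  [/\ C2_on setT F, forall p, F (- p) = F p & F 0 = 0].

Definition F2 F (nu1 : R) : Prop := forall p, `|F^`() p| <= nu1.

Definition F3 F (nu2 nu3 : R) : Prop := forall p, nu2 * `|p| - nu3 <= F p.

Definition F4 F : Prop := forall p, 0 < F^`()^`() p.

Definition lambda_inf F : R := lim (F^`() p @[p --> +oo]).

(** The limits in lambda_inf and omega_inf exist under (F1)-(F4), by monotonicity. *)
Definition omega_inf F : \bar R :=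
  lim ((p * derive1 F p - F p)%:E @[p --> +oo]).

Definition K F f lambda w : \bar R :=
  (\int[mu]_(t in I01) (F (BVdot w t))%:E
   + (lambda_inf F)%:E * variation_charge (BVsing w) I01
   + (lambda / 2)%:E * \int[mu]_(t in I01) ((w t - f t) ^+ 2)%:E)%E.

Definition minimizer F f lambda u : Prop :=
  BV u /\ forall w, BV w -> (K F f lambda u <= K F f lambda w)%E.

End Energy.

(* Main.v *)
From HB Require Import structures.
Require Import Defs.
From mathcomp Require Import all_boot all_order all_algebra.
From mathcomp Require Import all_classical all_reals all_analysis.
From mathcomp Require Import measurable_realfun.
From mathcomp Require Import ring lra.
Import Order.TTheory GRing.Theory Num.Theory.
Import numFieldNormedType.Exports.
Local Open Scope ring_scope.
Local Open Scope classical_set_scope.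
Set Implicit Arguments.
Unset Strict Implicit.

(** Write Phi for F' and L for its limit lambda_inf F.  The derivative of the
    minimizer u is a charge nu with density gu and singular part su, and u agrees
    almost everywhere with the right-continuous function U = c + cdf nu (BV_cdf,
    which rests on the lemma of du Bois-Reymond).  Let sigma be the primitive of
    lambda (U - f) that vanishes at 0.  Three kinds of variations of u are used.
    - Constants show that U - f has mean zero, so sigma vanishes at 1 as well.
    - Variations of the density show that Phi o gu = sigma almost everywhere
      (EL_density); in particular |sigma| <= L.
    - Thinning the singular part on a set A shows that su is nonnegative where
      sigma > - L and nonpositive where sigma < L (singular_nonneg,
      singular_nonpos).
    Together they say that U has slope at least q on every interval where
    sigma >= Phi q, and at most q where sigma <= Phi q (rep_slope_ge,
    rep_slope_le).  Everything else follows from these two inequalities and from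
    sigma' = lambda (U - f), which are collected in the record stationary.

    (a) Near a point where sigma < L the slopes of U are bounded above, so an
    upward jump at t forces sigma t = L.  As L is the maximum of sigma, sigma' = lambda (U - f)
    cannot be negative just before t nor positive just after, whence
    U(t+) <= f(t) <= U(t-), a contradiction (no_upward_jump).  Downward jumps are
    excluded by a change of sign.

    (b) If f is Lipschitz near t and sigma t = L, then to the right of t the slope
    of U exceeds that of f while U t >= f t; so U > f there and sigma becomes
    larger than L (sigma_lt_max).  Hence |sigma| < L, and U' = Phi^-1 (sigma) is
    continuously differentiable because sigma' = lambda (U - f) is continuous.

    (c) A maximum principle gives 0 <= U <= 1 (rep_le).  With
    W p = p Phi p - F p, the derivative of W(U') - lambda/2 (U - f)^2 is
    lambda (U - f) f', so W(U') <= lambda (1/2 + ||f'||) as long as |sigma| < L.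
    By hypothesis the right-hand side is smaller than W q for some q, so |U'| < q
    and |sigma| < Phi q; a continuity argument starting at 0, where sigma = 0,
    makes this hold on the whole interval (sobolev_sigma_lt).  There Phi^-1 is
    Lipschitz, and so is U' = Phi^-1 (sigma). *)

(** * Smooth steps *)

Section Derivatives.
Context {R : realType}.
Implicit Types f g : R -> R.

Lemma is_derive1_eps f (a l : R) :
  (forall e : R, 0 < e -> \forall h \near (0 : R),
     `|f (h + a) - f a - l * h| <= e * `|h|) ->
  is_derive a (1 : R) f l.
Proof.
move=> H.
have C : h^-1 *: (f (h *: (1 : R) + a) - f a) @[h --> 0^'] --> l.
  apply/cvgrPdist_le => e e0.
  rewrite near_withinE; near=> h => h0.
  have hn0 : `|h| > 0 by rewrite normr_gt0.
  rewrite [h *: 1]mulr1 /GRing.scale/= -(ler_pM2r hn0) -normrM mulrBl mulrAC mulVf//.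
  rewrite mul1r distrC; near: h; exact: H.
apply: DeriveDef; first by apply/cvg_ex; exists l.
exact: cvg_lim.
Unshelve. all: by end_near. Qed.

End Derivatives.

Section FlatFunctions.
Context {R : realType}.
Implicit Types (P : {poly R}) (x y : R).

(** The induction on the polynomial spends half of the exponent on each factor y. *)
Lemma poly_expR_bound P (e : R) : 0 < e ->
  exists2 C : R, 0 <= C & forall y, 0 < y -> `|P.[y]| <= C * expR (e * y).
Proof.
move: e; elim/poly_ind: P => [|Q c IH] e e0.
  by exists 0 => // y _; rewrite horner0 normr0 mul0r.
have [C C0 HC] := IH (e / 2) (divr_gt0 e0 (ltr0Sn _ _)).
exists (C * (2 / e) + `|c|); first by rewrite addr_ge0// mulr_ge0// divr_ge0// ltW.
move=> y y0; rewrite hornerMXaddC mulrDl (le_trans (ler_normD _ _))// lerD//.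
  rewrite normrM (gtr0_norm y0).
  have -> : e * y = e / 2 * y + e / 2 * y by field.
  rewrite expRD mulrACA ler_pM// ?HC// ?(ltW y0)//.
  have : 1 + e / 2 * y <= expR (e / 2 * y) by exact: expR_ge1Dx.
  have -> : y = 2 / e * (e / 2 * y) by field; rewrite gt_eqF.
  have -> : e / 2 * (2 / e * (e / 2 * y)) = e / 2 * y by field; rewrite gt_eqF.
  move=> h; apply: ler_wpM2l; first by rewrite divr_ge0// ltW.
  by apply: le_trans h; rewrite lerDr.
by rewrite ler_peMr// -expR0 ler_expR mulr_ge0 ?ltW.
Qed.

(** The derivatives of flat P have the same form, with other polynomials, and
    flat 1 is the classical function exp (-1/x). *)
Definition flat P x := if 0 < x then P.[x^-1] * expR (- x^-1) else 0.

(** This is what makes flat P differentiable at 0. *)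
Lemma flat_quadratic P : exists C : R, forall x, `|flat P x| <= C * x ^+ 2.
Proof.
have [C C0 HC] := @poly_expR_bound (P * 'X) (1 / 2) (divr_gt0 ltr01 (ltr0Sn _ _)).
exists (C * 2) => x; rewrite /flat; case: ifPn => x0; last first.
  by rewrite normr0 mulr_ge0// ?sqr_ge0// mulr_ge0.
have y0 : 0 < x^-1 by rewrite invr_gt0.
have := HC _ y0; rewrite hornerMX normrM (gtr0_norm y0) => h.
rewrite normrM (gtr0_norm (expR_gt0 _)).
have h2 : `|P.[x^-1]| <= C * expR (1 / 2 * x^-1) * x.
  by rewrite -ler_pdivrMr.
apply: le_trans (ler_wpM2r (expR_ge0 _) h2) _.
have h3 : expR (- (1 / 2 * x^-1)) <= 2 * x.
  rewrite expRN -[leRHS]invrK lef_pV2 ?posrE ?expR_gt0// ?invr_gt0 ?mulr_gt0//.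
  apply: le_trans (expR_ge1Dx _); rewrite invfM div1r lerDr//.
have -> : C * expR (1 / 2 / x) * x * expR (- x^-1) =
  C * x * expR (- (1 / 2 * x^-1)).
  have -> : expR (- (1 / 2 / x)) = expR (1 / 2 / x) * expR (- x^-1).
    by rewrite -expRD; congr expR; field; rewrite gt_eqF.
  ring.
have -> : C * 2 * x ^+ 2 = C * x * (2 * x) by ring.
by apply: ler_wpM2l => //; rewrite mulr_ge0// ltW.
Qed.

Definition flat_deriv P := ('X^2 * (P - P^`()))%R.

Lemma is_derive_flat P x : is_derive x (1 : R) (flat P) (flat (flat_deriv P) x).
Proof.
have [x0|x0|<-] := ltgtP 0 x.
- have -> : flat (flat_deriv P) x =
    P.[x^-1] * (expR (- x^-1) * (x ^- 2)) + expR (- x^-1) * (- x ^- 2 * P^`().[x^-1]).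
    by rewrite /flat x0 /flat_deriv !hornerE/=; rewrite exprVn; ring.
  have xn0 : x != 0 by rewrite gt_eqF.
  apply: (@near_eq_is_derive _ _ _
      (fun z : R => P.[z^-1] * expR (- z^-1)) (flat P)).
    by near=> z; rewrite /flat; case: ifPn => //; rewrite (_ : 0 < z)//;
      near: z; exact: lt_nbhsr.
  have iV : is_derive x (1 : R) (fun z : R => z^-1) (- x ^- 2).
    rewrite -[- x ^- 2]mulr1.
    exact: (@is_deriveV _ (fun z : R => z) x 1 1 xn0 (is_derive_id x 1)).
  have iN : is_derive x (1 : R) (fun z : R => - z^-1) (x ^- 2).
    by rewrite -[x ^- 2]opprK; exact: (@is_deriveN _ _ _ (fun z : R => z^-1)).
  have iE : is_derive x (1 : R) (fun z : R => expR (- z^-1)) (expR (- x^-1) * x ^- 2).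
    exact: (@is_derive1_comp _ expR (fun z : R => - z^-1)).
  have iP : is_derive x (1 : R) (fun z : R => P.[z^-1]) (- x ^- 2 * P^`().[x^-1]).
    by rewrite mulrC; exact: (@is_derive1_comp _ (horner P) (fun z : R => z^-1)).
  exact: (@is_deriveM _ _ (fun z : R => P.[z^-1]) (fun z : R => expR (- z^-1))).
- have -> : flat (flat_deriv P) x = 0 by rewrite /flat ltNge (ltW x0).
  apply: (@near_eq_is_derive _ _ _ (cst 0) (flat P)).
    near=> z; rewrite /flat; case: ifPn => //.
    rewrite (_ : (0 < z) = false)//; apply/negbTE; rewrite -leNgt; near: z.
    by apply: (@filterS _ _ _ (fun z => z < 0)) (lt_nbhsl x0) => z /ltW.
- have -> : flat (flat_deriv P) 0 = 0 by rewrite /flat ltxx.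
  have [C HC] := flat_quadratic P.
  apply: is_derive1_eps => e e0.
  near=> h; rewrite addr0 mul0r subr0 [X in _ - X]/flat ltxx subr0.
  apply: le_trans (HC _) _.
  rewrite -(real_normK (num_real h)) expr2 mulrA ler_wpM2r//.
  apply: le_trans (ler_wpM2r (normr_ge0 _) (ler_norm C)) _.
  apply: le_trans (ler_wpM2r (normr_ge0 h) (_ : `|C| <= `|C| + 1)) _.
    by rewrite lerDl.
  have C1 : 0 < `|C| + 1 by rewrite ltr_wpDl.
  rewrite mulrC -ler_pdivlMr//; near: h.
  by apply: (@nbhs0_le R R); exact: divr_gt0.
Unshelve. all: by end_near. Qed.

End FlatFunctions.

Section Smooth.
Context {R : realType}.
Implicit Types f g : R -> R.

(** Regularity of finite order is stable under products and inverses by a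
    plain induction on the order, which a statement on all iterated
    derivatives at once does not allow. *)
Fixpoint ntimes_derivable n f : Prop :=
  if n is m.+1 then (forall x, derivable f x 1) /\ ntimes_derivable m (derive1 f)
  else True.

Lemma ntimes_derivableW n f : ntimes_derivable n.+1 f -> ntimes_derivable n f.
Proof. by elim: n f => //= n IH f [df [ddf nf]]; split => //; exact: IH. Qed.

Lemma ntimes_derivableD n f g : ntimes_derivable n f -> ntimes_derivable n g ->
  ntimes_derivable n (fun x => f x + g x).
Proof.
elim: n f g => //= n IH f g [df nf] [dg ng]; split.
  by move=> x; exact: derivableD.
have -> : derive1 (fun x => f x + g x) = fun x => derive1 f x + derive1 g x; last exact: IH.
by apply/funext => x; rewrite !derive1E deriveD.
Qed.

Lemma ntimes_derivableM n f g : ntimes_derivable n f -> ntimes_derivable n g ->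
  ntimes_derivable n (fun x => f x * g x).
Proof.
elim: n f g => // n IH f g nf ng.
have [df nf'] := nf; have [dg ng'] := ng; split.
  by move=> x; exact: derivableM.
have -> : derive1 (fun x => f x * g x) = fun x => f x * derive1 g x + g x * derive1 f x.
  by apply/funext => x; rewrite !derive1E deriveM.
by apply: ntimes_derivableD; apply: IH => //; exact: ntimes_derivableW.
Qed.

Lemma ntimes_derivable_cst n (c : R) : ntimes_derivable n (cst c).
Proof.
elim: n c => //= n IH c; split; first by move=> x; exact: derivable_cst.
by rewrite (_ : derive1 (cst c) = cst 0)//; apply/funext => x; rewrite derive1_cst.
Qed.

Lemma ntimes_derivableV n f : (forall x, f x != 0) -> ntimes_derivable n f ->
  ntimes_derivable n (fun x => (f x)^-1).
Proof.
move=> f0; elim: n => // n IH nf; have [df nf'] := nf.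
have nV := IH (ntimes_derivableW nf).
split; first by move=> x; exact: derivableV.
have -> : derive1 (fun x => (f x)^-1) = fun x => -1 * derive1 f x * ((f x)^-1 * (f x)^-1).
  apply/funext => x; rewrite !derive1E deriveV// /GRing.scale/=.
  by rewrite -expr2 exprVn; ring.
by do 2 apply: ntimes_derivableM => //; exact: ntimes_derivable_cst.
Qed.

Lemma ntimes_derivable_affine n f (a b : R) : ntimes_derivable n f ->
  ntimes_derivable n (fun x => f (a * x + b)).
Proof.
elim: n f => // n IH f [df nf].
have dE x : is_derive x (1 : R) (fun x => f (a * x + b)) (a * derive1 f (a * x + b)).
  have ia : is_derive x (1 : R) (fun x => a * x + b) a.
    have -> : (fun x : R => a * x + b) = (fun x => a *: x) + cst b.
      by apply/funext.
    by apply: is_derive_eq; rewrite addr0 [_ *: _]mulr1.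
  have if' : is_derive (a * x + b) (1 : R) f (derive1 f (a * x + b)).
    by rewrite derive1E; exact: derivableP.
  by rewrite mulrC; exact: (@is_derive1_comp _ f (fun x => a * x + b)).
split; first by move=> x; have [] := dE x.
have -> : derive1 (fun x => f (a * x + b)) = fun x => a * derive1 f (a * x + b).
  by apply/funext => x; rewrite derive1E; apply: derive_val.
by apply: ntimes_derivableM; [exact: ntimes_derivable_cst|exact: IH].
Qed.

Lemma ntimes_derivable_flat n P : ntimes_derivable n (@flat R P).
Proof.
elim: n P => //= n IH P; split; first by move=> x; have [] := is_derive_flat P x.
have -> : derive1 (flat P) = flat (flat_deriv P); last exact: IH.
by apply/funext => x; rewrite derive1E; have [] := is_derive_flat P x.
Qed.

Lemma smoothP f : (forall n, ntimes_derivable n f) <->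
  (forall n x, derivable (derive1n n f) x 1).
Proof.
split=> [H n|H n].
  by elim: n f H => [f /(_ 1%N)[]//|n IH f H]; rewrite derive1Sn; apply: IH => m;
    have [] := H m.+1.
elim: n f H => //= n IH f H; split; first exact: (H 0%N).
by apply: IH => m x; rewrite -derive1Sn; exact: H.
Qed.

Definition smooth_step (x : R) :=
  flat 1%:P x / (flat 1%:P x + flat 1%:P (1 - x)).

Let flat1_ge0 (x : R) : 0 <= flat 1%:P x.
Proof. by rewrite /flat; case: ifP => // _; rewrite hornerE mul1r expR_ge0. Qed.

Let flat1_gt0 (x : R) : 0 < x -> 0 < flat 1%:P x.
Proof. by rewrite /flat => ->; rewrite hornerE mul1r expR_gt0. Qed.

Let den_gt0 (x : R) : 0 < flat 1%:P x + flat 1%:P (1 - x).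
Proof.
have [x0|x0] := ltP 0 x; first by rewrite ltr_pwDl// flat1_gt0.
by rewrite ltr_wpDl// flat1_gt0// subr_gt0 (le_lt_trans x0).
Qed.

Lemma smooth_step0 x : x <= 0 -> smooth_step x = 0.
Proof. by move=> x0; rewrite /smooth_step {1}/flat ltNge x0 /= mul0r. Qed.

Lemma smooth_step1 x : 1 <= x -> smooth_step x = 1.
Proof.
move=> x1; have := den_gt0 x; rewrite /smooth_step.
have -> : flat 1%:P (1 - x) = 0 by rewrite /flat subr_gt0 ltNge x1.
by rewrite addr0 => h; rewrite divff// gt_eqF.
Qed.

Lemma ntimes_derivable_smooth_step n : ntimes_derivable n smooth_step.
Proof.
apply: ntimes_derivableM; first exact: ntimes_derivable_flat.
apply: ntimes_derivableV => [x|]; first by rewrite gt_eqF.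
apply: ntimes_derivableD; first exact: ntimes_derivable_flat.
rewrite (_ : (fun x => _) = fun x => flat 1%:P (-1 * x + 1)).
  by apply: ntimes_derivable_affine; exact: ntimes_derivable_flat.
by apply/funext => x; rewrite mulN1r addrC.
Qed.

End Smooth.

(** * The lemma of du Bois-Reymond *)

Section Bump.
Context {R : realType}.
Implicit Types (s t e x : R).

Lemma derivable_continuous (f : R -> R) x : derivable f x 1 -> {for x, continuous f}.
Proof. by move=> /derivable1_diffP/differentiable_continuous. Qed.

Definition bump : R -> R := derive1 smooth_step.

Lemma is_derive_smooth_step x : is_derive x (1 : R) smooth_step (bump x).
Proof.
have [d _] := @ntimes_derivable_smooth_step R 1.
by rewrite /bump derive1E; exact: derivableP.
Qed.

Lemma continuous_bump : continuous bump.
Proof.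
have [_ [d _]] := @ntimes_derivable_smooth_step R 2.
by move=> x; exact: derivable_continuous.
Qed.

Lemma bump_out x : (x < 0) || (1 < x) -> bump x = 0.
Proof.
move=> x01; rewrite /bump derive1E.
suff [c ->] : exists c : R, 'D_1 smooth_step x = 'D_1 (cst c) x by rewrite derive_cst.
case/orP: x01 => x01; [exists 0|exists 1]; apply: near_eq_derive; near=> y => /=.
- by rewrite smooth_step0// ltW//; near: y; exact: lt_nbhsl.
- by rewrite smooth_step1// ltW//; near: y; exact: lt_nbhsr.
Unshelve. all: by end_near. Qed.

Lemma bump_bounded : exists2 B : R, 0 < B & forall x, `|bump x| <= B.
Proof.
have c : {within `[(0 : R), 1], continuous (fun x => `|bump x|)}.
  by apply: continuous_subspaceT => x; apply: continuous_comp;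
    [exact: continuous_bump|exact: norm_continuous].
have [x0 _ Hx0] := EVT_max ler01 c.
exists (`|bump x0| + 1); first by rewrite ltr_wpDl.
move=> x; have [x01|] := boolP (x \in `[0, 1]%R).
  by rewrite (le_trans (Hx0 _ x01))// lerDl.
rewrite in_itv/= negb_and -!ltNge => /bump_out ->.
by rewrite normr0 addr_ge0.
Qed.

(** A unit mass carried by [s, s + e].  Being the derivative of a step, the
    difference of two of them is the derivative of a test function. *)
Definition bump_at s e x := e^-1 * bump ((x - s) / e).

Lemma is_derive_step_at s e x :
  is_derive x (1 : R) (fun x => smooth_step ((x - s) / e)) (bump_at s e x).
Proof.
have ia : is_derive x (1 : R) (fun x => (x - s) / e) e^-1.
  have -> : (fun x : R => (x - s) / e) = (fun x => e^-1 *: x) + cst (- s / e).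
    by apply/funext => y; rewrite /cst /GRing.scale/= fctE; ring.
  by apply: is_derive_eq; rewrite addr0 [_ *: _]mulr1.
have ? := is_derive_smooth_step ((x - s) / e).
rewrite /bump_at [e^-1 * bump _]mulrC.
exact: (@is_derive1_comp _ smooth_step (fun x => (x - s) / e)).
Qed.

Lemma continuous_bump_at s e : continuous (bump_at s e).
Proof.
move=> x; apply: cvgM; first exact: cvg_cst.
apply: continuous_comp; last exact: continuous_bump.
by apply: cvgM; [apply: cvgB; [exact: cvg_id|exact: cvg_cst]|exact: cvg_cst].
Qed.

Lemma bump_at_out s e x : 0 < e -> (x < s) || (s + e < x) -> bump_at s e x = 0.
Proof.
move=> e0 h; rewrite /bump_at bump_out ?mulr0//.
by rewrite ltr_pdivlMr// mul1r ltr_pdivrMr// mul0r subr_lt0 ltrBrDl.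
Qed.

Lemma test_function_steps s t e : 0 < e -> 0 < s -> s <= t -> t + e < 1 ->
  test_function (fun x => smooth_step ((x - s) / e) - smooth_step ((x - t) / e)).
Proof.
move=> e0 s0 st te1.
set phi := fun x => _.
have cl : closure [set x | phi x != 0] `<=` `[s, t + e].
  have -> : `[s, t + e]%classic = closure `[s, t + e]%classic.
    by apply/closure_id; exact: interval_closed.
  apply: closure_subset => x /=; rewrite in_itv/=; apply: contraR.
  rewrite negb_and -!ltNge => /orP[xs|xt]; apply/eqP; rewrite /phi.
    by rewrite !smooth_step0 ?subrr// ler_pdivrMr// mul0r subr_le0 ?(le_trans (ltW xs))// ltW.
  rewrite !smooth_step1 ?subrr// ler_pdivlMr// mul1r lerBrDl ltW//.
  by apply: le_lt_trans xt; rewrite lerD2r.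
split.
- apply/smoothP => n.
  rewrite (_ : phi = fun x => smooth_step (e^-1 * x + (- s / e)) +
    cst (-1) x * smooth_step (e^-1 * x + (- t / e))); last first.
    apply/funext => x; rewrite /phi /= mulN1r.
    by congr (smooth_step _ - smooth_step _); ring.
  apply: ntimes_derivableD; first by apply: ntimes_derivable_affine;
    exact: ntimes_derivable_smooth_step.
  apply: ntimes_derivableM; first exact: ntimes_derivable_cst.
  by apply: ntimes_derivable_affine; exact: ntimes_derivable_smooth_step.
- apply: (subclosed_compact _ (@segment_compact _ s (t + e)) cl).
  exact: closed_closure.
- move=> x /cl; rewrite /= !in_itv/= => /andP[sx xt].
  by rewrite (lt_le_trans s0)// (le_lt_trans xt).
Qed.

Lemma derive1_steps s t e x :
  derive1 (fun x => smooth_step ((x - s) / e) - smooth_step ((x - t) / e)) x =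
  bump_at s e x - bump_at t e x.
Proof.
have := is_derive_step_at s e x; have := is_derive_step_at t e x => ? ?.
rewrite derive1E; apply: derive_val.
Qed.

End Bump.

Section BoundedIntegrands.
Context {R : realType}.
Local Notation mu := (@lebesgue_measure R).

Lemma aeS (P Q : R -> Prop) : (forall x, P x -> Q x) ->
  {ae mu, forall x, P x} -> {ae mu, forall x, Q x}.
Proof. exact: (@filterS _ _ (ae_filter_ringOfSetsType mu)). Qed.

Lemma aeS2 (P Q S : R -> Prop) : (forall x, P x -> Q x -> S x) ->
  {ae mu, forall x, P x} -> {ae mu, forall x, Q x} -> {ae mu, forall x, S x}.
Proof. exact: (@filterS2 _ _ (ae_filter_ringOfSetsType mu)). Qed.

Lemma integrable_mul_bounded (D : set (measurableTypeR R)) (f g : R -> R) (B : R) :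
  measurable D -> mu.-integrable D (EFin \o f) -> measurable_fun D g ->
  (forall x, D x -> `|g x| <= B) -> mu.-integrable D (fun x => (f x * g x)%:E).
Proof.
move=> mD fi mg gB.
apply: (@integrableMl _ _ _ mu D mD _ g fi mg).
exists B; split; first by rewrite num_real.
by move=> x xB y Dy /=; exact: le_trans (gB _ Dy) (ltW xB).
Qed.

Lemma integrable_bounded (D : set (measurableTypeR R)) (g : R -> R) (B : R) :
  measurable D -> (mu D < +oo)%E -> measurable_fun D g ->
  (forall x, D x -> `|g x| <= B) -> mu.-integrable D (EFin \o g).
Proof.
move=> mD Dy mg gB; apply: measurable_bounded_integrable => //.
exists B; split; first by rewrite num_real.
by move=> x xB y Dx /=; exact: le_trans (gB _ Dx) (ltW xB).
Qed.

Lemma lebesgue_measure_I01 : (mu I01 = 1)%E.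
Proof. by rewrite lebesgue_measure_itv/= lte_fin ltr01 oppr0 adde0. Qed.

Lemma measurable_itvT (i : interval R) :
  measurable ([set` i] : set (measurableTypeR R)).
Proof. exact: measurable_itv. Qed.

Lemma measurable_I01 : measurable (I01 : set (measurableTypeR R)).
Proof. exact: measurable_itv. Qed.

Lemma integrable_cst01 (c : R) : mu.-integrable I01 (EFin \o cst c).
Proof.
apply: (@integrable_bounded _ _ `|c|) => //.
by rewrite lebesgue_measure_I01 ltry.
Qed.

Lemma integrable_EFinB (D : set (measurableTypeR R)) (f g : R -> R) : measurable D ->
  mu.-integrable D (fun x => (f x)%:E) -> mu.-integrable D (fun x => (g x)%:E) ->
  mu.-integrable D (fun x => (f x - g x)%:E).
Proof.
by move=> mD fi gi; under eq_fun do rewrite EFinB; exact: integrableB.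
Qed.

End BoundedIntegrands.

Section DuBoisReymond.
Context {R : realType}.
Local Notation mu := (@lebesgue_measure R).
Implicit Types (s t e x : R) (w : R -> R).

Lemma integral_bump_at s e : 0 < e -> 0 < s -> s + e < 1 ->
  (\int[mu]_(x in I01) (bump_at s e x)%:E = 1)%E.
Proof.
move=> e0 s0 se1.
have sub : `[s, s + e]%classic `<=` (I01 : set R).
  move=> x /=; rewrite !in_itv/= => /andP[sx xs].
  by rewrite (lt_le_trans s0)// (le_lt_trans xs).
have -> : (\int[mu]_(x in I01) (bump_at s e x)%:E =
    \int[mu]_(x in `[s, (s + e)%R]) (bump_at s e x)%:E)%E.
  rewrite [RHS]integral_mkcond [LHS]integral_mkcond; apply: eq_integral => x _.
  rewrite !patchE; case: ifPn => [x01|xN]; case: ifPn => //.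
    move=> xN; congr EFin; apply: bump_at_out => //.
    by move: xN; rewrite notin_setE /= in_itv/= => /negP; rewrite negb_and -!ltNge.
  by move=> /set_mem/sub h; move: xN; rewrite notin_setE.
rewrite (@continuous_FTC2 _ _ (fun x => smooth_step ((x - s) / e))).
- have -> : (s + e - s) / e = 1 by field; rewrite gt_eqF.
  by rewrite subrr mul0r (@smooth_step0 _ 0)// (@smooth_step1 _ 1)// -EFinB subr0.
- by rewrite ltrDl.
- by apply: continuous_subspaceT => x; exact: continuous_bump_at.
- have c : continuous (fun x => smooth_step ((x - s) / e)).
    move=> x; apply: derivable_continuous; have ? := is_derive_step_at s e x.
    exact: ex_derive.
  split; first by move=> x _; have ? := is_derive_step_at s e x; exact: ex_derive.
    by apply: cvg_at_right_filter; exact: c.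
  by apply: cvg_at_left_filter; exact: c.
- move=> x _; have ? := is_derive_step_at s e x.
  by rewrite derive1E; exact: derive_val.
Qed.

Lemma bump_at_bounded s e : 0 < e ->
  exists2 B : R, 0 < B & forall x, `|bump_at s e x| <= B / e.
Proof.
move=> e0; have [B B0 HB] := @bump_bounded R.
exists B => // x; rewrite /bump_at normrM gtr0_norm ?invr_gt0// mulrC.
by rewrite ler_wpM2r// invr_ge0 ltW.
Qed.

Lemma measurable_bump_at s e (D : set (measurableTypeR R)) :
  measurable_fun D (bump_at s e).
Proof.
apply: measurable_funTS; apply: measurable_realfun.continuous_measurable_fun.
exact: continuous_bump_at.
Qed.

Lemma integrable_mul_bump_at w s e : 0 < e ->
  mu.-integrable I01 (EFin \o w) ->
  mu.-integrable I01 (fun x => (w x * bump_at s e x)%:E).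
Proof.
move=> e0 wi; have [B B0 HB] := bump_at_bounded s e0.
apply: (integrable_mul_bounded (measurable_itv _) wi); last by move=> x _; exact: HB.
exact: measurable_bump_at.
Qed.

(** Up to the factor 2 B, where B bounds the bump, the error is at most the mean
    value of |w - w s| on ball s e, which tends to 0 at a Lebesgue point. *)
Lemma mollify_cvg w s : 0 < s < 1 -> mu.-integrable I01 (EFin \o w) ->
  lebesgue_pt w s -> forall d : R, 0 < d ->
  \forall e \near (0 : R)^'+,
    `|\int[mu]_(x in I01) (w x * bump_at s (e / 2) x) - w s| <= d.
Proof.
move=> /andP[s0 s1] wi lw d d0.
have [B B0 HB] := @bump_bounded R.
have dB : 0 < d / (4 * B) by rewrite divr_gt0// mulr_gt0.
have lw2 : \forall r \near (0 : R)^'+, (davg w s r < (d / (4 * B))%:E)%E.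
  have : nbhs (0 : \bar R)%E (fun z => (z < (d / (4 * B))%:E)%E).
    by apply: open_ereal_lt'; rewrite lte_fin.
  by move/lw; apply.
near=> e.
have e0 : 0 < e by near: e; exact: nbhs_right_gt.
have se1 : s + e < 1.
  by rewrite -ltrBrDl; near: e; apply: nbhs_right_lt; rewrite subr_gt0.
have se0 : 0 < s - e.
  by rewrite subr_gt0; near: e; apply: nbhs_right_lt.
have e20 : 0 < e / 2 by rewrite divr_gt0.
have ee2 : e / 2 < e by rewrite ltr_pdivrMr// ltr_pMr// ltr1n.
have be : (davg w s e < (d / (4 * B))%:E)%E by near: e.
(* the radius e / 2 keeps the support of the bump inside ball s e *)
pose g := bump_at s (e / 2).
have gi := integrable_mul_bump_at s e20 wi.
have ci := integrable_mul_bump_at s e20 (integrable_cst01 (w s)).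
have sub : ball s e `<=` (I01 : set R).
  move=> x; rewrite ball_itv/= !in_itv/= => /andP[sx xs].
  by rewrite (lt_trans se0)// (lt_trans xs).
have mb : measurable (ball s e : set (measurableTypeR R)).
  by rewrite ball_itv; exact: measurable_itv.
have -> : w s = \int[mu]_(x in I01) (w s * bump_at s (e / 2) x).
  rewrite RintegralZl//; last first.
    have := integrable_mul_bump_at s e20 (integrable_cst01 1).
    by apply: eq_integrable => // x _; rewrite /= mul1r.
  rewrite /Rintegral integral_bump_at//= ?mulr1//.
  by rewrite (lt_trans _ se1)// ltrD2l.
rewrite -RintegralB//.
rewrite (le_trans (le_normr_Rintegral _ _))//.
  exact: integrable_EFinB.
rewrite -lee_fin /Rintegral fineK; last first.
  have := integrable_abse (integrable_EFinB measurable_I01 gi ci).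
  by move=> /integrable_fin_num; apply.
have wbi : mu.-integrable (ball s e) (EFin \o w) by exact: integrableS wi.
have cbi : mu.-integrable (ball s e) (EFin \o cst (w s)).
  by apply: (integrableS measurable_I01) => //; exact: integrable_cst01.
have wbc : mu.-integrable (ball s e) (fun x => `|w x - w s|%:E).
  have := integrable_EFinB mb wbi cbi; exact: integrable_abse.
pose h x := ((2 * B / e)%:E * `|w x - w s|%:E)%E.
have hE : (\int[mu]_(x in ball s e) h x =
    (2 * B / e)%:E * \int[mu]_(x in ball s e) `|w x - w s|%:E)%E.
  rewrite /h ge0_integralZl//.
  - by have /integrableP[] := wbc.
  - by rewrite lee_fin divr_ge0 ?mulr_ge0// ltW.
apply: (@le_trans _ _ (\int[mu]_(x in ball s e) h x)%E).
  rewrite -{1}(setIidr sub) integral_mkcondr; apply: ge0_le_integral => //.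
  - have := integrable_abse (integrable_EFinB measurable_I01 gi ci).
    by move=> /integrableP[].
  - apply/measurable_restrict => //; rewrite (setIidr sub).
    by apply: measurable_funeM; have /integrableP[] := wbc.
  - move=> x x01; rewrite patchE; case: ifPn => [xb|].
      rewrite /h -EFinM lee_fin -mulrBl normrM mulrC ler_wpM2r// normrM.
      rewrite gtr0_norm ?invr_gt0// invf_div mulrAC ler_pM2r ?invr_gt0//.
      by rewrite ler_pM2l.
    rewrite notin_setE ball_itv/= in_itv/= => /negP; rewrite negb_and -!leNgt => out.
    rewrite bump_at_out ?mulr0 ?subrr ?normr0//.
    case/orP: out => out; first by rewrite (le_lt_trans out)// ltrBlDr ltrDl.
    by rewrite (lt_le_trans _ out) ?orbT// ltrD2l.
rewrite hE.
move: be; rewrite /davg /iavg (lebesgue_measure_ball _ (ltW e0)).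
have IE := fineK (integrable_fin_num mb wbc).
rewrite -[(\int[mu]_(y in ball s e) _)%E]/(\int[mu]_(y in ball s e) `|w y - w s|%:E)%E.
rewrite -IE; set I := fine _.
rewrite inver mulrn_eq0/= gt_eqF// -!EFinM lte_fin lee_fin.
rewrite ltr_pdivrMl ?pmulrn_lgt0// => hI.
rewrite -ler_pdivlMl ?divr_gt0 ?mulr_gt0//; apply: le_trans (ltW hI) _.
rewrite le_eqVlt; apply/orP; left; apply/eqP; field.
by rewrite !gt_eqF.
Unshelve. all: by end_near. Qed.

(** Tested with the difference of two steps, the hypothesis says that the
    mollifications of w at s and at t agree; in the limit, so do the values of w
    at any two Lebesgue points. *)
Lemma du_bois_reymond w : mu.-integrable I01 (EFin \o w) ->
  (forall phi, test_function phi ->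
     (\int[mu]_(x in I01) (w x * derive1 phi x)%:E = 0)%E) ->
  exists c : R, {ae mu, forall x, I01 x -> w x = c}.
Proof.
move=> wi w0.
pose w' : R -> R := w \_ I01.
have w'E x : I01 x -> w' x = w x by move=> x01; rewrite /w' patchE mem_set.
have w'i : mu.-integrable I01 (EFin \o w').
  by apply: eq_integrable wi => // x x01; rewrite /= w'E//; exact: set_mem.
have lw : {ae mu, forall x, lebesgue_pt w' x}.
  by apply: lebesgue_differentiation; exact: integrable_locally_restrict.
have eq_lt s t : I01 s -> I01 t -> lebesgue_pt w' s -> lebesgue_pt w' t ->
    s < t -> w s = w t.
  move=> /[dup] s01 /=; rewrite in_itv/= => s01' /[dup] t01 /=; rewrite in_itv/= => t01'.
  move=> ls lt st; apply/eqP; rewrite -subr_eq0 -normr_le0; apply/ler_addgt0Pl => d d0.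
  rewrite addr0; have d20 : 0 < d / 2 by rewrite divr_gt0.
  suff : \forall e \near (0 : R)^'+, `|w s - w t| <= d by case/filter_ex.
  near=> e.
  have e0 : 0 < e by near: e; exact: nbhs_right_gt.
  have te1 : t + e < 1.
    rewrite -ltrBrDl; near: e; apply: nbhs_right_lt; rewrite subr_gt0.
    by case/andP: t01'.
  have e20 : 0 < e / 2 by rewrite divr_gt0.
  have ee2 : e / 2 < e by rewrite ltr_pdivrMr// ltr_pMr// ltr1n.
  have es : `|\int[mu]_(x in I01) (w' x * bump_at s (e / 2) x) - w' s| <= d / 2.
    by near: e; apply: (mollify_cvg s01' w'i ls d20).
  have et : `|\int[mu]_(x in I01) (w' x * bump_at t (e / 2) x) - w' t| <= d / 2.
    by near: e; apply: (mollify_cvg t01' w'i lt d20).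
  have test := @test_function_steps R s t (e / 2) e20 (proj1 (andP s01')) (ltW st).
  have /test/w0 : t + e / 2 < 1 by rewrite (lt_trans _ te1)// ltrD2l.
  have -> : (\int[mu]_(x in I01) (w x * derive1
      (fun x => smooth_step ((x - s) / (e / 2)) - smooth_step ((x - t) / (e / 2))) x)%:E =
      \int[mu]_(x in I01) (w' x * bump_at s (e / 2) x - w' x * bump_at t (e / 2) x)%:E)%E.
    by apply: eq_integral => x /set_mem x01; rewrite derive1_steps mulrBr w'E.
  move=> /(congr1 fine); rewrite -/(Rintegral _ _ _) RintegralB//;
    [|exact: integrable_mul_bump_at..].
  move=> /eqP; rewrite subr_eq0 => /eqP e_eq.
  move: es et; rewrite e_eq (w'E s s01) (w'E t t01).
  move: (Rintegral _ _ _) => i hs ht.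
  apply: le_trans (ler_distD i _ _) _; rewrite (splitr d) [X in X + _]distrC.
  exact: lerD hs ht.
have [[x0 [x01 lx0]]|no] := pselect (exists x, I01 x /\ lebesgue_pt w' x).
  exists (w x0); apply: aeS lw => x lx xI.
  by have [xx0|x0x|->//] := ltgtP x x0; [exact: eq_lt|apply/esym; exact: eq_lt].
exists 0; apply: aeS lw => x lx xI.
by exfalso; apply: no; exists x.
Unshelve. all: by end_near. Qed.

End DuBoisReymond.

(** * Charges and their distribution functions *)

Lemma integrable_restrict_I01 {R : realType}
    (m : {measure set (measurableTypeR R) -> \bar R}) (q : R -> R) :
  m.-integrable I01 (EFin \o q) -> m.-integrable setT (EFin \o (q \_ I01)).
Proof.
move=> qi; apply/(integrable_mkcond _ measurableT).
have := (integrable_mkcond _ (@measurable_I01 R)).1 qi.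
apply: eq_integrable => // x _; rewrite patch_setT /= !patchE.
by case: ifP.
Qed.

Section TriangleFubini.
Context {R : realType}.
Local Notation mu := (@lebesgue_measure R).
Local Notation T := (measurableTypeR R).
Variable m : {sigma_finite_measure set T -> \bar R}.
Variables p q : R -> R.
Hypothesis ip : mu.-integrable I01 (EFin \o p).
Hypothesis iq : m.-integrable I01 (EFin \o q).

Let pI : T -> R := p \_ I01.
Let qI : T -> R := q \_ I01.

Let tri (z : T * T) : R := if (z.2 <= z.1 :> R) then pI z.1 * qI z.2 else 0.

Let integrable_pI : mu.-integrable setT (EFin \o pI).
Proof. exact: integrable_restrict_I01. Qed.

Let integrable_qI : m.-integrable setT (EFin \o qI).
Proof. exact: integrable_restrict_I01. Qed.

Let measurable_pI : measurable_fun setT pI.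
Proof. by have /integrableP[/measurable_EFinP] := integrable_pI. Qed.

Let measurable_qI : measurable_fun setT qI.
Proof. by have /integrableP[/measurable_EFinP] := integrable_qI. Qed.

Let measurable_tri : measurable_fun setT tri.
Proof.
apply: measurable_fun_ifT.
- by apply: measurable_fun_ler; [exact: measurable_snd|exact: measurable_fst].
- apply: measurable_funM.
  + by apply: measurableT_comp; [exact: measurable_pI|exact: measurable_fst].
  + by apply: measurableT_comp; [exact: measurable_qI|exact: measurable_snd].
- exact: measurable_cst.
Qed.

Let integrable_tri : (mu \x m)%E.-integrable setT (EFin \o tri).
Proof.
apply/integrable12ltyP; first exact/measurable_EFinP.
apply: (@le_lt_trans _ _ (\int[mu]_t (`|pI t|%:E * \int[m]_x `|qI x|%:E))%E).
  apply: ge0_le_integral => //.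
  - by move=> t _; exact: integral_ge0.
  - apply: (@measurable_fun_fubini_tonelli_F _ _ _ _ _ m (fun z => `|(EFin \o tri) z|%E)) => //.
    by apply: measurableT_comp => //; exact/measurable_EFinP.
  - apply: emeasurable_funM; last exact: measurable_cst.
    by apply/measurable_EFinP; apply: measurableT_comp.
  - move=> t _; rewrite -ge0_integralZl//.
    + apply: ge0_le_integral => //.
      * by apply: measurableT_comp => //; apply/measurable_EFinP;
          apply: (measurableT_comp measurable_tri); exact: measurable_pair1.
      * apply: emeasurable_funM; first exact: measurable_cst.
        by apply/measurable_EFinP; apply: measurableT_comp.
      * move=> x _; rewrite /tri /=; case: ifP => _; first by rewrite normrM.
        by rewrite normr0 lee_fin mulr_ge0.
    + by apply/measurable_EFinP; apply: measurableT_comp.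
have qf : (\int[m]_x `|qI x|%:E)%E \is a fin_num.
  exact: (integrable_fin_num measurableT (integrable_abse integrable_qI)).
rewrite -(fineK qf) ge0_integralZr//.
- have pf : (\int[mu]_x `|pI x|%:E)%E \is a fin_num.
    exact: (integrable_fin_num measurableT (integrable_abse integrable_pI)).
  by rewrite -(fineK pf) -EFinM ltry.
- by apply/measurable_EFinP; apply: measurableT_comp.
- by rewrite lee_fin fine_ge0// integral_ge0.
Qed.

(** Both sides integrate p t * q x over the triangle 0 < x <= t < 1. *)
Lemma triangle_Fubini :
  \int[mu]_(t in I01) (p t * \int[m]_(x in `]0%R, t]) q x) =
  \int[m]_(x in I01) (q x * \int[mu]_(t in `[x, 1%R[) p t).
Proof.
have inner1 t : (\int[m]_x (EFin \o tri) (t, x) =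
    (((fun t => p t * \int[m]_(x in `]0%R, t]) q x) \_ I01) t)%:E)%E.
  rewrite patchE; case: ifPn => [/set_mem t01|tN]; last first.
    rewrite [LHS]integral0_eq// => x _; rewrite /= /tri; case: ifP => // _.
    by rewrite /pI patchE (negbTE tN) mul0r.
  have sub : `]0, t]%classic `<=` (I01 : set R).
    move: t01; rewrite /= in_itv/= => /andP[t0 t1] x /=.
    by rewrite !in_itv/= => /andP[-> xt]; rewrite (le_lt_trans xt).
  have qt : m.-integrable `]0%R, t] (EFin \o q) by exact: integrableS iq.
  rewrite -RintegralZl// /Rintegral fineK; last first.
    apply: (integrable_fin_num (measurable_itvT _)).
    exact: (integrableZl (measurable_itvT _) (p t) qt).
  rewrite [RHS]integral_mkcond; apply: eq_integral => x _.
  rewrite patchE /= /tri /=; case: ifPn => xt.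
    rewrite /pI patchE mem_set// /qI patchE; case: ifPn => [/set_mem x01|xN].
      rewrite mem_set//= in_itv/= xt andbT.
      by move: x01; rewrite /= in_itv/= => /andP[].
    have xN' : x \notin `]0%R, t]%classic by apply: contraNN xN => /set_mem/sub/mem_set.
    by rewrite (negbTE xN') mulr0.
  by rewrite memNset//= in_itv/= (negbTE xt) andbF.
have inner2 x : (\int[mu]_t (EFin \o tri) (t, x) =
    (((fun x => q x * \int[mu]_(t in `[x, 1%R[) p t) \_ I01) x)%:E)%E.
  rewrite patchE; case: ifPn => [/set_mem x01|xN]; last first.
    rewrite [LHS]integral0_eq// => t _; rewrite /= /tri; case: ifP => // _.
    by rewrite /qI patchE (negbTE xN) mulr0.
  have sub : `[x, 1[%classic `<=` (I01 : set R).
    move: x01; rewrite /= in_itv/= => /andP[x0 x1] t /=.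
    by rewrite !in_itv/= => /andP[xt ->]; rewrite (lt_le_trans x0).
  have qt : mu.-integrable `[x, 1%R[ (EFin \o p) by exact: integrableS ip.
  rewrite -RintegralZl// /Rintegral fineK; last first.
    apply: (integrable_fin_num (measurable_itvT _)).
    exact: (integrableZl (measurable_itvT _) (q x) qt).
  rewrite [RHS]integral_mkcond; apply: eq_integral => t _.
  rewrite patchE /= /tri /=; case: ifPn => xt.
    rewrite /qI patchE mem_set// /pI patchE; case: ifPn => [/set_mem t01|tN].
      rewrite mem_set//= ?in_itv/= ?xt//=; first by rewrite mulrC.
      by move: t01; rewrite /= in_itv/= => /andP[].
    have tN' : t \notin `[x, 1%R[%classic by apply: contraNN tN => /set_mem/sub/mem_set.
    by rewrite (negbTE tN') mul0r.
  by rewrite memNset//= in_itv/= (negbTE xt).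
have := Fubini integrable_tri.
under eq_integral do rewrite inner1.
under [RHS]eq_integral do rewrite inner2.
by move=> h; rewrite Rintegral_mkcond [RHS]Rintegral_mkcond /Rintegral h.
Qed.

End TriangleFubini.

Section MeasureDistribution.
Context {R : realType}.
Local Notation mu := (@lebesgue_measure R).
Local Notation T := (measurableTypeR R).
Variable m : {finite_measure set T -> \bar R}.
Implicit Types (s t e : R).

Definition mdist t : R := fine (m `]0, t]).

Let m_fin (A : set T) : measurable A -> m A \is a fin_num.
Proof. exact: fin_num_measure. Qed.

Lemma fine_measure_le (A B : set T) : measurable A -> measurable B -> A `<=` B ->
  fine (m A) <= fine (m B).
Proof.
by move=> mA mB AB; apply: fine_le; [exact: m_fin|exact: m_fin|
  apply: le_measure => //; rewrite inE].
Qed.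

Lemma mdist_ge0 t : 0 <= mdist t.
Proof. by rewrite fine_ge0. Qed.

Lemma mdist_le t : mdist t <= fine (m setT).
Proof. by apply: fine_measure_le => //; exact: measurable_itvT. Qed.

Lemma mdist_nondecreasing : {homo mdist : s t / s <= t}.
Proof.
move=> s t st; apply: fine_measure_le; [exact: measurable_itvT..|].
by move=> x /=; rewrite !in_itv/= => /andP[-> xs]; rewrite (le_trans xs).
Qed.

Lemma measurable_mdist (D : set T) : measurable_fun D mdist.
Proof.
apply: measurable_funTS; apply: nondecreasing_measurable => //.
exact: mdist_nondecreasing.
Qed.

(** Continuity from above along intervals shrinking to the empty set; it
    yields the one-sided limits of every distribution function. *)
Lemma measure_shrink (F : (set T)^nat) e : 0 < e -> (forall n, measurable (F n)) ->
  {homo F : n k / (n <= k)%N >-> (k <= n)%O} -> \bigcap_n F n = set0 ->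
  exists n, fine (m (F n)) <= e.
Proof.
move=> e0 mF hF F0.
have := @nonincreasing_cvg_mu _ _ _ m F; rewrite F0 measure0 => h.
have {h} : (m \o F) n @[n --> \oo] --> (0 : \bar R)%E.
  by apply: h => //; rewrite ltey_eq m_fin.
move=> /(_ [set z | (z < e%:E)%E]) h.
have /h[n _ /(_ n (leqnn n))/= Fn] : nbhs (0 : \bar R)%E [set z | (z < e%:E)%E].
  by apply: open_ereal_lt'; rewrite lte_fin.
exists n; rewrite -lee_fin fineK ?m_fin//; exact: ltW.
Qed.

Lemma measure_small_right t e : 0 < e ->
  exists2 d : R, 0 < d & fine (m `]t, t + d]) <= e.
Proof.
move=> e0.
have [|||n Hn] := @measure_shrink (fun n => `]t, t + n.+1%:R^-1]%classic) e e0.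
- by move=> n; exact: measurable_itvT.
- move=> n k nk; apply/subsetPset => x /=; rewrite !in_itv/= => /andP[-> h].
  by rewrite (le_trans h)// lerD2l lef_pV2 ?posrE// ler_nat.
- apply/seteqP; split => // x /= h.
  have tx : t < x by have := h 0%N Logic.I; rewrite /= in_itv/= => /andP[].
  have [n Hn] : exists n : nat, (x - t)^-1 < n%:R.
    by exists (Num.trunc (x - t)^-1).+1; exact: truncnS_gt.
  have := h n Logic.I; rewrite /= in_itv/= => /andP[_]; rewrite -lerBlDl leNgt => /negP.
  apply; rewrite invf_plt ?posrE ?subr_gt0// (lt_trans Hn)// ltr_nat//.
by exists n.+1%:R^-1.
Qed.

Lemma measure_small_left t e : 0 < e ->
  exists2 d : R, 0 < d & fine (m `[t - d, t[) <= e.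
Proof.
move=> e0.
have [|||n Hn] := @measure_shrink (fun n => `[t - n.+1%:R^-1, t[%classic) e e0.
- by move=> n; exact: measurable_itvT.
- move=> n k nk; apply/subsetPset => x /=; rewrite !in_itv/= => /andP[h ->].
  by rewrite (le_trans _ h)// lerD2l lerN2 lef_pV2 ?posrE// ler_nat.
- apply/seteqP; split => // x /= h.
  have tx : x < t by have := h 0%N Logic.I; rewrite /= in_itv/= => /andP[].
  have [n Hn] : exists n : nat, (t - x)^-1 < n%:R.
    by exists (Num.trunc (t - x)^-1).+1; exact: truncnS_gt.
  have := h n Logic.I; rewrite /= in_itv/= => /andP[]; rewrite lerBlDr -lerBlDl leNgt => /negP + _.
  apply; rewrite invf_plt ?posrE ?subr_gt0// (lt_trans Hn)// ltr_nat//.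
by exists n.+1%:R^-1.
Qed.

Lemma mdist_by_parts (p : R -> R) : mu.-integrable I01 (EFin \o p) ->
  \int[mu]_(t in I01) (p t * mdist t) =
  \int[m]_(x in I01) \int[mu]_(t in `[x, 1%R[) p t.
Proof.
move=> ip.
have i1 : m.-integrable I01 (EFin \o cst 1).
  by apply: finite_measure_integrable_cst; exact: measurable_I01.
have := triangle_Fubini ip i1.
under [X in _ = X -> _]eq_Rintegral do rewrite /= mul1r.
move=> <-; apply: eq_Rintegral => t _; congr (_ * _).
by rewrite Rintegral_cst ?mul1r//; exact: measurable_itvT.
Qed.

End MeasureDistribution.

Section ChargeDistribution.
Context {R : realType}.
Local Notation mu := (@lebesgue_measure R).
Local Notation T := (measurableTypeR R).
Implicit Types (nu kappa : {charge set T -> \bar R}) (s t e : R).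

Definition cdf nu t : R := fine (nu `]0, t]).

Definition cpos nu : {finite_measure set T -> \bar R} := jordan_pos (hahn_posneg nu).
Definition cneg nu : {finite_measure set T -> \bar R} := jordan_neg (hahn_posneg nu).

Lemma charge_fin nu (A : set T) : measurable A -> nu A \is a fin_num.
Proof. exact: fin_num_measure. Qed.

Lemma charge_posneg nu (A : set T) : measurable A -> nu A = (cpos nu A - cneg nu A)%E.
Proof.
by move=> mA; rewrite (jordan_decomp (hahn_posneg nu) mA) /cadd/= cscaleN1.
Qed.

Lemma fine_charge_posneg nu (A : set T) : measurable A ->
  fine (nu A) = fine (cpos nu A) - fine (cneg nu A).
Proof.
move=> mA; rewrite charge_posneg// fineB//; exact: fin_num_measure.
Qed.

Lemma cdfE nu t : cdf nu t = mdist (cpos nu) t - mdist (cneg nu) t.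
Proof. by rewrite /cdf fine_charge_posneg//; exact: measurable_itvT. Qed.

Lemma measurable_cdf nu (D : set T) : measurable_fun D (cdf nu).
Proof.
rewrite (_ : cdf nu = mdist (cpos nu) \- mdist (cneg nu)).
  by apply: measurable_funB; exact: measurable_mdist.
by apply/funext => t; rewrite cdfE.
Qed.

Lemma cdf_bounded nu : exists2 B : R, 0 <= B & forall t, `|cdf nu t| <= B.
Proof.
exists (fine (cpos nu setT) + fine (cneg nu setT)).
  by rewrite addr_ge0// fine_ge0.
move=> t; rewrite cdfE (le_trans (ler_normB _ _))//.
by rewrite !ger0_norm ?mdist_ge0// lerD ?mdist_le.
Qed.

Lemma integrable_cdf nu : mu.-integrable I01 (EFin \o cdf nu).
Proof.
have [B B0 HB] := cdf_bounded nu.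
apply: (@integrable_bounded _ _ _ B) => //.
- by rewrite lebesgue_measure_I01 ltry.
- exact: measurable_cdf.
Qed.

(** Integration by parts against a primitive vanishing at 1. *)
Lemma cdf_by_parts nu (p : R -> R) : mu.-integrable I01 (EFin \o p) ->
  \int[mu]_(t in I01) (p t * cdf nu t) =
  \int[cpos nu]_(x in I01) \int[mu]_(t in `[x, 1%R[) p t -
  \int[cneg nu]_(x in I01) \int[mu]_(t in `[x, 1%R[) p t.
Proof.
move=> ip; rewrite -!mdist_by_parts//.
have im (m : {finite_measure set T -> \bar R}) :
    mu.-integrable I01 (fun t => (p t * mdist m t)%:E).
  apply: (@integrable_mul_bounded _ _ _ _ (fine (m setT))) => //.
  - exact: measurable_mdist.
  - by move=> t _; rewrite ger0_norm ?mdist_ge0// mdist_le.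
rewrite -RintegralB//; [|exact: im..].
by apply: eq_Rintegral => t _; rewrite cdfE mulrBr.
Qed.

Lemma fine_chargeU nu (A B : set T) : measurable A -> measurable B ->
  A `&` B = set0 -> fine (nu (A `|` B)) = fine (nu A) + fine (nu B).
Proof.
by move=> mA mB AB; rewrite chargeU// fineD// charge_fin.
Qed.

Lemma cdfB nu s t : 0 <= s -> s <= t -> cdf nu t - cdf nu s = fine (nu `]s, t]).
Proof.
move=> s0 st; rewrite /cdf.
have -> : `]0, t]%classic = `]0, s] `|` `]s, t] :> set R.
  by rewrite -itv_bndbnd_setU// bnd_simp.
rewrite fine_chargeU; [by rewrite addrAC subrr add0r|exact: measurable_itvT..|].
apply/seteqP; split => // x [] /=; rewrite !in_itv/= => /andP[_ xs] /andP[sx _].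
by move: (lt_le_trans sx xs); rewrite ltxx.
Qed.

Lemma fine_charge_le nu (A B : set T) : measurable A -> measurable B -> A `<=` B ->
  `|fine (nu A)| <= fine (cpos nu B) + fine (cneg nu B).
Proof.
move=> mA mB AB; rewrite fine_charge_posneg// (le_trans (ler_normB _ _))//.
by rewrite !ger0_norm ?fine_ge0// lerD// fine_measure_le.
Qed.

Lemma cdf_right_continuous nu t e : 0 <= t -> 0 < e -> exists2 d : R, 0 < d &
  forall s, t <= s -> s <= t + d -> `|cdf nu s - cdf nu t| <= e.
Proof.
move=> t0 e0; have e20 : 0 < e / 2 by rewrite divr_gt0.
have [d1 d10 h1] := measure_small_right (cpos nu) t e20.
have [d2 d20 h2] := measure_small_right (cneg nu) t e20.
exists (Num.min d1 d2); first by rewrite lt_min d10.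
move=> s ts sd; rewrite cdfB// (splitr e).
apply: (@le_trans _ _ (fine (cpos nu `]t, s]) + fine (cneg nu `]t, s]))).
  by apply: fine_charge_le => //; exact: measurable_itvT.
have sub d : Num.min d1 d2 <= d -> `]t, s]%classic `<=` `]t, t + d]%classic.
  move=> dd x /=; rewrite !in_itv/= => /andP[-> xs]/=.
  by rewrite (le_trans xs)// (le_trans sd)// lerD2l.
apply: lerD; [apply: le_trans h1|apply: le_trans h2]; apply: fine_measure_le;
  try exact: measurable_itvT; apply: sub; rewrite ge_min lexx ?orbT//.
Qed.

(** The left limit of the distribution function falls short of its value by the
    atom at t. *)
Lemma cdf_left_limit nu t e : 0 < t -> 0 < e -> exists2 d : R, 0 < d &
  forall s, 0 <= s -> t - d <= s -> s < t ->
    `|cdf nu s - (cdf nu t - fine (nu [set t]))| <= e.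
Proof.
move=> t0 e0; have e20 : 0 < e / 2 by rewrite divr_gt0.
have [d1 d10 h1] := measure_small_left (cpos nu) t e20.
have [d2 d20 h2] := measure_small_left (cneg nu) t e20.
exists (Num.min d1 d2); first by rewrite lt_min d10.
move=> s s0 ds st.
have -> : cdf nu s - (cdf nu t - fine (nu [set t])) = - fine (nu `]s, t[).
  have : cdf nu t - cdf nu s = fine (nu `]s, t[) + fine (nu [set t]).
    rewrite cdfB// ?ltW// -fine_chargeU; [|exact: measurable_itvT|exact: measurable_set1|].
      congr (fine (nu _)); apply/seteqP; split => x /=; rewrite !in_itv/=.
        move=> /andP[sx]; rewrite le_eqVlt => /predU1P[->|xt]; [by right|left].
        by rewrite sx.
      by move=> [/andP[-> /ltW]//|->]; rewrite st lexx.
    apply/seteqP; split => // x [] /=; rewrite in_itv/= => /andP[_ xt] xE.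
    by move: xt; rewrite xE ltxx.
  by move=> h; rewrite opprB addrCA; lra.
rewrite normrN (splitr e).
apply: (@le_trans _ _ (fine (cpos nu `]s, t[) + fine (cneg nu `]s, t[))).
  by apply: fine_charge_le => //; exact: measurable_itvT.
have sub d : Num.min d1 d2 <= d -> `]s, t[%classic `<=` `[t - d, t[%classic.
  move=> dd x /=; rewrite !in_itv/= => /andP[sx ->]; rewrite andbT.
  by rewrite (le_trans _ (ltW sx))// (le_trans _ ds)// lerD2l lerN2.
apply: lerD; [apply: le_trans h1|apply: le_trans h2]; apply: fine_measure_le;
  try exact: measurable_itvT; apply: sub; rewrite ge_min lexx ?orbT//.
Qed.

End ChargeDistribution.

Section DistributionalDerivative.
Context {R : realType}.
Local Notation mu := (@lebesgue_measure R).
Local Notation T := (measurableTypeR R).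
Implicit Types (nu kappa : {charge set T -> \bar R}) (s t e : R) (phi w : R -> R).

Lemma test_function_out phi x : test_function phi -> ~ I01 x -> phi x = 0.
Proof.
move=> [_ _ sub] x01; apply/eqP; apply: contra_notT x01 => px.
by apply: sub; apply: subset_closure.
Qed.

Lemma test_function_derivable phi x : test_function phi -> derivable phi x 1.
Proof. by move=> [/(_ 0%N)]. Qed.

Lemma test_function_continuous phi : test_function phi -> continuous phi.
Proof. by move=> tp x; apply: derivable_continuous; exact: test_function_derivable. Qed.

Lemma test_function_deriv_continuous phi : test_function phi -> continuous (derive1 phi).
Proof. by move=> [/(_ 1%N) d _ _] x; apply: derivable_continuous; exact: d. Qed.

Lemma continuous_bounded_I01 (f : R -> R) : continuous f ->
  exists B : R, forall x, I01 x -> `|f x| <= B.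
Proof.
move=> cf.
have c : {within `[(0 : R), 1], continuous (fun x => `|f x|)}.
  by apply: continuous_subspaceT => x; apply: continuous_comp;
    [exact: cf|exact: norm_continuous].
have [x0 _ Hx0] := EVT_max ler01 c.
exists `|f x0| => x; rewrite /= in_itv/= => /andP[x0' x1]; apply: Hx0.
by rewrite in_itv/= !ltW.
Qed.

Lemma integrable_continuous_I01 (m : {finite_measure set T -> \bar R}) (f : R -> R) :
  continuous f -> m.-integrable I01 (EFin \o f).
Proof.
move=> cf; have [B HB] := continuous_bounded_I01 cf.
apply: measurable_bounded_integrable.
- exact: measurable_I01.
- by rewrite ltey_eq fin_num_measure//; exact: measurable_I01.
- by apply: measurable_funTS; exact: continuous_measurable_fun.
- exists B; split; first by rewrite num_real.
  by move=> x xB y Dx /=; exact: le_trans (HB _ Dx) (ltW xB).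
Qed.

Lemma integrable_continuous_lebesgue (f : R -> R) : continuous f ->
  mu.-integrable I01 (EFin \o f).
Proof.
move=> cf; have [B HB] := continuous_bounded_I01 cf.
apply: (@integrable_bounded _ _ _ B) => //.
- by rewrite lebesgue_measure_I01 ltry.
- by apply: measurable_funTS; exact: continuous_measurable_fun.
Qed.

Lemma integral_test_deriv phi x : test_function phi -> 0 <= x -> x < 1 ->
  \int[mu]_(t in `[x, 1%R[) derive1 phi t = - phi x.
Proof.
move=> tp x0 x1; have cphi := test_function_continuous tp.
rewrite Rintegral_itv_bndo_bndc; last first.
  have ci : mu.-integrable `[x, 1%R] (EFin \o derive1 phi).
    apply: continuous_compact_integrable; first exact: segment_compact.
    by apply: continuous_subspaceT; exact: test_function_deriv_continuous.
  apply: integrableS ci; [exact: measurable_itvT..|].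
  by move=> z /=; rewrite !in_itv/= => /andP[-> /ltW].
rewrite /Rintegral (@continuous_FTC2 _ _ phi)//.
- rewrite -EFinB/= (test_function_out tp (x := 1)) ?sub0r//.
  by rewrite /= in_itv/= ltxx andbF.
- by apply: continuous_subspaceT; exact: test_function_deriv_continuous.
- split; first by move=> z _; exact: test_function_derivable.
    by apply: cvg_at_right_filter; exact: cphi.
  by apply: cvg_at_left_filter; exact: cphi.
Qed.

Lemma integral_test_deriv0 phi : test_function phi ->
  \int[mu]_(t in I01) derive1 phi t = 0.
Proof.
move=> tp; rewrite Rintegral_itv_obnd_cbnd; last first.
  by apply: integrable_continuous_lebesgue; exact: test_function_deriv_continuous.
rewrite integral_test_deriv// (test_function_out tp) ?oppr0//.
by rewrite /= in_itv/= ltxx.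
Qed.

Lemma integral_chargeE nu phi : continuous phi ->
  integral_charge nu I01 phi =
  (\int[cpos nu]_(x in I01) phi x - \int[cneg nu]_(x in I01) phi x)%:E.
Proof.
move=> cphi; rewrite /integral_charge EFinB /Rintegral !fineK//.
  by apply: (integrable_fin_num (@measurable_I01 R)); exact: integrable_continuous_I01.
by apply: (integrable_fin_num (@measurable_I01 R)); exact: integrable_continuous_I01.
Qed.

Lemma cdf_test nu phi : test_function phi ->
  \int[mu]_(t in I01) (derive1 phi t * cdf nu t) =
  - (\int[cpos nu]_(x in I01) phi x - \int[cneg nu]_(x in I01) phi x).
Proof.
move=> tp; have cphi := test_function_continuous tp.
have cdphi := test_function_deriv_continuous tp.
rewrite cdf_by_parts; last exact: integrable_continuous_lebesgue.
have E (m : {finite_measure set T -> \bar R}) :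
    \int[m]_(x in I01) \int[mu]_(t in `[x, 1%R[) derive1 phi t =
    - \int[m]_(x in I01) phi x.
  rewrite -mulN1r -RintegralZl//; last exact: integrable_continuous_I01.
  apply: eq_Rintegral => x /set_mem; rewrite /= in_itv/= => /andP[x0 x1].
  by rewrite integral_test_deriv ?mulN1r// ltW.
by rewrite !E opprB opprK addrC.
Qed.

Lemma integrable_mul_test_deriv w phi : test_function phi ->
  mu.-integrable I01 (EFin \o w) ->
  mu.-integrable I01 (fun x => (w x * derive1 phi x)%:E).
Proof.
move=> tp wi; have cdphi := test_function_deriv_continuous tp.
have [B HB] := continuous_bounded_I01 cdphi.
apply: (integrable_mul_bounded (@measurable_I01 R) wi _ HB).
by apply: measurable_funTS; exact: continuous_measurable_fun.
Qed.

Lemma integrable_cst_cdf (c : R) nu :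
  mu.-integrable I01 (EFin \o (fun t => c + cdf nu t)).
Proof.
have -> : EFin \o (fun t => c + cdf nu t) = ((EFin \o cst c) \+ (EFin \o cdf nu))%E.
  by apply/funext.
by apply: integrableD; [exact: measurable_I01|exact: integrable_cst01|exact: integrable_cdf].
Qed.

Lemma distributional_derivative_cdf (c : R) nu :
  distributional_derivative (fun t => c + cdf nu t) nu.
Proof.
move=> phi tp; have cphi := test_function_continuous tp.
have ci := integrable_mul_test_deriv tp (integrable_cst_cdf c nu).
rewrite -[LHS]fineK; last exact: (integrable_fin_num (@measurable_I01 R) ci).
rewrite integral_chargeE// -EFinN; congr EFin.
rewrite -cdf_test// -/(Rintegral _ _ _).
have -> : \int[mu]_(t in I01) ((c + cdf nu t) * derive1 phi t) =
    \int[mu]_(t in I01) (c * derive1 phi t) + \int[mu]_(t in I01) (cdf nu t * derive1 phi t).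
  rewrite -RintegralD//; first by apply: eq_Rintegral => t _; rewrite mulrDl.
  - exact: (integrable_mul_test_deriv tp (integrable_cst01 c)).
  - exact: (integrable_mul_test_deriv tp (integrable_cdf nu)).
rewrite RintegralZl ?integral_test_deriv0 ?mulr0 ?add0r//; last first.
  by apply: integrable_continuous_lebesgue; exact: test_function_deriv_continuous.
by apply: eq_Rintegral => t _; rewrite mulrC.
Qed.

(** Every function of bounded variation is almost everywhere a constant plus
    the distribution function of its derivative: their difference is killed by
    all derivatives of test functions. *)
Lemma BV_cdf w nu : mu.-integrable I01 (EFin \o w) ->
  distributional_derivative w nu ->
  exists c : R, ae_eq01 w (fun t => c + cdf nu t).
Proof.
move=> wi dw.
have vi : mu.-integrable I01 (fun t => (w t - cdf nu t)%:E).
  by apply: integrable_EFinB => //; exact: integrable_cdf.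
have [phi tp|c Hc] := du_bois_reymond vi.
  have := dw _ tp; have := distributional_derivative_cdf 0 nu tp.
  move=> <- h.
  have i1 := integrable_mul_test_deriv tp wi.
  have i2 := integrable_mul_test_deriv tp (integrable_cdf nu).
  transitivity (\int[mu]_(x in I01) (w x * derive1 phi x - cdf nu x * derive1 phi x)%:E)%E.
    by apply: eq_integral => x _; rewrite mulrBl.
  under eq_integral do rewrite EFinB.
  rewrite integralB//.
  rewrite h; under [X in (X - _)%E]eq_integral do rewrite add0r.
  by rewrite subee//; exact: (integrable_fin_num (@measurable_I01 R) i2).
exists c; apply: aeS Hc => x Hx xI.
by rewrite -(Hx xI) subrK.
Qed.

Lemma ae_ex (P : R -> Prop) (a b : R) : a < b ->
  {ae mu, forall x, P x} -> exists x, a < x < b /\ P x.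
Proof.
move=> ab [A [mA A0 sub]]; apply/not_existsP => H.
have : `]a, b[%classic `<=` A.
  move=> x /=; rewrite in_itv/= => xab; apply: sub => /= Px.
  by apply: (H x).
move=> sA; have : (mu `]a, b[ <= mu A)%E.
  by apply: le_measure => //; rewrite inE.
rewrite A0 lebesgue_measure_itv/= lte_fin ab -EFinB lee_fin subr_le0.
by rewrite leNgt ab.
Qed.

(** Right-continuity turns equality almost everywhere into equality. *)
Lemma ae_eq_cdf_diff nu1 nu2 (c : R) : ae_eq01 (cdf nu1) (fun t => c + cdf nu2 t) ->
  forall t, I01 t -> cdf nu1 t = c + cdf nu2 t.
Proof.
move=> h t /[dup] tI /=; rewrite in_itv/= => /andP[t0 t1].
apply/eqP; rewrite -subr_eq0 -normr_le0; apply/ler_addgt0Pl => e e0; rewrite addr0.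
have e20 : 0 < e / 2 by rewrite divr_gt0.
have [d1 d10 h1] := cdf_right_continuous nu1 (ltW t0) e20.
have [d2 d20 h2] := cdf_right_continuous nu2 (ltW t0) e20.
pose d := Num.min (Num.min d1 d2) (1 - t).
have d0 : 0 < d by rewrite !lt_min d10 d20 subr_gt0.
have [|s [/andP[ts sd] hs]] := @ae_ex _ t (t + d) _ h; first by rewrite ltrDl.
have sI : I01 s.
  rewrite /= in_itv/= (lt_trans t0)//= (lt_le_trans sd)// -lerBrDl.
  by rewrite ge_min lexx orbT.
have l1 : s <= t + d1 by rewrite (le_trans (ltW sd))// lerD2l !ge_min lexx.
have l2 : s <= t + d2 by rewrite (le_trans (ltW sd))// lerD2l !ge_min lexx orbT.
have := h1 _ (ltW ts) l1; have := h2 _ (ltW ts) l2; rewrite (hs sI) => a2.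
rewrite distrC => a1.
have -> : cdf nu1 t - (c + cdf nu2 t) =
  (cdf nu1 t - (c + cdf nu2 s)) + (cdf nu2 s - cdf nu2 t) by ring.
by rewrite (le_trans (ler_normD _ _))// (splitr e) lerD.
Qed.

(** Two finite measures with the same mass on all intervals ]a, b] inside
    ]0, 1[ agree below each such interval by the pi-lambda theorem, hence on
    ]0, 1[ by exhaustion. *)
Lemma finite_measures_eq_I01 (m1 m2 : {measure set T -> \bar R}) :
  (m1 setT < +oo)%E ->
  (forall a b, 0 < a -> a <= b -> b < 1 -> m1 `]a, b] = m2 `]a, b]) ->
  forall A : set T, measurable A -> A `<=` I01 -> m1 A = m2 A.
Proof.
move=> fin1 E.
have step (a b : R) : 0 < a -> a <= b -> b < 1 ->
    forall A : set T, measurable A -> m1 (A `&` `]a, b]) = m2 (A `&` `]a, b]).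
  move=> a0 ab b1 A mA.
  pose n1 : {measure set T -> \bar R} := mrestr m1 (measurable_itvT `]a, b]%R).
  pose n2 : {measure set T -> \bar R} := mrestr m2 (measurable_itvT `]a, b]%R).
  have sub0 (x y : R) : (`]x, y] `&` `]a, b] = `]Num.max x a, Num.min y b] :> set R)%classic.
    apply/seteqP; split => z /=; rewrite !in_itv/= gt_max le_min.
      by move=> [/andP[-> ->] /andP[-> ->]].
    by move=> /andP[/andP[-> ->] /andP[-> ->]].
  have E' (x y : R) : n1 `]x, y]%classic = n2 `]x, y]%classic.
    rewrite -[LHS]/(m1 (`]x, y] `&` `]a, b])) -[RHS]/(m2 (`]x, y] `&` `]a, b])) sub0.
    have [xy|xy] := leP (Num.max x a) (Num.min y b).
      apply: E => //; first by rewrite lt_max a0 orbT.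
      by rewrite (le_lt_trans _ b1)// ge_min lexx orbT.
    by rewrite set_itv_ge ?measure0// bnd_simp -leNgt ltW.
  apply: (@measure_unique _ R T (@ocitv R) (fun n => `](- n%:R)%R, n%:R]%classic) _ _ _ _ n1 n2) => //.
  - exact: ocitvI.
  - by move=> k; exists (- k%:R, k%:R).
  - by rewrite bigcup_itvT.
  - by move=> X [[x y] _ <-]; exact: E'.
  - move=> k; apply: le_lt_trans fin1; apply: (le_measure m1) => //.
      by rewrite inE; apply: measurableI; exact: measurable_itvT.
    by rewrite inE.
move=> A mA AI.
pose G n : set T := A `&` `](n.+2%:R^-1 : R), 1 - n.+2%:R^-1].
have AG : A = \bigcup_n G n.
  apply/seteqP; split => [x Ax|x [n _ []]//].
  have := AI _ Ax; rewrite /= in_itv/= => /andP[x0 x1].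
  have x1' : 0 < 1 - x by rewrite subr_gt0.
  pose n := maxn (Num.trunc x^-1) (Num.trunc (1 - x)^-1).
  exists n => //; split => //=; rewrite in_itv/=; apply/andP; split.
    rewrite invf_plt ?posrE//; apply: (lt_trans (truncnS_gt _)).
    by rewrite ltr_nat !ltnS leq_maxl.
  rewrite lerBrDl -lerBrDr invf_ple ?posrE//; apply: (le_trans (ltW (truncnS_gt _))).
  by rewrite ler_nat ltnS (leq_trans (leq_maxr _ _) (leqnSn _)).
have mG n : measurable (G n) by apply: measurableI => //; exact: measurable_itvT.
have hG : {homo G : n k / (n <= k)%N >-> (n <= k)%O}.
  move=> n k nk; apply/subsetPset => x [Ax]; rewrite /= in_itv/= => /andP[h1 h2].
  have le : (k.+2%:R^-1 : R) <= n.+2%:R^-1 by rewrite lef_pV2 ?posrE// ler_nat.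
  split => //=; rewrite in_itv/= (le_lt_trans le)//= (le_trans h2)//.
  by rewrite lerD2l lerN2.
have mA' : measurable (\bigcup_n G n) by rewrite -AG.
have c1 := nondecreasing_cvg_mu (mu := m1) mG mA' hG.
have c2 := nondecreasing_cvg_mu (mu := m2) mG mA' hG.
rewrite AG; apply: (cvg_unique (@ereal_hausdorff R) c1) => /=.
rewrite (_ : m1 \o G = m2 \o G)//; apply/funext => n /=.
apply: step => //.
rewrite lerBrDl.
have : (n.+2%:R^-1 : R) <= 2^-1 by rewrite lef_pV2 ?posrE// ler_nat.
by move=> h; rewrite (le_trans (lerD h h))// -div1r -splitr.
Qed.

Lemma fine_sub_cross (a b c d : \bar R) : a \is a fin_num -> b \is a fin_num ->
  c \is a fin_num -> d \is a fin_num ->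
  fine a - fine b = fine c - fine d <-> (a + d = c + b)%E.
Proof.
move: a b c d => [a| |] [b| |] [c| |] [d| |]//= _ _ _ _.
by rewrite -!EFinD; split=> [e|[] e]; [congr EFin|]; lra.
Qed.

Lemma fine_inj_fin (a b : \bar R) : a \is a fin_num -> b \is a fin_num ->
  fine a = fine b -> a = b.
Proof. by move: a b => [a| |] [b| |]//= _ _ ->. Qed.

(** The measures nu1^+ + nu2^- and nu2^+ + nu1^- agree on intervals; moving the
    negative parts across makes it unnecessary to compare Jordan decompositions. *)
Lemma charges_eq_I01 nu1 nu2 (c : R) : ae_eq01 (cdf nu1) (fun t => c + cdf nu2 t) ->
  forall A : set T, measurable A -> A `<=` I01 -> nu1 A = nu2 A.
Proof.
move=> /ae_eq_cdf_diff h A mA AI.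
pose m1 : {measure set T -> \bar R} := measure_add (cpos nu1) (cneg nu2).
pose m2 : {measure set T -> \bar R} := measure_add (cpos nu2) (cneg nu1).
have m1E B : m1 B = (cpos nu1 B + cneg nu2 B)%E by exact: measure_addE.
have m2E B : m2 B = (cpos nu2 B + cneg nu1 B)%E by exact: measure_addE.
have pf nu B : measurable B -> cpos nu B \is a fin_num by exact: fin_num_measure.
have nf nu B : measurable B -> cneg nu B \is a fin_num by exact: fin_num_measure.
have cross B : measurable B -> (fine (nu1 B) = fine (nu2 B)) <-> m1 B = m2 B.
  move=> mB; rewrite m1E m2E (fine_charge_posneg nu1 mB) (fine_charge_posneg nu2 mB).
  by apply: fine_sub_cross; [exact: pf|exact: nf|exact: pf|exact: nf].
apply: fine_inj_fin; [exact: charge_fin|exact: charge_fin|].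
apply/(cross _ mA).
apply: (finite_measures_eq_I01 _ _ mA AI).
  by rewrite m1E ltey_eq fin_numD pf// nf.
move=> a b a0 ab b1; apply/cross; first exact: measurable_itvT.
rewrite -(cdfB nu1 (ltW a0) ab) -(cdfB nu2 (ltW a0) ab).
have aI : I01 a by rewrite /= in_itv/= a0 (le_lt_trans ab).
have bI : I01 b by rewrite /= in_itv/= b1 (lt_le_trans a0).
by rewrite (h a aI) (h b bI) opprD addrACA subrr add0r.
Qed.

Lemma distributional_derivative_unique w nu1 nu2 :
  mu.-integrable I01 (EFin \o w) ->
  distributional_derivative w nu1 -> distributional_derivative w nu2 ->
  forall A : set T, measurable A -> A `<=` I01 -> nu1 A = nu2 A.
Proof.
move=> wi /(BV_cdf wi)[c1 h1] /(BV_cdf wi)[c2 h2].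
apply: (@charges_eq_I01 _ _ (c2 - c1)); apply: aeS2 h1 h2 => x h1 h2 xI.
by have := h1 xI; rewrite (h2 xI) => e; lra.
Qed.

End DistributionalDerivative.

(** * Variation and Lebesgue decomposition of a charge *)

Section Variation.
Context {R : realType}.
Local Notation mu := (@lebesgue_measure R).
Local Notation T := (measurableTypeR R).
Implicit Types (nu kappa s : {charge set T -> \bar R}) (A B P N : set T).

Lemma cposE nu A : measurable A -> cpos nu A = nu (A `&` hahn_pos nu).
Proof. by move=> mA; rewrite /cpos /= jordan_posE cjordan_posE /crestr0 mem_set. Qed.

Lemma cnegE nu A : measurable A -> cneg nu A = (- nu (A `&` hahn_neg nu))%E.
Proof. by move=> mA; rewrite /cneg /= jordan_negE cjordan_negE /crestr0 mem_set. Qed.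

Lemma variation_chargeE nu A : variation_charge nu A = (cpos nu A + cneg nu A)%E.
Proof. by []. Qed.

Lemma measurable_hahn_pos nu : measurable (hahn_pos nu).
Proof. by have [[]] := hahn_posneg nu. Qed.

Lemma measurable_hahn_neg nu : measurable (hahn_neg nu).
Proof. by have [_ []] := hahn_posneg nu. Qed.

Lemma hahn_pos_ge0 nu A : measurable A -> A `<=` hahn_pos nu -> (0 <= nu A)%E.
Proof. by have [[_ h] _ _ _] := hahn_posneg nu; exact: h. Qed.

Lemma hahn_neg_le0 nu A : measurable A -> A `<=` hahn_neg nu -> (nu A <= 0)%E.
Proof. by have [_ [_ h] _ _] := hahn_posneg nu; exact: h. Qed.

Lemma hahn_split nu kappa A : measurable A ->
  kappa A = (kappa (A `&` hahn_pos nu) + kappa (A `&` hahn_neg nu))%E.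
Proof.
move=> mA; have [_ _ PN0 PNT] := hahn_posneg nu.
by apply: charge_partition => //; [exact: measurable_hahn_pos|exact: measurable_hahn_neg].
Qed.

Lemma variation_charge_eq0 nu A : measurable A ->
  variation_charge nu A = 0%E <->
  (forall B, measurable B -> B `<=` A -> nu B = 0%E).
Proof.
move=> mA; rewrite variation_chargeE; split=> [v0 B mB BA|h].
  have c0 : cpos nu A = 0%E /\ cneg nu A = 0%E.
    have := v0; have := measure_ge0 (cpos nu) A; have := measure_ge0 (cneg nu) A.
    by move=> p n /eqP; rewrite padde_eq0// => /andP[/eqP -> /eqP ->].
  have sub0 (m : {finite_measure set T -> \bar R}) : m A = 0%E -> m B = 0%E.
    move=> m0; apply/eqP; rewrite eq_le measure_ge0 andbT -m0.
    by apply: le_measure; rewrite ?inE.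
  by rewrite charge_posneg// !sub0 ?sube0//; case: c0.
rewrite cposE// cnegE// h ?h ?oppe0 ?adde0//.
- by apply: measurableI => //; exact: measurable_hahn_neg.
- by apply: measurableI => //; exact: measurable_hahn_pos.
Qed.

(** The variation may be computed from any sets on which the charge has a
    sign, so one Hahn decomposition serves a whole family of charges. *)
Lemma variation_chargeE_of nu kappa A : measurable A ->
  (forall B, measurable B -> B `<=` A `&` hahn_pos nu -> (0 <= kappa B)%E) ->
  (forall B, measurable B -> B `<=` A `&` hahn_neg nu -> (kappa B <= 0)%E) ->
  variation_charge kappa A =
  (kappa (A `&` hahn_pos nu) - kappa (A `&` hahn_neg nu))%E.
Proof.
move=> mA hp hn; rewrite variation_chargeE cposE// cnegE//.
have mP := measurable_hahn_pos; have mN := measurable_hahn_neg.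
have mI B C : measurable B -> measurable C -> measurable (B `&` C) by exact: measurableI.
have m1 := mI _ _ (mI _ _ mA (mP kappa)) (mN nu).
have m2 := mI _ _ (mI _ _ mA (mN kappa)) (mP nu).
have z1 : kappa (A `&` hahn_pos kappa `&` hahn_neg nu) = 0%E.
  apply/eqP; rewrite eq_le; apply/andP; split.
    by apply: hn => // x [[]].
  by apply: hahn_pos_ge0 => // x [[]].
have z2 : kappa (A `&` hahn_neg kappa `&` hahn_pos nu) = 0%E.
  apply/eqP; rewrite eq_le; apply/andP; split.
    by apply: hahn_neg_le0 => // x [[]].
  by apply: hp => // x [[]].
rewrite (hahn_split nu kappa (mI _ _ mA (mP kappa))) z1 adde0.
rewrite (hahn_split nu kappa (mI _ _ mA (mN kappa))) z2 add0e.
rewrite [in RHS](hahn_split kappa kappa (mI _ _ mA (mP nu))).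
rewrite [in RHS](setIAC A (hahn_pos nu) (hahn_neg kappa)) z2 adde0.
rewrite [in RHS](hahn_split kappa kappa (mI _ _ mA (mN nu))).
rewrite [in RHS](setIAC A (hahn_neg nu) (hahn_pos kappa)) z1 add0e.
by rewrite (setIAC A (hahn_pos kappa)) (setIAC A (hahn_neg kappa)).
Qed.

Lemma variation_charge_local nu kappa A : measurable A ->
  (forall B, measurable B -> B `<=` A -> nu B = kappa B) ->
  variation_charge nu A = variation_charge kappa A.
Proof.
move=> mA e.
have mP := measurable_hahn_pos nu; have mN := measurable_hahn_neg nu.
have mAP : measurable (A `&` hahn_pos nu) by exact: measurableI.
have mAN : measurable (A `&` hahn_neg nu) by exact: measurableI.
rewrite (@variation_chargeE_of nu kappa)//.
- by rewrite variation_chargeE cposE// cnegE// !e.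
- by move=> B mB BA; rewrite -e//; [apply: hahn_pos_ge0 => // x /BA[]|move=> x /BA[]].
- by move=> B mB BA; rewrite -e//; [apply: hahn_neg_le0 => // x /BA[]|move=> x /BA[]].
Qed.

(** Thinning a charge on A does not change its sign on any piece of its Hahn
    decomposition, which therefore still computes the variation. *)
Lemma variation_charge_thin nu (D A : set T) (mA : measurable A) (e : R) :
  measurable D -> A `<=` D -> 0 <= e <= 1 ->
  variation_charge (cadd nu (cscale (- e) (crestr nu mA))) D =
  (variation_charge nu D - e%:E * variation_charge nu A)%E.
Proof.
move=> mD AD /andP[e0 e1].
have mP := measurable_hahn_pos nu; have mN := measurable_hahn_neg nu.
pose kappa : {charge set T -> \bar R} := cadd nu (cscale (- e) (crestr nu mA)).
have kE0 B : kappa B = (nu B + (- e)%:E * nu (B `&` A))%E by [].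
have kE B : measurable B -> kappa B =
    (nu (B `\` A) + (1 - e)%:E * nu (B `&` A))%E.
  move=> mB; rewrite kE0 (chargeDI nu mB mA).
  have /fineK <- := charge_fin nu (measurableD mB mA).
  have /fineK <- := charge_fin nu (measurableI _ _ mB mA).
  by rewrite -!EFinM -!EFinD; congr EFin; ring.
rewrite -/kappa (@variation_chargeE_of nu kappa)//; last 2 first.
- move=> B mB BD; rewrite kE//; apply: adde_ge0.
    by apply: hahn_pos_ge0; [exact: measurableD|move=> x [/BD[]]].
  apply: mule_ge0; first by rewrite lee_fin subr_ge0.
  by apply: hahn_pos_ge0; [exact: measurableI|move=> x [/BD[]]].
- move=> B mB BD; rewrite kE//; apply: adde_le0.
    by apply: hahn_neg_le0; [exact: measurableD|move=> x [/BD[]]].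
  apply: mule_ge0_le0; first by rewrite lee_fin subr_ge0.
  by apply: hahn_neg_le0; [exact: measurableI|move=> x [/BD[]]].
have mDP : measurable (D `&` hahn_pos nu) by exact: measurableI.
have mDN : measurable (D `&` hahn_neg nu) by exact: measurableI.
have mAP : measurable (A `&` hahn_pos nu) by exact: measurableI.
have mAN : measurable (A `&` hahn_neg nu) by exact: measurableI.
rewrite !variation_chargeE !cposE// !cnegE// !kE0.
rewrite [D `&` hahn_pos nu `&` A]setIAC [D `&` hahn_neg nu `&` A]setIAC (setIidr AD).
have /fineK <- := charge_fin nu mDP.
have /fineK <- := charge_fin nu mDN.
have /fineK <- := charge_fin nu mAP.
have /fineK <- := charge_fin nu mAN.
move: (fine _) (fine (nu (A `&` hahn_pos nu))) (fine (nu (D `&` hahn_neg nu))) => a b c.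
move: (fine _) => d.
apply: (congr1 EFin (x := a + - e * b - (c + - e * d)) (y := a - c - e * (b - d))).
ring.
Qed.

Lemma variation_charge_fin nu A : measurable A -> variation_charge nu A \is a fin_num.
Proof. by move=> mA; rewrite variation_chargeE fin_numD !fin_num_measure. Qed.

End Variation.

Section LebesgueDecomposition.
Context {R : realType}.
Local Notation mu := (@lebesgue_measure R).
Local Notation T := (measurableTypeR R).
Implicit Types (nu kappa s : {charge set T -> \bar R}) (A B N : set T) (g : R -> R).

Lemma singular01P s : singular01 s <->
  exists N : set T, [/\ measurable N, mu N = 0%E &
    forall B, measurable B -> B `<=` I01 `\` N -> s B = 0%E].
Proof.
split=> -[N [mN N0 h]]; exists N; split => //.
  by apply/variation_charge_eq0 => //; exact: measurableD.
by apply/variation_charge_eq0 => //; exact: measurableD.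
Qed.

Lemma integral_negligible_diff (f : T -> \bar R) A N : measurable A -> measurable N ->
  mu.-integrable A f -> mu N = 0%E ->
  (\int[mu]_(x in A) f x = \int[mu]_(x in A `\` N) f x)%E.
Proof. by move=> mA mN fi N0; apply: negligible_integral. Qed.

(** Off a common null set both singular parts vanish, which determines the
    density; the singular parts are what remains. *)
Lemma lebesgue_decomposition_unique nu1 nu2 g1 g2 s1 s2 :
  (forall A, measurable A -> A `<=` I01 -> nu1 A = nu2 A) ->
  lebesgue_decomposition nu1 g1 s1 -> lebesgue_decomposition nu2 g2 s2 ->
  ae_eq01 g1 g2 /\ (forall A, measurable A -> A `<=` I01 -> s1 A = s2 A).
Proof.
move=> e12 [i1 /singular01P[N1 [mN1 N10 h1]] d1] [i2 /singular01P[N2 [mN2 N20 h2]] d2].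
have mN : measurable (N1 `|` N2) by exact: measurableU.
have N0 : mu (N1 `|` N2) = 0%E.
  by apply/eqP; rewrite eq_le measure_ge0 andbT -(adde0 0%E) -{1}N10 -N20 measureU2.
have eqi A : A `<=` I01 -> measurable A ->
    (\int[mu]_(x in A) (EFin \o g1) x = \int[mu]_(x in A) (EFin \o g2) x)%E.
  move=> AI mA.
  have mAN : measurable (A `\` (N1 `|` N2)) by exact: measurableD.
  have ANI : A `\` (N1 `|` N2) `<=` I01 by move=> x [/AI].
  rewrite !(@integral_negligible_diff _ A (N1 `|` N2))//;
    [|exact: integrableS i2|exact: integrableS i1].
  have := e12 _ mAN ANI; rewrite d1// d2// h1// ?h2// ?adde0//.
    by move=> x [/AI xI nx]; split => // xN; apply: nx; right.
  by move=> x [/AI xI nx]; split => // xN; apply: nx; left.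
split.
  have := integral_ae_eq (@measurable_I01 R) i1 _ eqi.
  have /integrableP[m2 _] := i2.
  move=> /(_ m2); apply: aeS => x h xI.
  by have := h xI => /= -[].
move=> A mA AI; have := e12 _ mA AI; rewrite d1// d2// (eqi _ AI mA).
have := integrable_fin_num mA (integrableS (@measurable_I01 R) mA AI i2).
move: (charge_fin s1 mA) (charge_fin s2 mA).
move: (s1 A) (s2 A) (\int[mu]_(x in A) _)%E => [a| |] [b| |] [c| |]//= _ _ _ [].
by move/addrI ->.
Qed.

Lemma lebesgue_decomposition_add nu kappa g1 g2 s1 s2 (r : R) :
  lebesgue_decomposition nu g1 s1 -> lebesgue_decomposition kappa g2 s2 ->
  lebesgue_decomposition (cadd nu (cscale r kappa)) (fun x => g1 x + r * g2 x)
    (cadd s1 (cscale r s2)).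
Proof.
move=> [i1 /singular01P[N1 [mN1 N10 h1]] d1] [i2 /singular01P[N2 [mN2 N20 h2]] d2].
have i2r : mu.-integrable I01 (fun x => (r * g2 x)%:E).
  exact: (integrableZl (@measurable_I01 R) r i2).
split.
- rewrite (_ : EFin \o _ = (EFin \o g1) \+ (fun x => (r * g2 x)%:E))%E//.
  by apply: integrableD.
- apply/singular01P; exists (N1 `|` N2); split; first exact: measurableU.
    by apply/eqP; rewrite eq_le measure_ge0 andbT -(adde0 0%E) -{1}N10 -N20 measureU2.
  move=> B mB BN; rewrite -[LHS]/(s1 B + r%:E * s2 B)%E h1// ?h2// ?mule0 ?adde0//.
    by move=> x /BN[xI nx]; split => // xN; apply: nx; right.
  by move=> x /BN[xI nx]; split => // xN; apply: nx; left.
- move=> A mA AI; rewrite -[LHS]/(nu A + r%:E * kappa A)%E d1// d2//.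
  have j1 := integrableS (@measurable_I01 R) mA AI i1.
  have j2 := integrableS (@measurable_I01 R) mA AI i2.
  have j2r := integrableS (@measurable_I01 R) mA AI i2r.
  have -> : (\int[mu]_(x in A) (g1 x + r * g2 x)%:E =
      \int[mu]_(x in A) (g1 x)%:E + r%:E * \int[mu]_(x in A) (g2 x)%:E)%E.
    rewrite -integralZl//.
    by rewrite -integralD.
  rewrite -[X in _ = (_ + X)%E]/(s1 A + r%:E * s2 A)%E.
  move: (charge_fin s1 mA) (charge_fin s2 mA).
  have := integrable_fin_num mA j1; have := integrable_fin_num mA j2.
  move: (s1 A) (s2 A) (\int[mu]_(x in A) (EFin \o g1) x)%E
    (\int[mu]_(x in A) (EFin \o g2) x)%E => [a| |] [b| |] [c| |] [d| |]//= _ _ _ _.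
  apply: (congr1 EFin (x := c + a + r * (d + b)) (y := c + r * d + (a + r * b))).
  ring.
Qed.

Lemma singular01_crestr s A (mA : measurable A) : singular01 s -> singular01 (crestr s mA).
Proof.
move=> /singular01P[N [mN N0 h]]; apply/singular01P; exists N; split => //.
move=> B mB BN; rewrite -[LHS]/(s (B `&` A)) h//; first exact: measurableI.
by move=> x [/BN].
Qed.

Lemma lebesgue_decomposition_singular s : singular01 s ->
  lebesgue_decomposition s (cst 0) s.
Proof.
by move=> hs; split => //; [exact: integrable_cst01|move=> A mA AI; rewrite integral0 add0e].
Qed.

Lemma singular01_czero : singular01 (czero : {charge set T -> \bar R}).
Proof. by apply/singular01P; exists set0; split => //; exact: measure0. Qed.

Definition density_charge g (gi : mu.-integrable I01 (EFin \o g)) :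
    {charge set T -> \bar R} :=
  induced_charge (integrable_restrict_I01 gi).

Lemma density_chargeE g (gi : mu.-integrable I01 (EFin \o g)) A : measurable A ->
  A `<=` I01 -> density_charge gi A = (\int[mu]_(x in A) (g x)%:E)%E.
Proof.
move=> mA AI; apply: eq_integral => x /set_mem/AI xI.
by rewrite /= patchE mem_set.
Qed.

Lemma cdf_density g (gi : mu.-integrable I01 (EFin \o g)) t : I01 t ->
  cdf (density_charge gi) t = \int[mu]_(x in `]0%R, t]) g x.
Proof.
rewrite /= in_itv/= => /andP[t0 t1]; rewrite /cdf density_chargeE//.
by move=> x /=; rewrite !in_itv/= => /andP[-> xt]; rewrite (le_lt_trans xt).
Qed.

Lemma lebesgue_decomposition_density g (gi : mu.-integrable I01 (EFin \o g)) :
  lebesgue_decomposition (density_charge gi) g czero.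
Proof.
split => //; first exact: singular01_czero.
by move=> A mA AI; rewrite density_chargeE// /czero adde0.
Qed.

End LebesgueDecomposition.

Section LebesgueDecompositionExists.
Context {R : realType}.
Local Notation mu := (@lebesgue_measure R).
Local Notation T := (measurableTypeR R).
Variable nu : {charge set T -> \bar R}.

Lemma lebesgue_measure_I01_lty : (mu I01 < +oo)%E.
Proof. by rewrite lebesgue_measure_I01 ltry. Qed.

Let leb01 : {finite_measure set T -> \bar R} :=
  mfrestr (@measurable_I01 R) lebesgue_measure_I01_lty.

(** A finite measure that dominates both Lebesgue measure on ]0, 1[ and nu. *)
Definition leb_plus_variation : set T -> \bar R :=
  measure_add leb01 (measure_add (cpos nu) (cneg nu)).

HB.instance Definition _ := Measure.on leb_plus_variation.

Lemma leb_plus_variationE A :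
  leb_plus_variation A = (mu (A `&` I01) + (cpos nu A + cneg nu A))%E.
Proof.
rewrite /leb_plus_variation measure_addE; congr (_ + _)%E; exact: measure_addE.
Qed.

Let leb_plus_variation_fin : fin_num_fun leb_plus_variation.
Proof.
move=> A mA; rewrite leb_plus_variationE !fin_numD.
by rewrite (fin_num_measure leb01) ?fin_num_measure.
Qed.

HB.instance Definition _ := @Measure_isFinite.Build _ _ _ leb_plus_variation
  leb_plus_variation_fin.

(** The null set carrying the singular part is where the density of Lebesgue
    measure with respect to its sum with the variation of nu vanishes. *)
Lemma lebesgue_decomposition_exists :
  exists (g : R -> R) (s : {charge set T -> \bar R}), lebesgue_decomposition nu g s.
Proof.
pose m : {finite_measure set T -> \bar R} := leb_plus_variation.
have mE A : m A = (mu (A `&` I01) + (cpos nu A + cneg nu A))%E.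
  exact: leb_plus_variationE.
have dom : leb01 `<< m.
  apply/null_content_dominatesP => A mA mA0; have : m A = 0%E by exact: mA0.
  rewrite mE => /eqP.
  rewrite padde_eq0 ?adde_ge0//.
  by move=> /andP[/eqP].
have [h [h0 hfin hi hE]] := radon_nikodym_sigma_finite dom.
have mh : measurable_fun setT h by have /integrableP[] := hi.
pose N : set T := h @^-1` [set 0%E].
have mN : measurable N by rewrite -[N]setTI; exact: mh.
have N0 : mu (N `&` I01) = 0%E.
  rewrite -[LHS]/(leb01 N) hE//; apply: integral0_eq => x.
  by rewrite /N /=.
have mCN : measurable (~` N) by exact: measurableC.
pose nuC : {charge set T -> \bar R} := crestr nu mCN.
have domC : nuC `<< mu.
  apply/null_content_dominatesP => A mA A0.
  have mAN : measurable (A `&` ~` N) by exact: measurableI.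
  have l0 : leb01 (A `&` ~` N) = 0%E.
    rewrite -[LHS]/(mu (A `&` ~` N `&` I01)).
    apply/eqP; rewrite eq_le measure_ge0 andbT -A0; apply: le_measure; rewrite ?inE//.
      by apply: measurableI => //; exact: measurable_I01.
    by move=> x [[]].
  have m0 : m (A `&` ~` N) = 0%E.
    have mhA : measurable_fun (A `&` ~` N) h by exact: measurable_funTS.
    have h00 : (\int[m]_(x in A `&` ~` N) `|h x| = 0)%E.
      rewrite -l0 hE//; apply: eq_integral => x _; exact: gee0_abs.
    have [M [mM M0 sub]] := (ae_eq_integral_abs m mAN mhA).1 h00.
    apply/eqP; rewrite eq_le measure_ge0 andbT -M0; apply: le_measure; rewrite ?inE//.
    by move=> x [Ax Nx]; apply: sub => /= e; apply: (Nx); exact: (e (conj Ax Nx)).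
  have := m0; rewrite mE => /eqP.
  rewrite padde_eq0 ?adde_ge0//.
  rewrite padde_eq0// => /andP[_ /andP[/eqP p0 /eqP n0]].
  by rewrite -[LHS]/(nu (A `&` ~` N)) charge_posneg// p0 n0 sube0.
have gfin x := Radon_Nikodym_fin_num x domC.
have gi := Radon_Nikodym_integrable domC.
have gE A (mA : measurable A) := Radon_Nikodym_integral domC mA.
pose g x := fine (Radon_Nikodym nuC mu x).
exists g, (crestr nu mN : {charge set T -> \bar R}).
have fE x : (g x)%:E = Radon_Nikodym nuC mu x by exact: fineK.
split.
- apply: (integrableS measurableT) => //.
  by apply: eq_integrable gi => // x _; rewrite /= fE.
- apply/singular01P; exists (N `&` I01); split => //.
    by apply: measurableI => //; exact: measurable_I01.
  move=> B mB BN; rewrite -[LHS]/(nu (B `&` N)).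
  rewrite (_ : B `&` N = set0) ?charge0//; apply/seteqP; split => // x [Bx Nx].
  by have [xI] := BN _ Bx; apply.
- move=> A mA AI; under eq_integral do rewrite fE.
  rewrite -gE// -[X in _ = (X + _)%E]/(nu (A `&` ~` N)) -[X in _ = (_ + X)%E]/(nu (A `&` N)).
  by rewrite (chargeDI nu mA mN) setDE.
Qed.

End LebesgueDecompositionExists.

(** * The energy of a function given by its derivative *)

Section EnergyFormula.
Context {R : realType}.
Local Notation mu := (@lebesgue_measure R).
Local Notation T := (measurableTypeR R).
Implicit Types (nu kappa s : {charge set T -> \bar R}) (g w f F : R -> R).

Lemma DmeasP w nu : distributional_derivative w nu ->
  distributional_derivative w (Dmeas w).
Proof.
move=> h; rewrite /Dmeas.
apply: (@xgetPex {classic {charge set T -> \bar R}} _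
  [set nu | distributional_derivative w nu]).
by exists nu.
Qed.

Lemma lebesgue_partsP nu g s : lebesgue_decomposition nu g s ->
  lebesgue_decomposition nu (lebesgue_parts nu).1 (lebesgue_parts nu).2.
Proof.
move=> h; rewrite /lebesgue_parts.
apply: (@xgetPex {classic (R -> R) * {charge set T -> \bar R}} _
  [set p | lebesgue_decomposition nu p.1 p.2]).
by exists (g, s).
Qed.

Lemma BV_parts w nu g s : mu.-integrable I01 (EFin \o w) ->
  distributional_derivative w nu -> lebesgue_decomposition nu g s ->
  ae_eq01 (BVdot w) g /\
  (forall A : set T, measurable A -> A `<=` I01 -> BVsing w A = s A).
Proof.
move=> wi dw dec.
have e := distributional_derivative_unique wi (DmeasP dw) dw.
have [g' [s' dec']] := lebesgue_decomposition_exists (Dmeas w).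
exact: (lebesgue_decomposition_unique e (lebesgue_partsP dec') dec).
Qed.

(** Clamping makes f bounded everywhere, and not only almost everywhere. *)
Definition clamp01 (y : R) : R := Num.max 0 (Num.min y 1).

Lemma clamp01_itv y : 0 <= clamp01 y <= 1.
Proof.
by rewrite /clamp01 le_max lexx/= ge_max ler01 ge_min lexx orbT.
Qed.

Lemma clamp01_id y : 0 <= y <= 1 -> clamp01 y = y.
Proof. by move=> /andP[y0 y1]; rewrite /clamp01 min_l// max_r. Qed.

Lemma measurable_clamp01 f (D : set T) : measurable_fun D f ->
  measurable_fun D (clamp01 \o f).
Proof.
move=> mf; apply: measurable_maxr; first exact: measurable_cst.
by apply: measurable_minr => //; exact: measurable_cst.
Qed.

Definition energy F f (lambda : R) g s w : R :=
  \int[mu]_(t in I01) F (g t) + lambda_inf F * fine (variation_charge s I01) +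
  lambda / 2 * \int[mu]_(t in I01) (w t - f t) ^+ 2.

(** The choices made in the definition of K are immaterial: any derivative, any
    decomposition and any representative compute it. *)
Lemma K_energy F f fh (lambda : R) w v nu g s :
  continuous F -> measurable_fun (I01 : set T) f -> measurable_fun (I01 : set T) fh ->
  ae_eq01 f fh -> ae_eq01 w v -> mu.-integrable I01 (EFin \o w) ->
  measurable_fun (I01 : set T) v ->
  distributional_derivative w nu -> lebesgue_decomposition nu g s ->
  mu.-integrable I01 (fun t => (F (g t))%:E) ->
  mu.-integrable I01 (fun t => ((v t - fh t) ^+ 2)%:E) ->
  K F f lambda w = (energy F fh lambda g s v)%:E.
Proof.
move=> cF mf mfh ffh wv wi mv dw dec iF i2.
have [edot esing] := BV_parts wi dw dec.
have [g' [s' dec']] := lebesgue_decomposition_exists (Dmeas w).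
have [i' _ _] := lebesgue_partsP dec'.
have [gi _ _] := dec.
have mF (g0 : R -> R) : mu.-integrable I01 (EFin \o g0) ->
    measurable_fun (I01 : set T) (fun t => (F (g0 t))%:E).
  move=> /integrableP[/measurable_EFinP mg _]; apply/measurable_EFinP.
  by apply: measurableT_comp mg; exact: continuous_measurable_fun.
have mI := @measurable_I01 R.
rewrite /K /energy 2!EFinD; congr (_ + _ + _)%E.
- rewrite (@ae_eq_integral _ _ _ mu I01 (fun t => (F (g t))%:E))//.
  + by rewrite /Rintegral fineK//; exact: integrable_fin_num iF.
  + exact: mF.
  + exact: mF.
  + by apply: aeS edot => t h /h /= ->.
- rewrite (variation_charge_local mI esing).
  by rewrite EFinM fineK// variation_charge_fin.
- rewrite [in RHS]EFinM; congr (_ * _)%E.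
  rewrite (@ae_eq_integral _ _ _ mu I01 (fun t => ((v t - fh t) ^+ 2)%:E))//.
  + by rewrite /Rintegral fineK//; exact: integrable_fin_num i2.
  + apply/measurable_EFinP; apply: measurable_funX; apply: measurable_funB => //.
    by have /integrableP[/measurable_EFinP] := wi.
  + by have /integrableP[] := i2.
  + by apply: aeS2 wv ffh => t h1 h2 tI; rewrite h1// h2.
Qed.

End EnergyFormula.

(** * The integrand *)

Section Integrand.
Context {R : realType}.
Variables (F : R -> R) (nu1 : R).
Hypotheses (hF1 : F1 F) (hF2 : F2 F nu1) (hF4 : F4 F).
Implicit Types p q y : R.

Local Notation Phi := (derive1 F).
Local Notation L := (lambda_inf F).

Lemma integrand_derivable p : derivable F p 1.
Proof. by have [[h _ _] _ _] := hF1; exact: h. Qed.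

Lemma Phi_derivable p : derivable Phi p 1.
Proof. by have [[_ h _] _ _] := hF1; exact: h. Qed.

Lemma Phi_derive_continuous : continuous (derive1 Phi).
Proof. by have [[_ _ h] _ _] := hF1 => p; exact: h. Qed.

Lemma integrand_continuous : continuous F.
Proof. by move=> p; apply: derivable_continuous; exact: integrand_derivable. Qed.

Lemma Phi_continuous : continuous Phi.
Proof. by move=> p; apply: derivable_continuous; exact: Phi_derivable. Qed.

Lemma Phi_lt p q : p < q -> Phi p < Phi q.
Proof.
move=> pq.
have [||c _ e] := @MVT R Phi (derive1 Phi) p q pq _ _.
- by move=> x _; rewrite derive1E; apply: derivableP; exact: Phi_derivable.
- by apply: continuous_subspaceT; exact: Phi_continuous.
by rewrite -subr_gt0 e mulr_gt0 ?subr_gt0//; exact: hF4.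
Qed.

Lemma Phi_ltE p q : (Phi p < Phi q) = (p < q).
Proof.
apply/idP/idP; last exact: Phi_lt.
by apply: contraTT; rewrite -!leNgt le_eqVlt => /predU1P[->//|/Phi_lt/ltW].
Qed.

Lemma Phi_leE p q : (Phi p <= Phi q) = (p <= q).
Proof. by rewrite !leNgt Phi_ltE. Qed.

(** The graph of a convex function lies above its tangents. *)
Lemma integrand_tangent p q : F p + Phi p * (q - p) <= F q.
Proof.
have key (a b : R) : a < b -> exists2 c, a < c < b & F b - F a = Phi c * (b - a).
  move=> ab; have [||c cab e] := @MVT R F Phi a b ab _ _.
  - by move=> x _; rewrite derive1E; apply: derivableP; exact: integrand_derivable.
  - by apply: continuous_subspaceT; exact: integrand_continuous.
  by exists c => //; move: cab; rewrite in_itv.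
have [pq|qp|->] := ltgtP p q; last by rewrite subrr mulr0 addr0.
- have [c /andP[pc _] e] := key _ _ pq.
  rewrite -lerBrDl e; apply: ler_wpM2r; first by rewrite subr_ge0 ltW.
  by rewrite Phi_leE ltW.
- have [c /andP[_ cp] e] := key _ _ qp.
  have h : Phi c * (p - q) <= Phi p * (p - q).
    by apply: ler_wpM2r; [rewrite subr_ge0 ltW|rewrite Phi_leE ltW].
  by move: h e; rewrite -[q - p]opprB mulrN; lra.
Qed.

Lemma PhiN p : Phi (- p) = - Phi p.
Proof.
have [_ Feven _] := hF1.
have d : is_derive p (1 : R) (F \o -%R) (Phi (- p) * -1).
  apply: is_derive1_comp; rewrite derive1E.
  by apply: derivableP; exact: integrand_derivable.
have e : F \o -%R = F by apply/funext => q /=; rewrite Feven.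
have := @derive_val _ _ _ _ _ _ _ d; rewrite e -derive1E => ->.
by rewrite mulrN1 opprK.
Qed.

Lemma Phi0 : Phi 0 = 0.
Proof. by have := PhiN 0; rewrite oppr0 => e; lra. Qed.

Let Phi_nondecreasing : nondecreasing_fun Phi.
Proof. by move=> p q; rewrite Phi_leE. Qed.

Let Phi_ub : has_ubound (range Phi).
Proof. by exists nu1 => _ [p _ <-]; apply: le_trans (hF2 p); exact: ler_norm. Qed.

Lemma lambda_infE : L = sup (range Phi).
Proof. by apply: cvg_lim => //; exact: nondecreasing_cvgr Phi_nondecreasing Phi_ub. Qed.

Lemma Phi_lt_lambda_inf p : Phi p < L.
Proof.
rewrite lambda_infE; apply: (@lt_le_trans _ _ (Phi (p + 1))).
  by rewrite Phi_ltE ltrDl.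
by apply: ub_le_sup => //; exists (p + 1).
Qed.

Lemma Phi_gt_lambda_inf p : - L < Phi p.
Proof. by rewrite ltrNl -PhiN; exact: Phi_lt_lambda_inf. Qed.

Lemma lambda_inf_gt0 : 0 < L.
Proof. by rewrite -Phi0; exact: Phi_lt_lambda_inf. Qed.

Lemma Phi_above y : y < L -> exists p, y < Phi p.
Proof.
rewrite lambda_infE => /sup_gt[|_ [p _ <-] yp]; last by exists p.
by exists (Phi 0), 0.
Qed.

Lemma Phi_below y : - L < y -> exists p, Phi p < y.
Proof.
by move=> yL; have [|p hp] := @Phi_above (- y); [lra|exists (- p); rewrite PhiN; lra].
Qed.

Lemma Phi_surj y : - L < y < L -> exists p, Phi p = y.
Proof.
move=> /andP[/Phi_below[p py] /Phi_above[q yq]].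
have pq : p <= q by rewrite -Phi_leE; lra.
have [| |c _ e] := @IVT R Phi p q y pq.
- by apply: continuous_subspaceT; exact: Phi_continuous.
- by rewrite ge_min le_max (ltW py) (ltW yq) orbT.
by exists c.
Qed.

Lemma integrand_bound p : (forall q, 0 <= F q) -> `|F p| <= nu1 * `|p|.
Proof.
move=> F0; have [_ _ F00] := hF1; rewrite ger0_norm//.
have := integrand_tangent p 0; rewrite F00 sub0r mulrN subr_le0 => h.
apply: (le_trans h); apply: (le_trans (ler_norm _)).
by rewrite normrM; apply: ler_wpM2r => //; exact: hF2.
Qed.

End Integrand.

(** * The Euler-Lagrange conditions *)

Section BoundedMeasurable.
Context {R : realType}.
Local Notation mu := (@lebesgue_measure R).
Local Notation T := (measurableTypeR R).
Implicit Types f g : R -> R.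

Definition bounded_measurable f := measurable_fun (I01 : set T) f /\
  exists B : R, forall x, I01 x -> `|f x| <= B.

Lemma bounded_measurable_cst (c : R) : bounded_measurable (cst c).
Proof. by split; [exact: measurable_cst|exists `|c|]. Qed.

Lemma bounded_measurableD f g : bounded_measurable f -> bounded_measurable g ->
  bounded_measurable (fun x => f x + g x).
Proof.
move=> [mf [B HB]] [mg [C HC]]; split; first exact: measurable_funD.
by exists (B + C) => x xI; rewrite (le_trans (ler_normD _ _))// lerD ?HB ?HC.
Qed.

Lemma bounded_measurableM f g : bounded_measurable f -> bounded_measurable g ->
  bounded_measurable (fun x => f x * g x).
Proof.
move=> [mf [B HB]] [mg [C HC]]; split; first exact: measurable_funM.
by exists (B * C) => x xI; rewrite normrM ler_pM ?HB ?HC.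
Qed.

Lemma bounded_measurableZ (r : R) f : bounded_measurable f ->
  bounded_measurable (fun x => r * f x).
Proof. by move=> bf; apply: bounded_measurableM => //; exact: bounded_measurable_cst. Qed.

Lemma bounded_measurableB f g : bounded_measurable f -> bounded_measurable g ->
  bounded_measurable (fun x => f x - g x).
Proof.
move=> bf /(bounded_measurableZ (-1)) bg.
under eq_fun do rewrite -mulN1r; exact: bounded_measurableD.
Qed.

Lemma bounded_measurable_integrable f : bounded_measurable f ->
  mu.-integrable I01 (EFin \o f).
Proof.
move=> [mf [B HB]]; apply: (@integrable_bounded _ _ _ B) => //.
by rewrite lebesgue_measure_I01 ltry.
Qed.

Lemma bounded_measurable_cdf nu : bounded_measurable (@cdf R nu).
Proof.
split; first exact: measurable_cdf.
by have [B _ HB] := cdf_bounded nu; exists B.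
Qed.

End BoundedMeasurable.

Lemma fine_cadd_cscale {R : realType}
    (nu kappa : {charge set (measurableTypeR R) -> \bar R}) (e : R) A : measurable A ->
  fine (cadd nu (cscale e kappa) A) = fine (nu A) + e * fine (kappa A).
Proof.
move=> mA; rewrite -[cadd _ _ A]/(nu A + e%:E * kappa A)%E.
move: (charge_fin nu mA) (charge_fin kappa mA).
by move: (nu A) (kappa A) => [a| |] [b| |].
Qed.

Section EulerLagrange.
Context {R : realType}.
Local Notation mu := (@lebesgue_measure R).
Local Notation T := (measurableTypeR R).
Variables (F f : R -> R) (nu1 lambda : R) (u : R -> R).
Hypothesis f_meas : measurable_fun (I01 : set T) f.
Hypothesis f_01 : {ae mu, forall t : R, I01 t -> 0 <= f t <= 1}.
Hypothesis F_ge0 : forall p, 0 <= F p.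
Hypotheses (hF1 : F1 F) (hF2 : F2 F nu1) (hF4 : F4 F).
Hypothesis lambda_gt0 : 0 < lambda.
Hypothesis u_min : minimizer F f lambda u.

Local Notation Phi := (derive1 F).
Local Notation L := (lambda_inf F).
Local Notation fh := (clamp01 \o f).

Variables (nu su : {charge set T -> \bar R}) (gu : R -> R) (c : R).
Hypothesis dec : lebesgue_decomposition nu gu su.
Hypothesis u_nu : distributional_derivative u nu.

Definition BV_rep (t : R) : R := c + cdf nu t.

Local Notation U := BV_rep.
Hypothesis uU : ae_eq01 u U.

Lemma bounded_measurable_fh : bounded_measurable fh.
Proof.
split; first exact: measurable_clamp01.
exists 1 => x _ /=; have /andP[h0 h1] := clamp01_itv (f x).
by rewrite ger0_norm.
Qed.

Lemma bounded_measurable_rep : bounded_measurable U.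
Proof.
by apply: bounded_measurableD; [exact: bounded_measurable_cst|exact: bounded_measurable_cdf].
Qed.

Lemma ae_eq_fh : ae_eq01 f fh.
Proof. by apply: aeS f_01 => t h /h /clamp01_id /= ->. Qed.

Lemma integrable_integrand g : mu.-integrable I01 (EFin \o g) ->
  mu.-integrable I01 (fun t => (F (g t))%:E).
Proof.
move=> gi.
apply: (@le_integrable _ _ _ _ _ _ _ (fun t => (nu1 * `|g t|)%:E)) => //.
- apply/measurable_EFinP; have /integrableP[/measurable_EFinP mg _] := gi.
  by apply: measurableT_comp mg; apply: continuous_measurable_fun; exact: integrand_continuous.
- move=> t _ /=; rewrite lee_fin (le_trans (integrand_bound hF1 hF2 hF4 _ F_ge0))//.
  exact: ler_norm.
- exact: (integrableZl (@measurable_I01 R) nu1 (integrable_abse gi)).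
Qed.

(** Every charge kappa is an admissible direction, since the distribution
    function of nu + e kappa has bounded variation. *)
Lemma energy_min kappa s1 g1 (c1 e : R) : lebesgue_decomposition kappa g1 s1 ->
  energy F fh lambda gu su U <=
  energy F fh lambda (fun t => gu t + e * g1 t) (cadd su (cscale e s1))
    (fun t => U t + e * (c1 + cdf kappa t)).
Proof.
move=> dk; have [[ui _] umin] := u_min.
have dec' := lebesgue_decomposition_add e dec dk.
set nu' : {charge set T -> \bar R} := cadd nu (cscale e kappa).
pose w t := (c + e * c1) + cdf nu' t.
have wE t : w t = U t + e * (c1 + cdf kappa t).
  have -> : w t = c + e * c1 + (cdf nu t + e * cdf kappa t).
    by congr (_ + _); rewrite /cdf fine_cadd_cscale.
  by rewrite /BV_rep; ring.
have bw : bounded_measurable (fun t => U t + e * (c1 + cdf kappa t)).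
  apply: bounded_measurableD; first exact: bounded_measurable_rep.
  apply: bounded_measurableZ; apply: bounded_measurableD.
    exact: bounded_measurable_cst.
  exact: bounded_measurable_cdf.
have wi := integrable_cst_cdf (c + e * c1) nu'.
have wd := distributional_derivative_cdf (c + e * c1) nu'.
have Bw : BV w by split => //; exists nu'.
have sq v : bounded_measurable v -> mu.-integrable I01 (fun t => ((v t - fh t) ^+ 2)%:E).
  move=> bv; have b := bounded_measurableB bv bounded_measurable_fh.
  exact: (bounded_measurable_integrable (bounded_measurableM b b)).
have [mfh _] := bounded_measurable_fh.
have cF := integrand_continuous hF1.
have [gi _ _] := dec; have [gi' _ _] := dec'.
have := umin _ Bw.
rewrite (K_energy lambda cF f_meas mfh ae_eq_fh uU ui _ u_nu dec) //; last 3 first.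
- by have [] := bounded_measurable_rep.
- exact: integrable_integrand.
- exact: sq bounded_measurable_rep.
rewrite (K_energy lambda cF f_meas mfh ae_eq_fh (v := fun t => U t + e * (c1 + cdf kappa t))
   _ wi _ wd dec') ?lee_fin //; last 2 first.
- exact: integrable_integrand gi'.
- exact: sq bw.
- by apply: aeW => t _; exact: wE.
- by have [] := bw.
Qed.

Lemma integral_square_expansion (h : R -> R) (e : R) : bounded_measurable h ->
  \int[mu]_(t in I01) (U t + e * h t - fh t) ^+ 2 =
  \int[mu]_(t in I01) (U t - fh t) ^+ 2 +
  (2 * e * \int[mu]_(t in I01) ((U t - fh t) * h t) +
   e ^+ 2 * \int[mu]_(t in I01) (h t * h t)).
Proof.
move=> bh; have b0 := bounded_measurableB bounded_measurable_rep bounded_measurable_fh.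
have b2 := bounded_measurableM b0 b0.
have b1 := bounded_measurableM b0 bh.
have bhh := bounded_measurableM bh bh.
have b1' := bounded_measurableZ (2 * e) b1.
have bhh' := bounded_measurableZ (e ^+ 2) bhh.
have b3 := bounded_measurableD b1' bhh'.
rewrite -RintegralZl//; last exact: bounded_measurable_integrable.
rewrite -RintegralZl//; last exact: bounded_measurable_integrable.
rewrite -RintegralD//; [|exact: bounded_measurable_integrable..].
under [X in _ = X + _]eq_Rintegral do rewrite expr2.
rewrite -RintegralD//; [|exact: bounded_measurable_integrable..].
by apply: eq_Rintegral => t _; ring.
Qed.

Lemma energy_variation kappa s1 g1 (c1 e : R) : lebesgue_decomposition kappa g1 s1 ->
  0 <= (\int[mu]_(t in I01) F (gu t + e * g1 t) - \int[mu]_(t in I01) F (gu t)) +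
    L * (fine (variation_charge (cadd su (cscale e s1)) I01) -
         fine (variation_charge su I01)) +
    (e * (lambda * \int[mu]_(t in I01) ((U t - fh t) * (c1 + cdf kappa t))) +
     e ^+ 2 * (lambda / 2 * \int[mu]_(t in I01) ((c1 + cdf kappa t) * (c1 + cdf kappa t)))).
Proof.
move=> dk; have := energy_min c1 e dk; rewrite /energy integral_square_expansion; last first.
  apply: bounded_measurableD; first exact: bounded_measurable_cst.
  exact: bounded_measurable_cdf.
move: (fine _) (fine _) (Rintegral _ _ _) (Rintegral _ _ _) => v1 v2 a b.
move: (Rintegral _ _ _) (Rintegral _ _ _) (Rintegral _ _ _) => i j k.
by move=> h; nra.
Qed.

Definition residual (t : R) : R := U t - fh t.

Lemma bounded_measurable_residual : bounded_measurable residual.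
Proof. exact: bounded_measurableB bounded_measurable_rep bounded_measurable_fh. Qed.

Lemma bounded_measurable_Phi g : mu.-integrable I01 (EFin \o g) ->
  bounded_measurable (fun t => Phi (g t)).
Proof.
move=> /integrableP[/measurable_EFinP mg _]; split; last by exists nu1 => x _; exact: hF2.
apply: measurableT_comp mg; apply: continuous_measurable_fun; exact: Phi_continuous hF1.
Qed.

(** The tangent of F at the varied density bounds the increment of the integral
    of F, so that nothing has to be differentiated under the integral sign. *)
Lemma density_variation_e g1 (bg : bounded_measurable g1) (c1 e : R) : 0 < e ->
  0 <= \int[mu]_(t in I01) (Phi (gu t + e * g1 t) * g1 t) +
    lambda * \int[mu]_(t in I01) (residual t *
      (c1 + cdf (density_charge (bounded_measurable_integrable bg)) t)) +
    e * (lambda / 2 * \int[mu]_(t in I01)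
      ((c1 + cdf (density_charge (bounded_measurable_integrable bg)) t) *
       (c1 + cdf (density_charge (bounded_measurable_integrable bg)) t))).
Proof.
move=> e0; set gi := bounded_measurable_integrable bg; set kappa := density_charge gi.
have dk := lebesgue_decomposition_density gi.
have := energy_variation c1 e dk.
have -> : variation_charge (cadd su (cscale e czero)) I01 = variation_charge su I01.
  apply: variation_charge_local; first exact: measurable_I01.
  by move=> B mB _; rewrite -[LHS]/(su B + e%:E * 0)%E mule0 adde0.
rewrite subrr mulr0 addr0 => h.
have [gui _ _] := dec.
have gei : mu.-integrable I01 (EFin \o (fun t => gu t + e * g1 t)).
  have b := bounded_measurable_integrable (bounded_measurableZ e bg).
  exact: (integrableD (@measurable_I01 R) gui b).
have bP := bounded_measurable_Phi gei.
have le : \int[mu]_(t in I01) F (gu t + e * g1 t) - \int[mu]_(t in I01) F (gu t) <=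
    e * \int[mu]_(t in I01) (Phi (gu t + e * g1 t) * g1 t).
  have bPg := bounded_measurableM bP bg.
  rewrite -RintegralB//; [|exact: integrable_integrand..].
  rewrite -RintegralZl//; last exact: bounded_measurable_integrable.
  apply: le_Rintegral => //.
  - by apply: integrable_EFinB => //; exact: integrable_integrand.
  - exact: bounded_measurable_integrable (bounded_measurableZ e bPg).
  - move=> t _; have := integrand_tangent hF1 hF4 (gu t + e * g1 t) (gu t).
    by move: (Phi _) (F _) (F _) => P a b; nra.
rewrite -/kappa in h *.
move: h le; rewrite -/(residual _).
move: (Rintegral _ _ _) (Rintegral _ _ _) (Rintegral _ _ _) (Rintegral _ _ _)
  (Rintegral _ _ _) => a b s q p h le.
rewrite -(pmulr_rge0 _ e0); apply: (le_trans h).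
rewrite -subr_ge0; move: le; rewrite -subr_ge0 => le.
apply: (le_trans le); rewrite le_eqVlt; apply/orP; left; apply/eqP; ring.
Qed.

(** The case e = 0, by dominated convergence: |Phi| is bounded. *)
Lemma density_variation g1 (bg : bounded_measurable g1) (c1 : R) :
  0 <= \int[mu]_(t in I01) (Phi (gu t) * g1 t) +
    lambda * \int[mu]_(t in I01) (residual t *
      (c1 + cdf (density_charge (bounded_measurable_integrable bg)) t)).
Proof.
pose a (e : R) := \int[mu]_(t in I01) (Phi (gu t + e * g1 t) * g1 t).
set S := lambda * _; pose Q := lambda / 2 * \int[mu]_(t in I01)
  ((c1 + cdf (density_charge (bounded_measurable_integrable bg)) t) *
   (c1 + cdf (density_charge (bounded_measurable_integrable bg)) t)).
have H e : 0 < e -> 0 <= a e + S + e * Q by exact: density_variation_e.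
have [gui _ _] := dec; have [mg [B HB]] := bg.
have mI := @measurable_I01 R.
have e_cvg : (n.+1%:R^-1 : R) @[n --> \oo] --> (0 : R) by exact: cvg_harmonic.
have acvg : a n.+1%:R^-1 @[n --> \oo] --> \int[mu]_(t in I01) (Phi (gu t) * g1 t).
  have bP e : bounded_measurable (fun t => Phi (gu t + e * g1 t) * g1 t).
    apply: bounded_measurableM (_) (bg); apply: bounded_measurable_Phi.
    have b := bounded_measurable_integrable (bounded_measurableZ e bg).
    exact: (integrableD mI gui b).
  have b0 := bounded_measurableM (bounded_measurable_Phi gui) bg.
  apply: fine_cvg; rewrite fineK; last first.
    exact: (integrable_fin_num mI (bounded_measurable_integrable b0)).
  apply: (@dominated_cvg _ _ _ mu I01 mI _ _ (fun t => (nu1 * B)%:E)) => //.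
  - move=> n; have /integrableP[m _] := bounded_measurable_integrable (bP n.+1%:R^-1).
    exact: m.
  - move=> t tI; apply: cvg_EFin; first exact: nearW.
    apply: cvgM; last exact: cvg_cst.
    have c0 : (gu t + n.+1%:R^-1 * g1 t) @[n --> \oo] --> gu t + 0 * g1 t.
      by apply: cvgD; [exact: cvg_cst|apply: cvgM; [exact: e_cvg|exact: cvg_cst]].
    rewrite mul0r addr0 in c0.
    exact: (continuous_cvg _ (@Phi_continuous _ _ hF1 (gu t)) c0).
  - exact: integrable_cst01.
  - move=> n t tI; rewrite lee_fin normrM; by apply: ler_pM => //; exact: HB.
have lim : (a n.+1%:R^-1 + S + n.+1%:R^-1 * Q) @[n --> \oo] -->
    \int[mu]_(t in I01) (Phi (gu t) * g1 t) + S + 0 * Q.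
  apply: cvgD; first by apply: cvgD => //; exact: cvg_cst.
  by apply: cvgM; [exact: e_cvg|exact: cvg_cst].
rewrite -[X in 0 <= X]addr0 -[X in _ + X](mul0r Q) -(cvg_lim (@Rhausdorff R) lim).
by apply: limr_ge; [exact: cvgP lim|apply: nearW => n; exact: H].
Qed.

Let residual_int := bounded_measurable_integrable bounded_measurable_residual.

Lemma Rintegral0_I01 (h : R -> R) : (forall t, I01 t -> h t = 0) ->
  \int[mu]_(t in I01) h t = 0.
Proof.
move=> h0; rewrite (@eq_Rintegral _ _ _ _ _ (fun=> 0)) ?Rintegral_cst ?mul0r//.
by move=> t /set_mem tI; exact: h0.
Qed.

(** Constants are admissible variations. *)
Lemma residual_mean0 : \int[mu]_(t in I01) residual t = 0.
Proof.
have key (c1 : R) : 0 <= lambda * (c1 * \int[mu]_(t in I01) residual t).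
  have b0 := bounded_measurable_cst (0 : R).
  have := density_variation b0 c1.
  rewrite Rintegral0_I01 ?add0r; last by move=> t _; rewrite /= mulr0.
  move=> h; apply: (le_trans h); rewrite le_eqVlt; apply/orP; left; apply/eqP.
  congr (_ * _); rewrite -RintegralZl//; apply: eq_Rintegral => t /set_mem tI.
  rewrite mulrC; congr (_ * _); rewrite cdf_density// [X in _ + X](_ : _ = 0) ?addr0//.
  rewrite (@eq_Rintegral _ _ _ _ _ (fun=> 0)) ?Rintegral_cst ?mul0r//.
have := key 1; have := key (-1); rewrite !(pmulr_rge0 _ lambda_gt0).
by move: (Rintegral _ _ _) => r *; lra.
Qed.

(** The primitive of lambda (U - f); it will turn out to be the flux F'(u'). *)
Definition sigma (t : R) : R := lambda * cdf (density_charge residual_int) t.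

Lemma bounded_measurable_sigma : bounded_measurable sigma.
Proof. by apply: bounded_measurableZ; exact: bounded_measurable_cdf. Qed.

Lemma sigma_primitive t : I01 t -> sigma t = lambda * \int[mu]_(x in `]0, t]) residual x.
Proof. by move=> tI; rewrite /sigma cdf_density. Qed.

Lemma residual_tail t : I01 t -> lambda * \int[mu]_(x in `[t, 1[) residual x = - sigma t.
Proof.
move=> tI; rewrite sigma_primitive// -mulrN; congr (_ * _).
have [t0 t1] : 0 < t /\ t < 1 by move: tI; rewrite /= in_itv/= => /andP.
have := @Rintegral_itvB _ residual (BRight 0) (BLeft 1) t residual_int.
rewrite residual_mean0 sub0r !bnd_simp => ->; rewrite ?ltW//.
rewrite Rintegral_itv_obnd_cbnd//; apply: integrableS residual_int => //.
by move=> x /=; rewrite !in_itv/= => /andP[tx ->]; rewrite (lt_trans t0).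
Qed.

(** The derivative of the energy along the variation sigma - Phi(gu) is minus
    the integral of its square. *)
Lemma EL_density : ae_eq01 (fun t => Phi (gu t)) sigma.
Proof.
have [gui _ _] := dec.
have bP := bounded_measurable_Phi gui.
(* the direction of steepest descent of the energy *)
have bg := bounded_measurableB bounded_measurable_sigma bP.
have gi := bounded_measurable_integrable bg.
have := density_variation bg 0.
have -> : lambda * \int[mu]_(t in I01) (residual t *
      (0 + cdf (density_charge (bounded_measurable_integrable bg)) t)) =
    \int[mu]_(x in I01) ((sigma x - Phi (gu x)) * - sigma x).
  have -> : \int[mu]_(t in I01) (residual t *
      (0 + cdf (density_charge (bounded_measurable_integrable bg)) t)) =
      \int[mu]_(t in I01) (residual t *
        \int[mu]_(x in `]0, t]) (sigma x - Phi (gu x))).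
    by apply: eq_Rintegral => t /set_mem tI; rewrite add0r cdf_density.
  rewrite (triangle_Fubini residual_int gi).
  rewrite -RintegralZl//.
    by apply: eq_Rintegral => t /set_mem tI; rewrite -residual_tail//; ring.
  have bt := bounded_measurableM bg (bounded_measurableZ (- lambda^-1) bounded_measurable_sigma).
  apply: eq_integrable (bounded_measurable_integrable bt) => //.
  move=> t /set_mem tI /=; congr (_ * _)%:E.
  rewrite -(opprK (sigma t)) -residual_tail// mulrNN mulrA mulVf ?gt_eqF//.
  by rewrite mul1r.
rewrite -RintegralD//; last 2 first.
- exact: bounded_measurable_integrable (bounded_measurableM bP bg).
- have := bounded_measurable_integrable
    (bounded_measurableM bg (bounded_measurableZ (-1) bounded_measurable_sigma)).
  by apply: eq_integrable => // t _; rewrite /= mulN1r.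
move=> h; have bgg := bounded_measurableM bg bg.
have ggi := bounded_measurable_integrable bgg.
have {h} gg0 : \int[mu]_(t in I01) ((sigma t - Phi (gu t)) * (sigma t - Phi (gu t))) = 0.
  apply/eqP; rewrite eq_le; apply/andP; split; last first.
    by apply: Rintegral_ge0 => t _; exact: sqr_ge0.
  rewrite -oppr_ge0; apply: (le_trans h); rewrite le_eqVlt; apply/orP; left; apply/eqP.
  rewrite -mulN1r -RintegralZl//; apply: eq_Rintegral => t _.
  by move: (Phi _) (sigma _) => a b; ring.
have mI := @measurable_I01 R.
have /integrableP[mgg _] := ggi.
have : (\int[mu]_(t in I01) `|((sigma t - Phi (gu t)) * (sigma t - Phi (gu t)))%:E| = 0)%E.
  under eq_integral do rewrite gee0_abs ?lee_fin ?sqr_ge0//.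
  by rewrite -(fineK (integrable_fin_num mI ggi)); congr (_%:E).
move=> /(ae_eq_integral_abs _ mI mgg).1; apply: aeS => t /= h tI.
have /eqP := h tI; rewrite eqe mulf_eq0 orbb subr_eq0 => /eqP ->//.
Qed.

Lemma bounded_measurable_integrable_finite (m : {finite_measure set T -> \bar R}) h :
  bounded_measurable h -> m.-integrable I01 (EFin \o h).
Proof.
move=> [mh [B HB]]; apply: measurable_bounded_integrable => //.
  by rewrite ltey_eq fin_num_measure.
exists B; split; first by rewrite num_real.
by move=> x xB y Dx /=; exact: le_trans (HB _ Dx) (ltW xB).
Qed.

(** Thinning the singular part of Du on a set A by a factor 1 - e is an
    admissible variation; letting e tend to 0 compares L |D^s u|(A) with the
    integral of sigma over A against D^s u. *)
Lemma EL_singular (A : set T) (mA : measurable A) : A `<=` I01 ->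
  L * fine (variation_charge su A) <=
  \int[cpos (crestr su mA)]_(x in I01) sigma x -
  \int[cneg (crestr su mA)]_(x in I01) sigma x.
Proof.
move=> AI; pose kappa : {charge set T -> \bar R} := crestr su mA.
have mI := @measurable_I01 R.
have [_ sing _] := dec.
have dk := lebesgue_decomposition_singular (singular01_crestr mA sing).
have sint (m : {finite_measure set T -> \bar R}) : m.-integrable I01 (EFin \o sigma).
  exact: bounded_measurable_integrable_finite bounded_measurable_sigma.
have -> : \int[cpos kappa]_(x in I01) sigma x - \int[cneg kappa]_(x in I01) sigma x =
    - (lambda * \int[mu]_(t in I01) (residual t * (0 + cdf kappa t))).
  under [in RHS]eq_Rintegral do rewrite add0r.
  rewrite (cdf_by_parts kappa residual_int) mulrBr.
  have key (m : {finite_measure set T -> \bar R}) :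
      lambda * (\int[m]_(x in I01) \int[mu]_(t in `[x, 1[) residual t) =
      - \int[m]_(x in I01) sigma x.
    transitivity (lambda * \int[m]_(x in I01) (- lambda^-1 * sigma x)).
      congr (_ * _); apply: eq_Rintegral => x /set_mem xI.
      rewrite -(opprK (sigma x)) -residual_tail// mulrNN mulrA.
      by rewrite mulVf ?gt_eqF// mul1r.
    have h := RintegralZl (- lambda^-1) mI (sint m).
    apply: (etrans (congr1 (fun r : R => lambda * r) h)).
    by move: (Rintegral _ _ _) => r; field; rewrite gt_eqF.
  by rewrite !key opprB opprK addrC.
pose Q := lambda / 2 * \int[mu]_(t in I01) ((0 + cdf kappa t) * (0 + cdf kappa t)).
have H e : 0 < e -> e <= 1 -> L * fine (variation_charge su A) +
    lambda * \int[mu]_(t in I01) (residual t * (0 + cdf kappa t)) <= e * Q.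
  move=> e0 e1; have := energy_variation 0 (- e) dk.
  have -> : \int[mu]_(t in I01) F (gu t + - e * cst 0 t) = \int[mu]_(t in I01) F (gu t).
    by apply: eq_Rintegral => t _; rewrite /= mulr0 addr0.
  rewrite variation_charge_thin//; last by rewrite ltW.
  rewrite fineB ?variation_charge_fin//; last by rewrite fin_numM// variation_charge_fin.
  rewrite fineM ?variation_charge_fin// /=.
  rewrite -/kappa -/(residual _) -/Q.
  move: (fine _) (fine _) (Rintegral _ _ _) (Rintegral _ _ _) (Q) => v1 v2 a b q h.
  by rewrite -(ler_pM2l e0); move: h; nra.
rewrite -subr_le0 opprK; apply/ler_addgt0Pr => e e0; rewrite add0r.
have [Q0|Q0] := leP Q 0.
  by have := H 1 ltr01 (lexx _); move=> h; apply: (le_trans h); lra.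
have d0 : 0 < Num.min 1 (e / Q) by rewrite lt_min ltr01 divr_gt0.
have d1 : Num.min 1 (e / Q) <= 1 by rewrite ge_min lexx.
have h := H _ d0 d1; apply: (le_trans h).
by rewrite -ler_pdivlMr// ge_min lexx orbT.
Qed.

Lemma Rintegral_le_support (m : {finite_measure set T -> \bar R}) (A : set T) h (k : R) :
  measurable A -> A `<=` I01 -> m (I01 `\` A) = 0%E -> bounded_measurable h ->
  (forall x, A x -> h x <= k) -> \int[m]_(x in I01) h x <= k * fine (m A).
Proof.
move=> mA AI m0 bh hk; have [mh _] := bh; have mI := @measurable_I01 R.
have mD : measurable (I01 `\` A : set T) by exact: measurableD.
have hi : m.-integrable I01 (EFin \o h).
  exact: bounded_measurable_integrable_finite.
have e : A `|` (I01 `\` A) = I01 by rewrite setDUK.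
rewrite -{1}e Rintegral_setU//; last 2 first.
- by rewrite e.
- by apply/disj_setPS => x [Ax [_]].
rewrite [X in _ + X](_ : _ = 0) ?addr0; last first.
  rewrite /Rintegral null_set_integral//; apply/measurable_EFinP.
  by apply: measurable_funS mh => // x [].
rewrite -Rintegral_cst//; apply: le_Rintegral => //.
- exact: integrableS hi.
- exact: finite_measure_integrable_cst.
Qed.

(** On the part B of A in the negative Hahn set of su, the inequality above reads
    L |su|(B) <= (L - d) |su|(B), whence |su|(B) = 0. *)
Lemma singular_nonneg (A : set T) (d : R) : measurable A -> A `<=` I01 -> 0 < d ->
  (forall x, A x -> - L + d <= sigma x) -> 0 <= fine (su A).
Proof.
move=> mA AI d0 HA.
have mP := measurable_hahn_pos su; have mN := measurable_hahn_neg su.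
rewrite (hahn_split su su mA) fineD ?charge_fin//; [|exact: measurableI..].
apply: addr_ge0; first by apply/fine_ge0/hahn_pos_ge0 => //; exact: measurableI.
have mB : measurable (A `&` hahn_neg su) by exact: measurableI.
set B := A `&` hahn_neg su in mB *; pose kappa : {charge set T -> \bar R} := crestr su mB.
have BI : B `<=` I01 by move=> x [/AI].
have kp C : measurable C -> cpos kappa C = 0%E.
  move=> mC; apply/eqP; rewrite eq_le measure_ge0 andbT cposE//.
  rewrite -[kappa _]/(su ((C `&` hahn_pos kappa) `&` B)).
  apply: hahn_neg_le0; last by move=> x [_ [_]].
  by apply: measurableI => //; apply: measurableI => //; exact: measurable_hahn_pos.
have kn C : measurable C -> cneg kappa C = (- su (C `&` B))%E.
  move=> mC; have := charge_posneg kappa mC; rewrite kp// add0e.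
  by rewrite -[kappa C]/(su (C `&` B)) => ->; rewrite oppeK.
have := EL_singular mB BI; rewrite -/kappa.
rewrite [X in X - _](_ : _ = 0); last first.
  rewrite /Rintegral null_set_integral//; last exact: kp.
  by have [ms _] := bounded_measurable_sigma; exact/measurable_EFinP.
rewrite sub0r => h.
have bs := bounded_measurableZ (-1) bounded_measurable_sigma.
have h2 : \int[cneg kappa]_(x in I01) (-1 * sigma x) <= (L - d) * fine (cneg kappa B).
  apply: Rintegral_le_support => //.
    rewrite kn; last exact: measurableD.
    by rewrite (_ : _ `&` _ = set0) ?charge0 ?oppe0//; apply/seteqP; split => // x [[]].
  by move=> x [Ax _]; have := HA x Ax; lra.
have [ms [b Hb]] := bounded_measurable_sigma.
have si := bounded_measurable_integrable_finite (cneg kappa) bounded_measurable_sigma.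
rewrite RintegralZl// in h2.
rewrite kn// setIid fineN in h2.
have h3 : `|fine (su B)| <= fine (variation_charge su B).
  rewrite variation_chargeE fineD ?fin_num_measure//; exact: fine_charge_le.
have L0 := lambda_inf_gt0 hF1 hF2 hF4.
move: h h2 h3; move: (Rintegral _ _ _) (fine (su B)) (fine _) => r s v h h2.
have /orP[s0|s0] := le_total 0 s; first by [].
by rewrite ler0_norm// => h3; nra.
Qed.

Lemma singular_nonpos (A : set T) (d : R) : measurable A -> A `<=` I01 -> 0 < d ->
  (forall x, A x -> sigma x <= L - d) -> fine (su A) <= 0.
Proof.
move=> mA AI d0 HA.
have mP := measurable_hahn_pos su; have mN := measurable_hahn_neg su.
rewrite (hahn_split su su mA) fineD ?charge_fin//; [|exact: measurableI..].
rewrite addrC -oppr_ge0 opprD; apply: addr_ge0.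
  rewrite -fineN; apply: fine_ge0; rewrite oppe_ge0; apply: hahn_neg_le0 => //.
  exact: measurableI.
have mB : measurable (A `&` hahn_pos su) by exact: measurableI.
set B := A `&` hahn_pos su in mB *; pose kappa : {charge set T -> \bar R} := crestr su mB.
have BI : B `<=` I01 by move=> x [/AI].
have kn C : measurable C -> cneg kappa C = 0%E.
  move=> mC; apply/eqP; rewrite eq_le measure_ge0 andbT cnegE// leeNl oppe0.
  rewrite -[kappa _]/(su ((C `&` hahn_neg kappa) `&` B)).
  apply: hahn_pos_ge0; last by move=> x [_ [_]].
  by apply: measurableI => //; apply: measurableI => //; exact: measurable_hahn_neg.
have kp C : measurable C -> cpos kappa C = su (C `&` B).
  move=> mC; have := charge_posneg kappa mC; rewrite kn// oppe0 adde0.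
  by rewrite -[kappa C]/(su (C `&` B)).
have := EL_singular mB BI; rewrite -/kappa.
rewrite [X in _ - X](_ : _ = 0); last first.
  rewrite /Rintegral null_set_integral//; last exact: kn.
  by have [ms _] := bounded_measurable_sigma; exact/measurable_EFinP.
rewrite subr0 => h.
have h2 : \int[cpos kappa]_(x in I01) sigma x <= (L - d) * fine (cpos kappa B).
  apply: Rintegral_le_support => //.
  - rewrite kp; last exact: measurableD.
    by rewrite (_ : _ `&` _ = set0) ?charge0//; apply/seteqP; split => // x [[]].
  - exact: bounded_measurable_sigma.
  - by move=> x [Ax _]; exact: HA.
rewrite kp// setIid in h2.
have h3 : `|fine (su B)| <= fine (variation_charge su B).
  rewrite variation_chargeE fineD ?fin_num_measure//; exact: fine_charge_le.
have L0 := lambda_inf_gt0 hF1 hF2 hF4.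
move: h h2 h3; move: (Rintegral _ _ _) (fine (su B)) (fine _) => r s v h h2.
rewrite oppr_ge0; have /orP[s0|s0] := le_total s 0; first by [].
by rewrite ger0_norm// => h3; nra.
Qed.

Lemma ae_le_Rintegral (D : set T) (f1 f2 : R -> R) : measurable D ->
  mu.-integrable D (EFin \o f1) -> mu.-integrable D (EFin \o f2) ->
  {ae mu, forall x : R, D x -> f1 x <= f2 x} ->
  \int[mu]_(x in D) f1 x <= \int[mu]_(x in D) f2 x.
Proof.
move=> mD i1 i2 le12; rewrite -subr_ge0 -RintegralB//.
have i12 := integrable_EFinB mD i2 i1.
rewrite (_ : Rintegral _ _ _ = \int[mu]_(x in D) `|f2 x - f1 x|).
  by apply: Rintegral_ge0 => x _.
congr fine; have /integrableP[m12 _] := i12.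
apply: ae_eq_integral => //.
- by apply/measurable_EFinP; apply: measurableT_comp => //; exact/measurable_EFinP.
- by apply: aeS le12 => x h Dx /=; rewrite ger0_norm// subr_ge0; exact: h.
Qed.

Lemma ae_neq (t : R) : {ae mu, forall x : R, x <> t}.
Proof.
exists [set t]; split; [exact: measurable_set1|exact: lebesgue_measure_set1|].
by move=> x /= /contrapT.
Qed.

Lemma lebesgue_measure_itvoc (s t : R) : s <= t -> mu `]s, t] = (t - s)%:E.
Proof.
move=> st; rewrite lebesgue_measure_itv/= lte_fin.
case: ltP st => [_ _|ts st]; first by rewrite -EFinB.
have -> : t = s by apply/eqP; rewrite eq_le ts st.
by rewrite subrr.
Qed.

Lemma Rintegral_cst_itvoc s t (m : R) : s <= t ->
  \int[mu]_(x in `]s, t]) m = m * (t - s).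
Proof.
move=> st; rewrite Rintegral_cst; last exact: measurable_itvT.
congr (_ * _); exact: (congr1 fine (lebesgue_measure_itvoc st)).
Qed.

Lemma integrable_cst_itvoc s t (m : R) : s <= t -> mu.-integrable `]s, t] (EFin \o cst m).
Proof.
move=> st; apply: (@integrable_bounded _ _ _ `|m|) => //.
by rewrite [X in (X < _)%E](lebesgue_measure_itvoc st) ltry.
Qed.

Lemma sigma_increment_E s t : 0 <= s -> s <= t ->
  sigma t - sigma s = lambda * \int[mu]_(x in `]s, t]) (residual \_ I01) x.
Proof. by move=> s0 st; rewrite /sigma -mulrBr cdfB. Qed.

Lemma sigma_increment_ge s t m : 0 <= s -> s <= t -> t <= 1 ->
  {ae mu, forall x : R, s < x < t -> m <= U x - f x} ->
  lambda * (m * (t - s)) <= sigma t - sigma s.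
Proof.
move=> s0 st t1 h; rewrite sigma_increment_E// ler_pM2l//.
have mA : measurable (`]s, t]%classic : set T) by exact: measurable_itvT.
rewrite -(Rintegral_cst_itvoc m st).
apply: ae_le_Rintegral => //.
- exact: integrable_cst_itvoc.
- by apply: integrableS (integrable_restrict_I01 residual_int).
- apply: aeS2 ae_eq_fh (aeS2 (fun x a b => conj a b) h (ae_neq t)) => x fx [hx xt].
  rewrite /= in_itv/= => /andP[sx]; rewrite le_eqVlt => /predU1P[//|{}xt].
  have xI : I01 x by rewrite /= in_itv/= (le_lt_trans s0 sx) (lt_le_trans xt).
  by rewrite patchE mem_set// /residual -[fh x]fx//; apply: hx; rewrite sx.
Qed.

Lemma sigma_increment_le s t m : 0 <= s -> s <= t -> t <= 1 ->
  {ae mu, forall x : R, s < x < t -> U x - f x <= m} ->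
  sigma t - sigma s <= lambda * (m * (t - s)).
Proof.
move=> s0 st t1 h; rewrite sigma_increment_E// ler_pM2l//.
have mA : measurable (`]s, t]%classic : set T) by exact: measurable_itvT.
rewrite -(Rintegral_cst_itvoc m st).
apply: ae_le_Rintegral => //.
- by apply: integrableS (integrable_restrict_I01 residual_int).
- exact: integrable_cst_itvoc.
- apply: aeS2 ae_eq_fh (aeS2 (fun x a b => conj a b) h (ae_neq t)) => x fx [hx xt].
  rewrite /= in_itv/= => /andP[sx]; rewrite le_eqVlt => /predU1P[//|{}xt].
  have xI : I01 x by rewrite /= in_itv/= (le_lt_trans s0 sx) (lt_le_trans xt).
  by rewrite patchE mem_set// /residual -[fh x]fx//; apply: hx; rewrite sx.
Qed.

Lemma sigma0 : sigma 0 = 0.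
Proof. by rewrite /sigma /cdf set_itvoc0 charge0 mulr0. Qed.

Lemma sigma1 : sigma 1 = 0.
Proof.
have := sigma_increment_E (lexx 0) ler01; rewrite sigma0 subr0 => ->.
apply/eqP; rewrite mulf_eq0; apply/orP; right; apply/eqP.
rewrite -[RHS]residual_mean0 [RHS]Rintegral_mkcond Rintegral_mkcond; apply: eq_Rintegral => x _.
rewrite !patchE; case: ifPn => //; case: ifPn => // xI /negP[].
by apply/mem_set; move: xI => /set_mem; rewrite /= !in_itv/= => /andP[-> /ltW].
Qed.

Lemma rep_increment a b : 0 <= a -> a <= b -> b < 1 ->
  U b - U a = \int[mu]_(x in `]a, b]) gu x + fine (su `]a, b]).
Proof.
move=> a0 ab b1; have [gui _ decE] := dec.
have AI : `]a, b] `<=` (I01 : set R).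
  by move=> x /=; rewrite !in_itv/= => /andP[ax xb]; rewrite (le_lt_trans a0 ax)/= (le_lt_trans xb).
have mA : measurable (`]a, b]%classic : set T) by exact: measurable_itvT.
rewrite /BV_rep opprD addrACA subrr add0r cdfB //.
have gA : mu.-integrable `]a, b] (EFin \o gu) by exact: integrableS gui.
rewrite -fineD ?charge_fin//; last exact: (integrable_fin_num mA gA).
exact: (congr1 fine (decE _ mA AI)).
Qed.

(** Where sigma >= Phi q, the density of Du is at least q and its singular part
    is nonnegative. *)
Lemma rep_slope_ge a b q : 0 <= a -> a <= b -> b < 1 ->
  (forall x, a < x <= b -> Phi q <= sigma x) -> q * (b - a) <= U b - U a.
Proof.
move=> a0 ab b1 h; have [gui _ decE] := dec.
have AI : `]a, b] `<=` (I01 : set R).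
  by move=> x /=; rewrite !in_itv/= => /andP[ax xb]; rewrite (le_lt_trans a0 ax)/= (le_lt_trans xb).
have mA : measurable (`]a, b]%classic : set T) by exact: measurable_itvT.
rewrite rep_increment// -(Rintegral_cst_itvoc q ab).
rewrite -[X in X <= _]addr0; apply: lerD.
- apply: ae_le_Rintegral => //; [exact: integrable_cst_itvoc|exact: integrableS gui|].
  apply: aeS EL_density => x /[swap] xA /(_ (AI _ xA)) e.
  by rewrite -(Phi_leE hF1 hF4) e; apply: h; move: xA; rewrite /= in_itv.
- apply: (@singular_nonneg _ (Phi q + L)) => //.
    by have := Phi_gt_lambda_inf hF1 hF2 hF4 q; lra.
  by move=> x /=; rewrite in_itv/= => xA; have := h x xA; lra.
Qed.

Lemma rep_slope_le a b q : 0 <= a -> a <= b -> b < 1 ->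
  (forall x, a < x <= b -> sigma x <= Phi q) -> U b - U a <= q * (b - a).
Proof.
move=> a0 ab b1 h; have [gui _ decE] := dec.
have AI : `]a, b] `<=` (I01 : set R).
  by move=> x /=; rewrite !in_itv/= => /andP[ax xb]; rewrite (le_lt_trans a0 ax)/= (le_lt_trans xb).
have mA : measurable (`]a, b]%classic : set T) by exact: measurable_itvT.
rewrite rep_increment// -(Rintegral_cst_itvoc q ab).
rewrite -[X in _ <= X]addr0; apply: lerD.
- apply: ae_le_Rintegral => //; [exact: integrableS gui|exact: integrable_cst_itvoc|].
  apply: aeS EL_density => x /[swap] xA /(_ (AI _ xA)) e.
  by rewrite -(Phi_leE hF1 hF4) e; apply: h; move: xA; rewrite /= in_itv.
- apply: (@singular_nonpos _ (L - Phi q)) => //.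
    by have := Phi_lt_lambda_inf hF1 hF2 hF4 q; lra.
  by move=> x /=; rewrite in_itv/= => xA; have := h x xA; lra.
Qed.

Lemma rep_bounded : exists2 B, 0 <= B & forall t, `|U t| <= B.
Proof.
have [B B0 HB] := cdf_bounded nu; exists (`|c| + B); first by rewrite addr_ge0.
by move=> t; rewrite (le_trans (ler_normD _ _))// lerD2l.
Qed.

(** |sigma| <= L, by continuity of sigma and since Phi o gu = sigma almost everywhere. *)
Lemma sigma_bound t : 0 <= t < 1 -> `|sigma t| <= L.
Proof.
move=> /andP[t0 t1]; apply/ler_addgt0Pr => e e0.
have [d d0 hd] := @cdf_right_continuous _ (density_charge residual_int) t (e / lambda) t0
  (divr_gt0 e0 lambda_gt0).
have td : t < Num.min 1 (t + d) by rewrite lt_min t1 ltrDl.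
have [x [/andP[tx]]] := ae_ex td EL_density.
rewrite lt_min => /andP[x1 xd]; rewrite /= in_itv/= (le_lt_trans t0 tx) x1.
move=> /(_ isT) Ex.
have sx : `|sigma x| <= L.
  by rewrite -Ex ler_norml (ltW (Phi_gt_lambda_inf hF1 hF2 hF4 _))
    (ltW (Phi_lt_lambda_inf hF1 hF2 hF4 _)).
have := hd x (ltW tx) (ltW xd).
rewrite -(ler_pM2l lambda_gt0) [X in _ <= X]mulrC divfK ?gt_eqF// => h.
have {}h : `|sigma x - sigma t| <= e.
  by rewrite /sigma -mulrBr normrM gtr0_norm.
move: sx h; rewrite !ler_norml => /andP[? ?] /andP[? ?]; lra.
Qed.

End EulerLagrange.

(** * Consequences of the Euler-Lagrange conditions *)

Section RealInduction.
Context {R : realType}.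
Implicit Types (P : R -> Prop) (a b t s d : R).

Lemma real_induction P a b : a <= b -> P a ->
  (forall t, a <= t -> t < b -> (forall s, a <= s -> s <= t -> P s) ->
    exists2 d, 0 < d & forall s, t <= s -> s <= t + d -> s <= b -> P s) ->
  (forall t, a < t -> t <= b -> (forall s, a <= s -> s < t -> P s) -> P t) ->
  forall t, a <= t -> t <= b -> P t.
Proof.
move=> ab Pa right left.
pose S := [set x | a <= x <= b /\ forall s, a <= s -> s <= x -> P s].
have Sa : S a.
  split; first by rewrite lexx ab.
  by move=> s as_ sa; rewrite (_ : s = a)//; apply/eqP; rewrite eq_le sa as_.
have supS : has_sup S.
  by split; [exists a|exists b => x [/andP[_ ->]]].
set m := sup S.
have am : a <= m by apply: ub_le_sup => //; exact: supS.2.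
have mb : m <= b by apply: ge_sup; [exists a|move=> x [/andP[_ ->]]].
have Plt s : a <= s -> s < m -> P s.
  move=> as_ sm; have ms0 : 0 < m - s by rewrite subr_gt0.
  have [x [_ Px] sx] := sup_adherent ms0 supS.
  by apply: Px => //; rewrite ltW//; move: sx; rewrite -/m opprB addrC subrK.
have Pm : P m.
  by move: am; rewrite le_eqVlt => /predU1P[<-//|am]; apply: left.
have Ple s : a <= s -> s <= m -> P s.
  by move=> as_; rewrite le_eqVlt => /predU1P[->//|]; exact: Plt.
have [mb'|bm] := ltP m b; last first.
  by move=> t at_ tb; apply: Ple => //; exact: le_trans bm.
have [d d0 Hd] := right m am mb' Ple.
have : Num.min b (m + d) <= m.
  apply: ub_le_sup; first exact: supS.2.
  split; first by rewrite le_min ab ge_min lexx /= (le_trans am)// lerDl ltW.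
  move=> s as_; rewrite le_min => /andP[sb smd].
  by have [sm|ms] := leP s m; [exact: Ple|apply: Hd => //; exact: ltW].
by rewrite ge_min leNgt mb' /= gerDl leNgt d0.
Qed.

Lemma real_induction_left P a b : a <= b -> P b ->
  (forall t, a < t -> t <= b -> (forall s, t <= s -> s <= b -> P s) ->
    exists2 d, 0 < d & forall s, s <= t -> t - d <= s -> a <= s -> P s) ->
  (forall t, a <= t -> t < b -> (forall s, t < s -> s <= b -> P s) -> P t) ->
  forall t, a <= t -> t <= b -> P t.
Proof.
move=> ab Pb left right t at_ tb; rewrite -(opprK t).
apply: (@real_induction (fun x => P (- x)) (- b) (- a)); rewrite ?lerN2 ?opprK//.
- move=> x bx xa H; have [|||d d0 Hd] := left (- x); rewrite 1?ltrNr 1?lerNl//.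
    by move=> s xs sb; rewrite -(opprK s); apply: H; rewrite ?lerN2// lerNl.
  exists d => // s xs sd sa; apply: Hd; rewrite ?lerN2//.
  - by rewrite -opprD lerN2.
  - by rewrite lerNr.
- move=> x bx xa H; apply: right; rewrite 1?lerNr 1?ltrNl//.
  by move=> s xs sb; rewrite -(opprK s); apply: H; rewrite ?lerN2// ltrNl.
Qed.

End RealInduction.

Section Stationary.
Context {R : realType}.
Local Notation mu := (@lebesgue_measure R).
Variables (F : R -> R) (nu1 lambda : R).
Hypotheses (hF1 : F1 F) (hF2 : F2 F nu1) (hF4 : F4 F).
Hypothesis lambda_gt0 : 0 < lambda.
Implicit Types (f U Ul sigma g : R -> R) (s t x y q m e d : R).

Local Notation Phi := (derive1 F).
Local Notation L := (lambda_inf F).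

(** What the Euler-Lagrange conditions say about a right-continuous function U
    with left limits Ul: sigma' = lambda (U - f), and the slope of U is
    bounded by q wherever sigma is bounded by Phi q.  Changing the sign of all
    four functions preserves these properties, so that each one-sided result
    below has a mirror image. *)
Record stationary f U Ul sigma : Prop := Stationary {
  slope_ge : forall s t q, 0 <= s -> s <= t -> t < 1 ->
    (forall x, s < x <= t -> Phi q <= sigma x) -> q * (t - s) <= U t - U s;
  slope_le : forall s t q, 0 <= s -> s <= t -> t < 1 ->
    (forall x, s < x <= t -> sigma x <= Phi q) -> U t - U s <= q * (t - s);
  increment_ge : forall s t m, 0 <= s -> s <= t -> t <= 1 ->
    {ae mu, forall x : R, s < x < t -> m <= U x - f x} ->
    lambda * (m * (t - s)) <= sigma t - sigma s;
  increment_le : forall s t m, 0 <= s -> s <= t -> t <= 1 ->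
    {ae mu, forall x : R, s < x < t -> U x - f x <= m} ->
    sigma t - sigma s <= lambda * (m * (t - s));
  sigma_at0 : sigma 0 = 0;
  sigma_at1 : sigma 1 = 0;
  sigma_le : forall t, 0 <= t -> t < 1 -> `|sigma t| <= L;
  sigma_lip : exists2 C, 0 < C & forall s t, 0 <= s -> s <= t -> t <= 1 ->
    `|sigma t - sigma s| <= C * (t - s);
  rep_right : forall t e, 0 <= t -> 0 < e -> exists2 d, 0 < d &
    forall s, t <= s -> s <= t + d -> `|U s - U t| <= e;
  rep_left : forall t e, 0 < t -> 0 < e -> exists2 d, 0 < d &
    forall s, 0 <= s -> t - d <= s -> s < t -> `|U s - Ul t| <= e }.

Lemma stationaryN f U Ul sigma : stationary f U Ul sigma ->
  stationary (fun t => - f t) (fun t => - U t) (fun t => - Ul t) (fun t => - sigma t).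
Proof.
case=> sg sl ig il z0 z1 sL [C C0 lip] r l; split.
- move=> s t q s0 st t1 h; have := @sl s t (- q) s0 st t1.
  rewrite (PhiN hF1) => /(_ _)/le_trans; rewrite -opprD lerNr -mulNr; apply => //.
  by move=> x /h; rewrite lerNr.
- move=> s t q s0 st t1 h; have := @sg s t (- q) s0 st t1.
  rewrite (PhiN hF1) -opprD lerNl -mulNr; apply => //.
  by move=> x /h; rewrite lerNl.
- move=> s t m s0 st t1 h; have := @il s t (- m) s0 st t1.
  rewrite -opprD lerNr mulNr mulrN; apply.
  by apply: aeS h => x h /h; lra.
- move=> s t m s0 st t1 h; have := @ig s t (- m) s0 st t1.
  rewrite -opprD lerNl mulNr mulrN; apply.
  by apply: aeS h => x h /h; lra.
- by rewrite z0 oppr0.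
- by rewrite z1 oppr0.
- by move=> t t0 t1; rewrite normrN; exact: sL.
- by exists C => // s t s0 st t1; rewrite -opprD normrN; exact: lip.
- move=> t e t0 e0; have [d d0 h] := r t e t0 e0; exists d => // s ts sd.
  by rewrite -opprD normrN; exact: h.
- move=> t e t0 e0; have [d d0 h] := l t e t0 e0; exists d => // s s0 ts sd.
  by rewrite -opprD normrN; exact: h.
Qed.

Lemma sigma_near f U Ul sigma t e : stationary f U Ul sigma -> 0 <= t -> t <= 1 -> 0 < e ->
  exists2 d, 0 < d & forall s, 0 <= s -> s <= 1 -> `|s - t| <= d ->
    `|sigma s - sigma t| <= e.
Proof.
move=> st t0 t1 e0; have [C C0 lip] := sigma_lip st.
exists (e / C); first by rewrite divr_gt0.
move=> s s0 s1; rewrite ler_pdivlMr// mulrC => h; apply: (le_trans _ h).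
have [ts|ts] := leP t s; first by rewrite [`|s - t|]ger0_norm ?subr_ge0//; exact: lip.
rewrite distrC [`|s - t|]distrC [`|t - s|]ger0_norm ?subr_ge0 ?(ltW ts)//.
by apply: lip => //; exact: ltW.
Qed.

Lemma sigma_below f U Ul sigma t y : stationary f U Ul sigma -> 0 <= t -> t <= 1 ->
  sigma t < y ->
  exists2 d, 0 < d & forall s, 0 <= s -> s <= 1 -> `|s - t| <= d -> sigma s <= y.
Proof.
move=> st t0 t1 ty; have e0 : 0 < y - sigma t by rewrite subr_gt0.
have [d d0 h] := sigma_near st t0 t1 e0.
by exists d => // s s0 s1 sd; have := h s s0 s1 sd; rewrite ler_norml => /andP[]; lra.
Qed.

Lemma sigma_above f U Ul sigma t y : stationary f U Ul sigma -> 0 <= t -> t <= 1 ->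
  y < sigma t ->
  exists2 d, 0 < d & forall s, 0 <= s -> s <= 1 -> `|s - t| <= d -> y <= sigma s.
Proof.
move=> /stationaryN st t0 t1; rewrite -ltrN2 => ty.
have [d d0 h] := sigma_below st t0 t1 ty.
by exists d => // s s0 s1 sd; have := h s s0 s1 sd; rewrite lerN2.
Qed.

(** Continuity at t of some representative of f, whose value there is y, in a form
    insensitive to null sets. *)
Definition ess_continuous f t y := forall e, 0 < e -> exists2 d, 0 < d &
  {ae mu, forall x : R, 0 < x < 1 -> `|x - t| <= d -> `|f x - y| <= e}.

Lemma ess_continuousN f t y : ess_continuous f t y ->
  ess_continuous (fun t => - f t) t (- y).
Proof.
move=> h e e0; have [d d0 hd] := h e e0; exists d => //.
by apply: aeS hd => x hx x01 /(hx x01); rewrite -opprD normrN.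
Qed.

(** sigma cannot exceed L, so at a point where it equals L it cannot have been
    decreasing just before ... *)
Lemma left_limit_at_max f U Ul sigma t y : stationary f U Ul sigma -> 0 < t -> t < 1 ->
  ess_continuous f t y -> sigma t = L -> y <= Ul t.
Proof.
move=> st t0 t1 fy tL; rewrite leNgt; apply/negP => lt.
(* U and f both stay within e of their limits, and U - f remains below - e *)
pose e := (y - Ul t) / 3; have e0 : 0 < e by rewrite divr_gt0// subr_gt0.
have [d1 d10 h1] := rep_left st t0 e0; have [d2 d20 h2] := fy e e0.
pose s := Num.max (Num.max (t - d1) (t - d2)) (t / 2).
have s0 : 0 < s by rewrite !lt_max divr_gt0 ?orbT.
have st_ : s < t by rewrite !gt_max ltrBlDr ltrDl d10 ltrBlDr ltrDl d20 /=; lra.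
have sd1 : t - d1 <= s by rewrite !le_max lexx.
have sd2 : t - d2 <= s by rewrite !le_max lexx orbT.
have Hm : {ae mu, forall x : R, s < x < t -> U x - f x <= - e}.
  apply: aeS h2 => x h2 /andP[sx xt].
  have x2 : `|x - t| <= d2 by rewrite ler_norml; apply/andP; split; lra.
  have x01 : 0 < x < 1 by lra.
  have := h2 x01 x2; have := h1 x (ltW (lt_trans s0 sx)) (le_trans sd1 (ltW sx)) xt.
  rewrite !ler_norml /e => /andP[_ a] /andP[b _]; lra.
have := increment_le st (ltW s0) (ltW st_) (ltW t1) Hm.
have := sigma_le st (ltW s0) (lt_trans st_ t1).
rewrite tL ler_norml => /andP[_ sL]; rewrite mulNr mulrN.
have : 0 < lambda * (e * (t - s)) by rewrite !mulr_gt0// subr_gt0.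
by move: (lambda * _) => k; lra.
Qed.

(** ... nor can it increase just after. *)
Lemma right_value_at_max f U Ul sigma t y : stationary f U Ul sigma -> 0 < t -> t < 1 ->
  ess_continuous f t y -> sigma t = L -> U t <= y.
Proof.
move=> st t0 t1 fy tL; rewrite leNgt; apply/negP => lt.
pose e := (U t - y) / 3; have e0 : 0 < e by rewrite divr_gt0// subr_gt0.
have [d1 d10 h1] := rep_right st (ltW t0) e0; have [d2 d20 h2] := fy e e0.
pose s := Num.min (Num.min (t + d1) (t + d2)) ((t + 1) / 2).
have s1 : s < 1 by rewrite !gt_min; apply/orP; right; lra.
have st_ : t < s by rewrite !lt_min !ltrDl d10 d20 /=; lra.
have sd1 : s <= t + d1 by rewrite !ge_min lexx.
have sd2 : s <= t + d2 by rewrite !ge_min lexx orbT.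
have Hm : {ae mu, forall x : R, t < x < s -> e <= U x - f x}.
  apply: aeS h2 => x h2 /andP[tx xs].
  have x2 : `|x - t| <= d2 by rewrite ler_norml; apply/andP; split; lra.
  have x01 : 0 < x < 1 by lra.
  have := h2 x01 x2; have := h1 x (ltW tx) (le_trans (ltW xs) sd1).
  rewrite !ler_norml /e => /andP[a _] /andP[_ b]; lra.
have := increment_ge st (ltW t0) (ltW st_) (ltW s1) Hm.
have := sigma_le st (ltW (lt_trans t0 st_)) s1.
rewrite tL ler_norml => /andP[_ sL].
have : 0 < lambda * (e * (s - t)) by rewrite !mulr_gt0// subr_gt0.
by move: (lambda * _) => k; lra.
Qed.

(** An upward jump would force sigma = L, and then U t <= y <= Ul t. *)
Lemma no_upward_jump f U Ul sigma t y : stationary f U Ul sigma -> 0 < t -> t < 1 ->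
  ess_continuous f t y -> U t <= Ul t.
Proof.
move=> st t0 t1 fy; have [tL|Lt] := ltP (sigma t) L; last first.
  have tL : sigma t = L.
    apply/eqP; rewrite eq_le Lt andbT; have := sigma_le st (ltW t0) t1.
    by rewrite ler_norml => /andP[].
  exact: le_trans (right_value_at_max st t0 t1 fy tL) (left_limit_at_max st t0 t1 fy tL).
have [p tp] := Phi_above hF1 hF2 hF4 tL.
have [d d0 hd] := sigma_below st (ltW t0) (ltW t1) tp.
rewrite leNgt; apply/negP => lt; pose e := (U t - Ul t) / 3.
have e0 : 0 < e by rewrite divr_gt0// subr_gt0.
have [d1 d10 h1] := rep_left st t0 e0.
have k0 : 0 < e / (`|p| + 1) by rewrite divr_gt0// ltr_wpDl.
pose s := Num.max (Num.max (t - d1) (t - d)) (Num.max (t - e / (`|p| + 1)) (t / 2)).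
have s0 : 0 < s by rewrite !lt_max divr_gt0 ?orbT.
have st_ : s < t by rewrite !gt_max !gtrDl !oppr_lt0 d10 d0 k0 /=; lra.
have sd1 : t - d1 <= s by rewrite !le_max lexx.
have sd : t - d <= s by rewrite !le_max lexx orbT.
have sk : t - s <= e / (`|p| + 1) by rewrite lerBlDr -lerBlDl !le_max lexx !orbT.
have := @slope_le _ _ _ _ st s t p (ltW s0) (ltW st_) t1.
move=> /(_ _)/wrap[x /andP[sx xt]|].
  apply: hd; [exact: ltW (lt_trans s0 sx)|lra|].
  by rewrite ler_norml; apply/andP; split; lra.
have := h1 s (ltW s0) sd1 st_; rewrite ler_norml => /andP[_ a] b.
have : p * (t - s) <= e.
  apply: (le_trans (ler_wpM2r _ (ler_norm p))); first by rewrite subr_ge0 ltW.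
  apply: (le_trans (ler_wpM2l (normr_ge0 _) sk)).
  by rewrite mulrA ler_pdivrMr ?ltr_wpDl// mulrDr mulr1 mulrC lerDl ltW.
by move: a b; rewrite /e; lra.
Qed.

Lemma rep_left_eq f U Ul sigma t y : stationary f U Ul sigma -> 0 < t -> t < 1 ->
  ess_continuous f t y -> Ul t = U t.
Proof.
move=> st t0 t1 fy; apply/eqP; rewrite eq_le (no_upward_jump st t0 t1 fy) andbT.
by have := no_upward_jump (stationaryN st) t0 t1 (ess_continuousN fy); rewrite lerN2.
Qed.

(** Continuity relative to [0, 1[: from 1 on, U depends on the values of the
    charge nu outside ]0, 1[. *)
Definition near_continuous g t := forall e, 0 < e -> exists2 d, 0 < d &
  forall s, 0 <= s -> s < 1 -> `|s - t| <= d -> `|g s - g t| <= e.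

Lemma rep_continuous f U Ul sigma t y : stationary f U Ul sigma -> 0 < t -> t < 1 ->
  ess_continuous f t y -> near_continuous U t.
Proof.
move=> st t0 t1 fy e e0.
have [d1 d10 h1] := rep_right st (ltW t0) e0; have [d2 d20 h2] := rep_left st t0 e0.
rewrite (rep_left_eq st t0 t1 fy) in h2.
exists (Num.min d1 d2); first by rewrite lt_min d10.
move=> s s0 _; rewrite le_min => /andP[]; rewrite !ler_norml => /andP[a1 b1] /andP[a2 b2].
rewrite -ler_norml.
by have [ts|ts] := leP t s; [apply: h1|apply: h2] => //; lra.
Qed.

Lemma rep_continuous0 f U Ul sigma : stationary f U Ul sigma -> near_continuous U 0.
Proof.
move=> st e e0; have [d d0 h] := rep_right st (lexx 0) e0; exists d => // s s0 _.
by rewrite subr0 ger0_norm// => sd; apply: h; rewrite ?add0r.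
Qed.

(** The inverse of Phi on ]-L, L[. *)
Definition Psi y := xget (0 : R) [set p | Phi p = y].

Lemma PhiK : cancel Phi Psi.
Proof.
move=> p; rewrite /Psi; case: xgetP => [q _ /= e|/(_ p)/(_ erefl)//].
by apply/eqP; rewrite eq_le -(Phi_leE hF1 hF4 q) -(Phi_leE hF1 hF4 p) e lexx.
Qed.

Lemma PsiK y : `|y| < L -> Phi (Psi y) = y.
Proof.
by rewrite ltr_norml => /(Phi_surj hF1 hF2 hF4)[p <-]; rewrite PhiK.
Qed.

Lemma Psi_derive y : `|y| < L -> is_derive y (1 : R) Psi (derive1 Phi (Psi y))^-1.
Proof.
move=> yL; rewrite -{1}(PsiK yL).
apply: (@is_derive_inverse _ Phi).
- by apply: filterE => x; exact: PhiK.
- by apply: filterE => x; exact: Phi_continuous hF1 x.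
- by rewrite derive1E; apply: derivableP; exact: Phi_derivable hF1 _.
- by rewrite gt_eqF//; exact: hF4.
Qed.

Lemma slope_near f U Ul sigma t e : stationary f U Ul sigma -> 0 <= t -> t <= 1 ->
  `|sigma t| < L -> 0 < e -> exists2 d, 0 < d &
  forall a b, 0 <= a -> a <= b -> b < 1 -> `|a - t| <= d -> `|b - t| <= d ->
    (Psi (sigma t) - e) * (b - a) <= U b - U a <= (Psi (sigma t) + e) * (b - a).
Proof.
move=> st t0 t1 tL e0.
have [d1 d10 h1] : exists2 d, 0 < d & forall s, 0 <= s -> s <= 1 -> `|s - t| <= d ->
    sigma s <= Phi (Psi (sigma t) + e).
  by apply: (sigma_below st) => //; rewrite -{1}(PsiK tL); apply: Phi_lt; rewrite // ltrDl.
have [d2 d20 h2] : exists2 d, 0 < d & forall s, 0 <= s -> s <= 1 -> `|s - t| <= d ->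
    Phi (Psi (sigma t) - e) <= sigma s.
  by apply: (sigma_above st) => //; rewrite -{2}(PsiK tL); apply: Phi_lt; rewrite // gtrBl.
exists (Num.min d1 d2); first by rewrite lt_min d10.
move=> a b a0 ab b1; rewrite !le_min => /andP[].
rewrite !ler_norml => /andP[? ?] /andP[? ?] /andP[/andP[? ?] /andP[? ?]].
apply/andP; split.
- apply: (slope_ge st) => // x /andP[ax xb]; apply: h2; [lra|lra|].
  by rewrite ler_norml; apply/andP; split; lra.
- apply: (slope_le st) => // x /andP[ax xb]; apply: h1; [lra|lra|].
  by rewrite ler_norml; apply/andP; split; lra.
Qed.

Lemma increment_near f U Ul sigma t y e : stationary f U Ul sigma ->
  near_continuous U t -> ess_continuous f t y -> 0 < e -> exists2 d, 0 < d &
  forall a b, 0 <= a -> a <= b -> b < 1 -> `|a - t| <= d -> `|b - t| <= d ->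
    lambda * ((U t - y - e) * (b - a)) <= sigma b - sigma a <=
    lambda * ((U t - y + e) * (b - a)).
Proof.
move=> st cU cf e0; have e20 : 0 < e / 2 by rewrite divr_gt0.
have [d1 d10 h1] := cU _ e20; have [d2 d20 h2] := cf _ e20.
exists (Num.min d1 d2); first by rewrite lt_min d10.
move=> a b a0 ab b1; rewrite !le_min => /andP[].
rewrite !ler_norml => /andP[? ?] /andP[? ?] /andP[/andP[? ?] /andP[? ?]].
have H x : `|x - t| <= d2 -> `|f x - y| <= e / 2 -> a < x < b ->
    U t - y - e <= U x - f x <= U t - y + e.
  move=> _ + /andP[ax xb]; have /h1 : 0 <= x by lra.
  have x1 : x < 1 by lra.
  have xd : `|x - t| <= d1 by rewrite ler_norml; apply/andP; split; lra.
  move=> /(_ x1 xd); rewrite !ler_norml => /andP[? ?] /andP[? ?].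
  by apply/andP; split; lra.
have xd x : a < x < b -> `|x - t| <= d2.
  by move=> /andP[? ?]; rewrite ler_norml; apply/andP; split; lra.
have x01 x : a < x < b -> 0 < x < 1 by move=> /andP[? ?]; apply/andP; split; lra.
apply/andP; split.
- apply: (increment_ge st) => //; first exact: ltW.
  by apply: aeS h2 => x h xab; have /andP[] := H x (xd x xab) (h (x01 x xab) (xd x xab)) xab.
- apply: (increment_le st) => //; first exact: ltW.
  by apply: aeS h2 => x h xab; have /andP[] := H x (xd x xab) (h (x01 x xab) (xd x xab)) xab.
Qed.

(** Where sigma = L the slope of U would be infinite, whereas f grows at most
    linearly; sigma would then exceed L. *)
Lemma sigma_lt_max f U Ul sigma t y M r : stationary f U Ul sigma -> 0 < t -> t < 1 ->
  ess_continuous f t y -> 0 < r ->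
  {ae mu, forall x : R, t < x < t + r -> f x <= y + M * (x - t)} -> sigma t < L.
Proof.
move=> st t0 t1 fy r0 fM; rewrite lt_neqAle; apply/andP; split; last first.
  by have := sigma_le st (ltW t0) t1; rewrite ler_norml => /andP[].
apply/negP => /eqP tL.
have yU : y <= U t.
  by rewrite -(rep_left_eq st t0 t1 fy); exact: left_limit_at_max st t0 t1 fy tL.
have PL : Phi (M + 1) < sigma t by rewrite tL; exact: Phi_lt_lambda_inf hF1 hF2 hF4 _.
have [d d0 hd] := sigma_above st (ltW t0) (ltW t1) PL.
pose h := Num.min (Num.min d r) (1 - t) / 3.
have h0 : 0 < h by rewrite divr_gt0// !lt_min d0 r0 subr_gt0.
have hd3 : 3 * h <= d by rewrite /h mulrC divfK// !ge_min lexx.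
have hr3 : 3 * h <= r by rewrite /h mulrC divfK// !ge_min lexx orbT.
have ht3 : 3 * h <= 1 - t by rewrite /h mulrC divfK// !ge_min lexx !orbT.
clearbody h.
have slope x : t <= x -> x <= t + 2 * h -> (M + 1) * (x - t) <= U x - U t.
  move=> tx xh; apply: (slope_ge st) => //; [exact: ltW|lra|].
  move=> z /andP[tz zx]; apply: hd; [lra|lra|].
  by rewrite ler_norml; apply/andP; split; lra.
have res (s1 : R) : {ae mu, forall x : R, t + s1 < x < t + 2 * h -> 0 <= s1 -> s1 <= U x - f x}.
  apply: aeS fM => x fM /andP[sx xh] s10.
  have tx : t <= x by lra.
  have xh2 : x <= t + 2 * h by lra.
  have xr : t < x < t + r by apply/andP; split; lra.
  by have := fM xr; have := slope x tx xh2; rewrite mulrDl mul1r; lra.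
(* U - f is nonnegative on the first half of ]t, t + 2 h[, and at least h on the second *)
have i1 : lambda * (0 * (t + h - t)) <= sigma (t + h) - sigma t.
  apply: (increment_ge st); [exact: ltW|lra|lra|].
  by apply: aeS (res 0) => x h0x /andP[tx xh]; apply: h0x => //; apply/andP; split; lra.
have i2 : lambda * (h * (t + 2 * h - (t + h))) <= sigma (t + 2 * h) - sigma (t + h).
  apply: (increment_ge st); [lra|lra|lra|].
  by apply: aeS (res h) => x h0x /h0x; apply; exact: ltW.
have : 0 < lambda * (h * h) by rewrite !mulr_gt0.
have := @sigma_le _ _ _ _ st (t + 2 * h) _ _; rewrite -tL.
move=> /(_ _ _)/wrap[||]; [lra|lra|rewrite ler_norml => /andP[_]].
move: i1 i2; rewrite mul0r mulr0.
have -> : t + 2 * h - (t + h) = h by ring.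
lra.
Qed.

(** ** Lipschitz data *)

Lemma near_itv a b t : a < t -> t < b -> \forall x \near t, a < x < b.
Proof.
move=> at_ tb; near=> x; apply/andP; split; near: x.
- exact: lt_nbhsr.
- exact: lt_nbhsl.
Unshelve. all: by end_near. Qed.

Lemma is_derive_of_slopes g t l :
  (forall e, 0 < e -> exists2 d, 0 < d & forall x y, t - d <= x -> x <= y -> y <= t + d ->
     (l - e) * (y - x) <= g y - g x <= (l + e) * (y - x)) ->
  is_derive t (1 : R) g l.
Proof.
move=> H; apply: is_derive1_eps => e e0; have [d d0 hd] := H e e0.
have H0 : \forall h \near (0 : R), `|h| <= d by exact: (@nbhs0_le R R).
near=> h; have hle : `|h| <= d by near: h.
move: hle; rewrite ler_norml => /andP[h1 h2].
have [h0|h0] := leP 0 h.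
  have /andP[] : (l - e) * (h + t - t) <= g (h + t) - g t <= (l + e) * (h + t - t).
    by apply: hd; lra.
  by rewrite addrK => u v; rewrite [`|h|]ger0_norm// ler_norml; apply/andP; split; lra.
have /andP[] : (l - e) * (t - (h + t)) <= g t - g (h + t) <= (l + e) * (t - (h + t)).
  by apply: hd; lra.
have -> : t - (h + t) = - h by ring.
by move=> u v; rewrite [`|h|]ltr0_norm// ler_norml; apply/andP; split; lra.
Unshelve. all: by end_near. Qed.

Lemma rep_is_derive f U Ul sigma ug t a b : stationary f U Ul sigma ->
  0 <= a -> a < t -> t < b -> b <= 1 -> (forall x, a < x < b -> ug x = U x) ->
  `|sigma t| < L -> is_derive t (1 : R) ug (Psi (sigma t)).
Proof.
move=> st a0 at_ tb b1 ugU tL; apply: is_derive_of_slopes => e e0.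
have [t0 t1] : 0 <= t /\ t <= 1 by lra.
have [d d0 hd] := slope_near st t0 t1 tL e0.
pose r := Num.min d (Num.min (t - a) (b - t) / 2).
have r0 : 0 < r by rewrite lt_min d0 divr_gt0// lt_min !subr_gt0 at_.
have rd : r <= d by rewrite ge_min lexx.
have ra : 2 * r <= t - a by rewrite mulrC -ler_pdivlMr// ge_min ler_pM2r// ge_min lexx orbT.
have rb : 2 * r <= b - t.
  by rewrite mulrC -ler_pdivlMr// ge_min ler_pM2r// ge_min lexx !orbT.
clearbody r; exists r => // x y x1 xy y1; rewrite !ugU; [|lra..].
by apply: hd; rewrite ?ler_norml; lra.
Qed.

Lemma sigma_is_derive f U Ul sigma t y : stationary f U Ul sigma -> 0 < t -> t < 1 ->
  ess_continuous f t y -> is_derive t (1 : R) sigma (lambda * (U t - y)).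
Proof.
move=> st t0 t1 fy; apply: is_derive_of_slopes => e e0.
have k0 : 0 < e / lambda by rewrite divr_gt0.
have [d d0 hd] := increment_near st (rep_continuous st t0 t1 fy) fy k0.
pose r := Num.min d (Num.min t (1 - t) / 2).
have r0 : 0 < r by rewrite lt_min d0 divr_gt0// lt_min t0 subr_gt0.
have rd : r <= d by rewrite ge_min lexx.
have ra : 2 * r <= t by rewrite mulrC -ler_pdivlMr// ge_min ler_pM2r// ge_min lexx orbT.
have rb : 2 * r <= 1 - t.
  by rewrite mulrC -ler_pdivlMr// ge_min ler_pM2r// ge_min lexx !orbT.
clearbody r; exists r => // x z x1 xz z1.
have E (s : R) : lambda * ((U t - y + s * (e / lambda)) * (z - x)) =
    (lambda * (U t - y) + s * e) * (z - x) by field; rewrite gt_eqF.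
have := E 1; have := E (-1); rewrite !mulN1r !mul1r => <- <-.
by apply: hd; rewrite ?ler_norml; lra.
Qed.

Section LipschitzDatum.
Variables (f U Ul sigma g : R -> R) (a b M : R).
Hypotheses (st : stationary f U Ul sigma) (a0 : 0 <= a) (b1 : b <= 1).
Hypothesis fg : {ae mu, forall x : R, a < x < b -> g x = f x}.
Hypothesis gM : forall x y, a < x < b -> a < y < b -> `|g x - g y| <= M * `|x - y|.

Let in01 t : a < t < b -> 0 < t /\ t < 1.
Proof. by move: a0 b1 => ha hb /andP[? ?]; split; lra. Qed.

Lemma lipschitz_ess_continuous t : a < t < b -> ess_continuous f t (g t).
Proof.
move=> tab e e0; have M1 : 0 < `|M| + 1 by rewrite ltr_wpDl.
pose d := Num.min (e / (`|M| + 1)) (Num.min (t - a) (b - t) / 2).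
have ta : 0 < t - a by lra.
have bt : 0 < b - t by lra.
have d0 : 0 < d by rewrite lt_min !divr_gt0// lt_min ta.
have da : 2 * d <= t - a by rewrite mulrC -ler_pdivlMr// ge_min ler_pM2r// ge_min lexx orbT.
have db : 2 * d <= b - t.
  by rewrite mulrC -ler_pdivlMr// ge_min ler_pM2r// ge_min lexx !orbT.
have de : (`|M| + 1) * d <= e by rewrite mulrC -ler_pdivlMr// ge_min lexx.
clearbody d; exists d => //; apply: aeS fg => x fx _ xd.
have xab : a < x < b by move: xd; rewrite ler_norml => /andP[? ?]; apply/andP; split; lra.
rewrite -fx//; apply: (le_trans (gM xab tab)).
apply: (le_trans (ler_wpM2r (normr_ge0 _) (ler_norm M))); apply: le_trans de.
by apply: ler_pM => //; rewrite lerDl.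
Qed.

Lemma lipschitz_sigma_lt t : a < t < b -> `|sigma t| < L.
Proof.
move=> tab; have [t0 t1] := in01 tab.
have bt : 0 < b - t by lra.
have bound x : t < x < t + (b - t) -> `|g x - g t| <= M * (x - t).
  move=> /andP[tx xb]; have xab : a < x < b by lra.
  by have := gM xab tab; rewrite [`|x - t|]gtr0_norm// subr_gt0.
rewrite ltr_norml; apply/andP; split.
  rewrite ltrNl; apply: (@sigma_lt_max _ _ _ (fun t => - sigma t) t _ M _ (stationaryN st) t0 t1
    (ess_continuousN (lipschitz_ess_continuous tab)) bt).
  apply: aeS fg => x fx xb; rewrite -fx; last lra.
  by have := bound x xb; rewrite ler_norml => /andP[]; lra.
apply: (@sigma_lt_max _ _ _ _ t _ M _ st t0 t1 (lipschitz_ess_continuous tab) bt).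
apply: aeS fg => x fx xb; rewrite -fx; last lra.
by have := bound x xb; rewrite ler_norml => /andP[]; lra.
Qed.

Lemma lipschitz_continuous t : a < t < b -> {for t, continuous g}.
Proof.
move=> tab; apply/cvgrPdist_le => e e0; have M1 : 0 < `|M| + 1 by rewrite ltr_wpDl.
have r0 : 0 < e / (`|M| + 1) by rewrite divr_gt0.
have h : \forall x \near t, t - e / (`|M| + 1) < x < t + e / (`|M| + 1).
  by apply: near_itv; rewrite ?gtrBl ?ltrDl.
have key x : t - e / (`|M| + 1) < x < t + e / (`|M| + 1) ->
    `|t - x| <= e / (`|M| + 1).
  by move=> /andP[? ?]; rewrite ler_norml; apply/andP; split; lra.
have h2 : \forall x \near t, a < x < b by move: tab => /andP[? ?]; exact: near_itv.
near=> x; have xab : a < x < b by near: x.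
apply: (le_trans (gM tab xab)).
apply: (le_trans (ler_wpM2r (normr_ge0 _) (ler_norm M))).
apply: (@le_trans _ _ (`|M| * (e / (`|M| + 1)))).
  by apply: ler_wpM2l => //; apply: key; near: x.
by rewrite mulrA ler_pdivrMr// mulrDr mulr1 mulrC lerDl ltW.
Unshelve. all: by end_near. Qed.

(** Locally U' = Psi o sigma, and sigma' = lambda (U - g) is continuous. *)
Lemma lipschitz_C2 ug : (forall x, a < x < b -> ug x = U x) -> C2_on `]a, b[ ug.
Proof.
move=> ugU.
have d1 t : a < t < b -> is_derive t (1 : R) ug (Psi (sigma t)).
  move=> /andP[ta tb]; apply: (rep_is_derive st a0 ta tb b1 ugU).
  by apply: lipschitz_sigma_lt; rewrite ta.
have e1 t : a < t < b -> derive1 ug t = Psi (sigma t).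
  by move=> tab; rewrite derive1E; exact: (@derive_val _ _ _ _ _ _ _ (d1 t tab)).
pose k t := (derive1 Phi (Psi (sigma t)))^-1 * (lambda * (ug t - g t)).
have ds t : a < t < b -> is_derive t (1 : R) sigma (lambda * (ug t - g t)).
  move=> tab; rewrite ugU//.
  have [t0 t1] := in01 tab.
  exact: (sigma_is_derive st t0 t1 (lipschitz_ess_continuous tab)).
have d2 t : a < t < b -> is_derive t (1 : R) (derive1 ug) (k t).
  move=> tab; apply: (@near_eq_is_derive _ _ _ (Psi \o sigma)).
    have /andP[ta tb] := tab; have h := near_itv ta tb.
    by near=> x; rewrite e1//; near: x.
  apply: is_derive1_comp; last exact: ds.
  by apply: Psi_derive; exact: lipschitz_sigma_lt.
have e2 t : a < t < b -> derive1 (derive1 ug) t = k t.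
  by move=> tab; rewrite derive1E; exact: (@derive_val _ _ _ _ _ _ _ (d2 t tab)).
split.
- by move=> t; rewrite /= in_itv/= => /d1[].
- by move=> t; rewrite /= in_itv/= => /d2[].
move=> t; rewrite /= in_itv/= => tab.
have kt : {for t, continuous k}.
  have cs : {for t, continuous sigma}.
    by apply: derivable_continuous; have [] := ds t tab.
  have cP : {for sigma t, continuous Psi}.
    by apply: derivable_continuous; have [] := Psi_derive (lipschitz_sigma_lt tab).
  have cu : {for t, continuous ug}.
    by apply: derivable_continuous; have [] := d1 t tab.
  have cg : {for t, continuous g}.
    exact: lipschitz_continuous.
  apply: cvgM.
    apply: cvgV; first by rewrite gt_eqF//; exact: hF4.
    exact: (continuous_comp (continuous_comp cs cP)
      (@Phi_derive_continuous _ _ hF1 (Psi (sigma t)))).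
  by apply: cvgM; [exact: cvg_cst|exact: cvgB].
rewrite /prop_for /continuous_at e2//; apply: cvg_trans kt; apply: near_eq_cvg.
have /andP[ta tb] := tab; have h := near_itv ta tb.
by near=> x; rewrite e2//; near: x.
Unshelve. all: by end_near. Qed.

End LipschitzDatum.

(** ** Sobolev data *)

(** Maximum principle.  If U > m at s, then U - f > 0 near s, so sigma is
    increasing there; on the side of s where the sign of sigma makes U move
    away from m, both properties persist up to the end point, where sigma
    should vanish. *)
Lemma rep_le f U Ul sigma m s : stationary f U Ul sigma ->
  (forall t, 0 < t -> t < 1 -> near_continuous U t) ->
  {ae mu, forall x : R, 0 < x < 1 -> f x <= m} -> 0 < s -> s < 1 -> U s <= m.
Proof.
move=> st cU fm s0 s1; rewrite leNgt; apply/negP => mU.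
have inc x y k : 0 <= x -> x <= y -> y <= 1 -> (forall z, x < z < y -> m + k <= U z) ->
    lambda * (k * (y - x)) <= sigma y - sigma x.
  move=> x0 xy y1 h; apply: (increment_ge st) => //.
  apply: aeS fm => z fz zxy; have z01 : 0 < z < 1 by lra.
  by have := fz z01; have := h z zxy; lra.
pose k := U s - m; have k0 : 0 < k by rewrite subr_gt0.
have e0 : 0 < k / 2 by rewrite divr_gt0.
have [ss|ss] := leP 0 (sigma s).
- have H t : s <= t -> t < 1 -> U s <= U t /\ 0 <= sigma t.
    move=> st_ t1; apply: (@real_induction _ (fun x => U s <= U x /\ 0 <= sigma x) s t) => //.
    + move=> x sx xt /(_ x sx (lexx x))[Ux sgx].
      have x0 : 0 <= x by lra.
      have [d d0 hd] := rep_right st x0 e0; exists d => // y xy yd yt.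
      have Um z : x <= z -> z <= y -> m <= U z.
        move=> xz zy; have := hd z xz (le_trans zy yd); rewrite ler_norml => /andP[].
        by rewrite /k; lra.
      have sg z : x <= z -> z <= y -> 0 <= sigma z.
        move=> xz zy; have z1 : z <= 1 by lra.
        have := inc x z 0 x0 xz z1; rewrite mul0r mulr0 addr0 => /(_ _)/wrap[|]; last by lra.
        by move=> w /andP[xw wz]; apply: Um; lra.
      split; last exact: sg.
      have := @slope_ge _ _ _ _ st x y 0 x0 xy.
      rewrite mul0r (Phi0 hF1) => /(_ _ _)/wrap[||]; [lra| |lra].
      by move=> z /andP[xz zy]; apply: sg => //; exact: ltW.
    + move=> x sx xt Hx; have s0' := ltW s0.
      have sgx : 0 <= sigma x.
        have x1 : x <= 1 by lra.
        have := inc s x 0 s0' (ltW sx) x1; rewrite mul0r mulr0 addr0 => /(_ _)/wrap[|]; last by lra.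
        by move=> z /andP[sz zx]; have [] := Hx z (ltW sz) zx; lra.
      split => //.
      have := @slope_ge _ _ _ _ st s x 0 s0' (ltW sx).
      rewrite mul0r (Phi0 hF1) => /(_ _ _)/wrap[||]; [lra| |lra].
      move=> z /andP[sz]; rewrite le_eqVlt => /predU1P[->//|zx].
      by have [] := Hx z (ltW sz) zx.
  have := inc s 1 k (ltW s0) (ltW s1) (lexx 1) _.
  rewrite (sigma_at1 st) => /(_ _)/wrap[|].
    by move=> z /andP[sz z1]; have [] := H z (ltW sz) z1; rewrite /k; lra.
  have : 0 < lambda * (k * (1 - s)) by rewrite mulr_gt0// mulr_gt0// subr_gt0.
  by move: (lambda * _) => w; lra.
- have H t : 0 < t -> t <= s -> U s <= U t /\ sigma t <= 0.
    move=> t0 ts.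
    apply: (@real_induction_left _ (fun x => U s <= U x /\ sigma x <= 0) t s) => //.
    + by split => //; exact: ltW.
    + move=> x tx xs /(_ x (lexx x) xs)[Ux sgx].
      have [x0 x1] : 0 < x /\ x < 1 by lra.
      have [d d0 hd] := cU x x0 x1 _ e0; exists d => // y yx yd ty.
      have Um z : y <= z -> z <= x -> m <= U z.
        move=> yz zx; have [z0 z1] : 0 <= z /\ z < 1 by lra.
        have zd : `|z - x| <= d by rewrite ler_norml; apply/andP; split; lra.
        by have := hd z z0 z1 zd; rewrite ler_norml => /andP[]; rewrite /k; lra.
      have sg z : y <= z -> z <= x -> sigma z <= 0.
        move=> yz zx; have z0 : 0 <= z by lra.
        have := inc z x 0 z0 zx (ltW x1); rewrite mul0r mulr0 addr0 => /(_ _)/wrap[|]; last by lra.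
        by move=> w /andP[zw wx]; apply: Um; lra.
      split; last exact: sg.
      have y0 : 0 <= y by lra.
      have := @slope_le _ _ _ _ st y x 0 y0 yx x1.
      rewrite mul0r (Phi0 hF1) => /(_ _)/wrap[|]; [|lra].
      by move=> z /andP[yz zx]; apply: sg => //; exact: ltW.
    + move=> x tx xs Hx; have x0 : 0 <= x by lra.
      have sgx : sigma x <= 0.
        have := inc x s 0 x0 (ltW xs) (ltW s1); rewrite mul0r mulr0 addr0 => /(_ _)/wrap[|]; last by lra.
        by move=> z /andP[xz zs]; have [] := Hx z xz (ltW zs); lra.
      split => //.
      have := @slope_le _ _ _ _ st x s 0 x0 (ltW xs) s1.
      rewrite mul0r (Phi0 hF1) => /(_ _)/wrap[|]; [|lra].
      by move=> z /andP[xz zs]; have [] := Hx z xz zs.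
  have := inc 0 s k (lexx 0) (ltW s0) (ltW s1) _.
  rewrite (sigma_at0 st) => /(_ _)/wrap[|].
    by move=> z /andP[z0 zs]; have [] := H z z0 (ltW zs); rewrite /k; lra.
  have : 0 < lambda * (k * (s - 0)) by rewrite subr0 mulr_gt0// mulr_gt0.
  by move: (lambda * _) => w; lra.
Qed.

(** The Legendre-type function of the integrand whose limit is omega_infty. *)
Definition W p := p * Phi p - F p.

(** The tangent inequality of F in terms of W. *)
Lemma W_increment p q : W q - W p <= q * (Phi q - Phi p).
Proof.
have := integrand_tangent hF1 hF4 p q; rewrite /W.
by move: (F p) (F q) (Phi p) (Phi q) => a b c d; lra.
Qed.

Lemma W0 : W 0 = 0.
Proof. by have [_ _ F0] := hF1; rewrite /W F0 mul0r subr0. Qed.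

Lemma W_norm p : W `|p| = W p.
Proof.
have [_ Feven _] := hF1; have [p0|p0] := leP 0 p; first by rewrite ger0_norm.
by rewrite ltr0_norm// /W (PhiN hF1) Feven mulrNN.
Qed.

Lemma W_nondecreasing p q : 0 <= p -> p <= q -> W p <= W q.
Proof.
move=> p0 pq; rewrite -subr_le0; apply: (le_trans (W_increment _ _)).
by rewrite mulr_ge0_le0// subr_le0 (Phi_leE hF1 hF4).
Qed.

Lemma W_lt_norm p q : 0 <= q -> W p < W q -> `|p| < q.
Proof.
move=> q0; rewrite -W_norm; apply: contraTT; rewrite -!leNgt; exact: W_nondecreasing.
Qed.

Lemma omega_inf_gt (B : R) : (B%:E < omega_inf F)%E -> exists2 q, 0 < q & B < W q.
Proof.
move=> Bo; apply: contrapT => no.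
pose h p : \bar R := (W (Num.max p 0))%:E.
have hnd : nondecreasing_fun h.
  move=> p q pq; rewrite lee_fin; apply: W_nondecreasing; first by rewrite le_max lexx orbT.
  by rewrite ge_max !le_max pq lexx orbT.
have hB p : (h p <= B%:E)%E.
  rewrite lee_fin leNgt; apply/negP => Bh; apply: no; exists (Num.max p 1).
    by rewrite lt_max ltr01 orbT.
  apply: (lt_le_trans Bh); apply: W_nondecreasing; first by rewrite le_max lexx orbT.
  by rewrite ge_max !le_max lexx ler01 orbT.
have E : omega_inf F = ereal_sup (range h).
  apply: cvg_lim => //; apply: cvg_trans (nondecreasing_cvge hnd); apply: near_eq_cvg.
  near=> p; rewrite /h max_l//; near: p; exact: nbhs_pinfty_ge.
move: Bo; rewrite E ltNge => /negP; apply.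
by apply: ge_ereal_sup => _ [p _ <-].
Unshelve. all: by end_near. Qed.

Lemma Psi_near f U Ul sigma t e : stationary f U Ul sigma -> 0 <= t -> t <= 1 ->
  `|sigma t| < L -> 0 < e -> exists2 d, 0 < d &
  forall s, 0 <= s -> s <= 1 -> `|s - t| <= d -> `|sigma s| < L ->
    `|Psi (sigma s) - Psi (sigma t)| <= e.
Proof.
move=> st t0 t1 tL e0; have := @derivable_continuous _ Psi (sigma t) _.
move=> /(_ _)/wrap[|]; first by have [] := Psi_derive tL.
move=> /cvgrPdist_le/(_ e e0) /nbhs_normP[r /= r0 hr].
have r20 : 0 < r / 2 by rewrite divr_gt0.
have [d d0 hd] := sigma_near st t0 t1 r20; exists d => // s s0 s1 sd _.
rewrite distrC; apply: hr; rewrite /= distrC.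
by apply: (le_lt_trans (hd s s0 s1 sd)); rewrite ltr_pdivrMr// ltr_pMr// ltr1n.
Qed.

Lemma product_estimate (a b A B x y : R) : `|a - A| <= x -> `|b - B| <= y ->
  `|a * b - A * B| <= `|A| * y + x * (`|B| + y).
Proof.
move=> aA bB; have -> : a * b - A * B = A * (b - B) + (a - A) * b by ring.
apply: (le_trans (ler_normD _ _)); rewrite !normrM; apply: lerD.
  by apply: ler_wpM2l.
apply: ler_pM => //; have -> : b = B + (b - B) by ring.
by apply: (le_trans (ler_normD _ _)); rewrite lerD2l.
Qed.

(** The first-order terms of the increments of W and of the square cancel:
    both are lambda times the slope of U times U - f. *)
Lemma energy_increment_estimate (P v h D pb Wd sd Ua Ub ga gb Vd : R) :
  0 <= D -> 0 < h -> h <= 1 -> `|v| <= 1 ->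
  Wd <= pb * sd -> `|pb - P| <= h -> `|sd - lambda * (v * D)| <= lambda * (h * D) ->
  `|Ub - Ua - P * D| <= h * D ->
  `|Ua - ga - v| <= h -> `|Ub - gb - v| <= h ->
  `|Ua - ga| <= 1 -> `|Ub - gb| <= 1 -> `|gb - ga| <= Vd ->
  Wd - lambda / 2 * ((Ub - gb) ^+ 2 - (Ua - ga) ^+ 2) - lambda * Vd <=
    2 * lambda * (`|P| + 2) * h * D.
Proof.
move=> D0 h0 h1 v1 Wp pP sP UP av bv a1 b1 gVd.
pose w := (Ua - ga + (Ub - gb)) / 2.
have wv : `|w - v| <= h.
  by move: av bv; rewrite /w !ler_norml => /andP[? ?] /andP[? ?]; apply/andP; split; lra.
have w1 : `|w| <= 1.
  by move: a1 b1; rewrite /w !ler_norml => /andP[? ?] /andP[? ?]; apply/andP; split; lra.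
have e1 := product_estimate pP sP; have e2 := product_estimate wv UP.
have e3 : w * (gb - ga) <= Vd.
  apply: (le_trans (ler_norm _)); rewrite normrM; apply: le_trans gVd.
  by rewrite ler_piMl.
have hD0 : 0 <= h * D by rewrite mulr_ge0// ltW.
have lhD0 : 0 <= lambda * (h * D) by rewrite mulr_ge0// ltW.
have E1 : `|P| * (lambda * (h * D)) + h * (`|lambda * (v * D)| + lambda * (h * D)) <=
    lambda * (h * D) * (`|P| + 2).
  have -> : `|lambda * (v * D)| = lambda * (`|v| * D).
    by rewrite normrM (gtr0_norm lambda_gt0) normrM (ger0_norm D0).
  have : lambda * (h * D) * (`|v| + h) <= lambda * (h * D) * 2 by apply: ler_wpM2l => //; lra.
  by move: (`|v|) (`|P|) => x y; lra.
have E2 : `|v| * (h * D) + h * (`|P * D| + h * D) <= h * D * (`|P| + 2).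
  rewrite normrM (ger0_norm D0).
  have : h * D * (`|v| + h) <= h * D * 2 by apply: ler_wpM2l => //; lra.
  by move: (`|v|) (`|P|) => x y; lra.
have {}e1 : pb * sd - P * (lambda * (v * D)) <= lambda * (h * D) * (`|P| + 2).
  exact: le_trans (le_trans (ler_norm _) e1) E1.
have {}e2 : v * (P * D) - w * (Ub - Ua) <= h * D * (`|P| + 2).
  by apply: (le_trans (ler_norm _)); rewrite distrC; exact: le_trans e2 E2.
have {}e2 := ler_wpM2l (ltW lambda_gt0) e2.
have {}e3 := ler_wpM2l (ltW lambda_gt0) e3.
have -> : (Ub - gb) ^+ 2 - (Ua - ga) ^+ 2 = 2 * (w * (Ub - Ua) - w * (gb - ga)).
  by rewrite /w; field.
move: Wp e1 e2 e3; clearbody w; move: (`|P|) => p; lra.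
Qed.

Lemma unit_interval_dist (y z : R) : 0 <= y <= 1 -> 0 <= z <= 1 -> `|z - y| <= 1.
Proof.
by move=> /andP[? ?] /andP[? ?]; rewrite ler_norml; apply/andP; split; lra.
Qed.

Lemma energy_increment_le (P h D pb Wa Wb sa sb Ua Ub ga gb Va Vb Ux gx e : R) :
  0 <= D -> 0 < h -> h <= 1 -> 2 * lambda * (`|P| + 2) * h <= e -> `|Ux - gx| <= 1 ->
  0 <= gb <= 1 -> 0 <= ga <= 1 -> 0 <= Ub <= 1 -> 0 <= Ua <= 1 ->
  Wb - Wa <= pb * (sb - sa) -> `|gb - ga| <= Vb - Va ->
  `|gb - gx| <= h / 2 -> `|ga - gx| <= h / 2 -> `|Ub - Ux| <= h / 2 -> `|Ua - Ux| <= h / 2 ->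
  `|pb - P| <= h ->
  lambda * ((Ux - gx - h) * D) <= sb - sa <= lambda * ((Ux - gx + h) * D) ->
  (P - h) * D <= Ub - Ua <= (P + h) * D ->
  (Wb - lambda / 2 * (Ub - gb) ^+ 2 - lambda * Vb) -
  (Wa - lambda / 2 * (Ua - ga) ^+ 2 - lambda * Va) <= e * D.
Proof.
move=> D0 h0 h1 he vn gb01 ga01 Ub01 Ua01 Wi gV gbx gax Ubx Uax pP sP UP.
have sP' : `|sb - sa - lambda * ((Ux - gx) * D)| <= lambda * (h * D).
  by move: sP => /andP[s1 s2]; clear -s1 s2; rewrite ler_norml; apply/andP; split; lra.
have UP' : `|Ub - Ua - P * D| <= h * D.
  by move: UP => /andP[s1 s2]; clear -s1 s2; rewrite ler_norml; apply/andP; split; lra.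
have near (y z : R) : `|y - gx| <= h / 2 -> `|z - Ux| <= h / 2 -> `|z - y - (Ux - gx)| <= h.
  clear; rewrite !ler_norml => /andP[? ?] /andP[? ?]; apply/andP; split; lra.
have := energy_increment_estimate D0 h0 h1 vn Wi pP sP' UP' (near _ _ gax Uax)
  (near _ _ gbx Ubx) (unit_interval_dist ga01 Ua01) (unit_interval_dist gb01 Ub01) gV.
have := ler_wpM2r D0 he; clear.
move: (2 * lambda * (`|P| + 2) * h) ((Ub - gb) ^+ 2) ((Ua - ga) ^+ 2) => k q1 q2; lra.
Qed.

Lemma decreasing_of_small_increments (G : R -> R) t : 0 <= t -> t < 1 ->
  (forall x e, 0 <= x -> x <= t -> 0 < e -> exists2 d, 0 < d &
     forall a b, 0 <= a -> a <= b -> b <= t -> `|a - x| <= d -> `|b - x| <= d ->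
       G b - G a <= e * (b - a)) ->
  G t <= G 0.
Proof.
move=> t0 t1 H; suff h e : 0 < e -> G t - G 0 <= e * t.
  rewrite -subr_le0; apply/ler_addgt0Pr => e e0; rewrite add0r.
  by apply: (le_trans (h e e0)); rewrite ler_piMr// ltW.
move=> e0; apply: (@real_induction _ (fun x => G x - G 0 <= e * x) 0 t) => //.
- by rewrite subrr mulr0.
- move=> x x0 xt /(_ x x0 (lexx x)) Px; have [d d0 hd] := H x e x0 (ltW xt) e0.
  exists d => // s xs sd st.
  have := hd x s x0 xs st; rewrite subrr normr0 ger0_norm ?subr_ge0// => /(_ (ltW d0)).
  by move=> /(_ _)/wrap[|]; lra.
- move=> x x0 xt Hx; have [d d0 hd] := H x e (ltW x0) xt e0.
  pose s := Num.max 0 (x - d).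
  have s0 : 0 <= s by rewrite le_max lexx.
  have sx : s < x by rewrite gt_max x0 gtrBl.
  have sd : x - d <= s by rewrite le_max lexx orbT.
  have Ps := Hx s s0 sx; clearbody s.
  have := hd s x s0 (ltW sx) xt; rewrite subrr normr0 distrC ger0_norm; last lra.
  by move=> /(_ _ (ltW d0))/wrap[|]; lra.
Qed.

(** V stands for the primitive of |g'| that vanishes at 0. *)
Section SobolevDatum.
Variables (f U Ul sigma g V : R -> R) (Vtot : R).
Hypothesis st : stationary f U Ul sigma.
Hypothesis fg : {ae mu, forall x : R, 0 < x < 1 -> g x = f x}.
Hypothesis gV : forall s t, 0 <= s -> s <= t -> t < 1 -> `|g t - g s| <= V t - V s.
Hypothesis V0 : V 0 = 0.
Hypothesis Vle : forall t, 0 <= t -> t < 1 -> V t <= Vtot.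
Hypothesis g_cont : forall t, 0 <= t -> t < 1 -> near_continuous g t.
Hypothesis g01 : forall t, 0 <= t -> t < 1 -> 0 <= g t <= 1.

Lemma sobolev_ess_continuous t : 0 <= t -> t < 1 -> ess_continuous f t (g t).
Proof.
move=> t0 t1 e e0; have [d d0 hd] := g_cont t0 t1 e0; exists d => //.
by apply: aeS fg => x fx x01 xd; rewrite -fx//; apply: hd => //; lra.
Qed.

Lemma sobolev_rep_continuous t : 0 <= t -> t < 1 -> near_continuous U t.
Proof.
rewrite le_eqVlt => /predU1P[<- _|t0 t1]; first exact: rep_continuous0 st.
exact: rep_continuous st t0 t1 (sobolev_ess_continuous (ltW t0) t1).
Qed.

Lemma sobolev_rep01_in t : 0 < t -> t < 1 -> 0 <= U t <= 1.
Proof.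
move=> t0 t1; apply/andP; split; last first.
  apply: (rep_le st) => // [s s0 s1|]; first exact: sobolev_rep_continuous (ltW s0) s1.
  by apply: aeS fg => x fx x01; rewrite -fx//; have := @g01 x; lra.
rewrite -oppr_le0; apply: (rep_le (stationaryN st)) => // [s s0 s1 e e0|].
  have [d d0 hd] := sobolev_rep_continuous (ltW s0) s1 e0.
  by exists d => // x x0 x1 xd; rewrite -opprD normrN; exact: hd.
by apply: aeS fg => x fx x01; rewrite -fx//; have := @g01 x; lra.
Qed.

Lemma sobolev_rep01 t : 0 <= t -> t < 1 -> 0 <= U t <= 1.
Proof.
rewrite le_eqVlt => /predU1P[<- _|]; last exact: sobolev_rep01_in.
have H e : 0 < e -> - e <= U 0 <= 1 + e.
  move=> e0; have [d d0 hd] := rep_right st (lexx 0) e0.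
  pose s := Num.min d (1 / 2).
  have s0 : 0 < s by rewrite lt_min d0 divr_gt0.
  have s1 : s < 1 by rewrite gt_min; apply/orP; right; lra.
  have sd : s <= 0 + d by rewrite add0r ge_min lexx.
  have := hd s (ltW s0) sd; have := sobolev_rep01_in s0 s1.
  by rewrite ler_norml => /andP[? ?] /andP[? ?]; apply/andP; split; lra.
apply/andP; split; apply/ler_addgt0Pr => e e0; have := H e e0; lra.
Qed.

(** Formally, W(U') - lambda/2 (U - g)^2 has derivative lambda (U - g) g', which is
    at most lambda |g'| because U and g take their values in [0, 1].  The
    increments are estimated directly, g' existing only almost everywhere. *)
Lemma sobolev_energy_near x e : 0 <= x -> x < 1 -> `|sigma x| < L -> 0 < e ->
  exists2 d, 0 < d & forall a b, 0 <= a -> a <= b -> b < 1 ->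
    `|a - x| <= d -> `|b - x| <= d -> `|sigma a| < L -> `|sigma b| < L ->
    (W (Psi (sigma b)) - lambda / 2 * (U b - g b) ^+ 2 - lambda * V b) -
    (W (Psi (sigma a)) - lambda / 2 * (U a - g a) ^+ 2 - lambda * V a) <= e * (b - a).
Proof.
move=> x0 x1 xL e0; pose P := Psi (sigma x); pose v := U x - g x.
have k0 : 0 < 2 * lambda * (`|P| + 2).
  by rewrite !mulr_gt0// ltr_wpDl.
(* the errors add up to at most 2 lambda (|P| + 2) h times the length of the interval *)
pose h := Num.min 1 (e / (2 * lambda * (`|P| + 2))).
have h0 : 0 < h by rewrite lt_min ltr01 divr_gt0.
have h1 : h <= 1 by rewrite ge_min lexx.
have he : 2 * lambda * (`|P| + 2) * h <= e.
  by rewrite mulrC -ler_pdivlMr// ge_min lexx orbT.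
clearbody h; have h20 : 0 < h / 2 by rewrite divr_gt0.
have [d1 d10 H1] := slope_near st x0 (ltW x1) xL h0.
have cU := sobolev_rep_continuous x0 x1.
have [d2 d20 H2] := increment_near st cU (sobolev_ess_continuous x0 x1) h0.
have [d3 d30 H3] := Psi_near st x0 (ltW x1) xL h0.
have [d4 d40 H4] := cU _ h20; have [d5 d50 H5] := g_cont x0 x1 h20.
exists (Num.min d1 (Num.min (Num.min d2 d3) (Num.min d4 d5))).
  by rewrite !lt_min d10 d20 d30 d40 d50.
move=> a b a0 ab b1; rewrite !le_min => /and3P[ax1 /andP[ax2 ax3] /andP[ax4 ax5]].
move=> /and3P[bx1 /andP[bx2 bx3] /andP[bx4 bx5]] aL bL.
have b0 := le_trans a0 ab; have a1 := le_lt_trans ab b1.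
have := H1 a b a0 ab b1 ax1 bx1; have := H2 a b a0 ab b1 ax2 bx2.
have := H3 b b0 (ltW b1) bx3 bL.
have := H4 a a0 a1 ax4; have := H4 b b0 b1 bx4.
have := H5 a a0 a1 ax5; have := H5 b b0 b1 bx5.
have := gV a0 ab b1; have := W_increment (Psi (sigma a)) (Psi (sigma b)).
rewrite !PsiK//.
have := sobolev_rep01 a0 a1; have := sobolev_rep01 b0 b1.
have := g01 a0 a1; have := g01 b0 b1.
have vn : `|v| <= 1 := unit_interval_dist (g01 x0 x1) (sobolev_rep01 x0 x1).
rewrite -/P -/v.
move=> gb01 ga01 Ub01 Ua01 Wi gVi gbx gax Ubx Uax pbP sP UP.
apply: (@energy_increment_le P h (b - a) (Psi (sigma b)) _ _ (sigma a) (sigma b) _ _ _ _ _ _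
  (U x) (g x) e) => //.
by rewrite subr_ge0.
Qed.

Local Notation B := (lambda * (1 / 2 + Vtot)).

Lemma sobolev_energy_bound t : 0 <= t -> t < 1 ->
  (forall x, 0 <= x -> x <= t -> `|sigma x| < L) -> W (Psi (sigma t)) <= B.
Proof.
move=> t0 t1 sL.
pose G x := W (Psi (sigma x)) - lambda / 2 * (U x - g x) ^+ 2 - lambda * V x.
have : G t <= G 0.
  apply: decreasing_of_small_increments => // x e x0 xt e0.
  have [d d0 hd] := sobolev_energy_near x0 (le_lt_trans xt t1) (sL x x0 xt) e0.
  exists d => // a b a0 ab bt ax bx.
  have b0 := le_trans a0 ab.
  apply: hd => //; [exact: le_lt_trans t1|apply: sL|apply: sL] => //.
  exact: le_trans bt.
have G0 : G 0 <= 0.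
  have -> : G 0 = - (lambda / 2 * (U 0 - g 0) ^+ 2).
    rewrite /G (sigma_at0 st) -[X in Psi X](Phi0 hF1) PhiK W0 V0.
    by move: ((U 0 - g 0) ^+ 2) => x; lra.
  by rewrite oppr_le0 mulr_ge0 ?sqr_ge0// divr_ge0// ltW.
have q1 : (U t - g t) ^+ 2 <= 1.
  rewrite -real_normK ?num_real// expr_le1//.
  exact: unit_interval_dist (g01 t0 t1) (sobolev_rep01 t0 t1).
have := ler_wpM2l (ltW lambda_gt0) q1; have := ler_wpM2l (ltW lambda_gt0) (Vle t0 t1).
by rewrite /G in G0 *; move: (W _) (_ ^+ 2) G0 => w q G0; lra.
Qed.

(** As long as |sigma| < L, the energy bound keeps |U'| below Q, hence |sigma|
    below Phi Q < L; starting from sigma 0 = 0 this propagates along [0, 1[. *)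
Lemma sobolev_sigma_lt Q t : 0 < Q -> B < W Q -> 0 <= t -> t < 1 -> `|sigma t| < Phi Q.
Proof.
move=> Q0 BQ t0 t1.
have PQ0 : 0 < Phi Q by rewrite -(Phi0 hF1) (Phi_ltE hF1 hF4).
have PQL := Phi_lt_lambda_inf hF1 hF2 hF4 Q.
apply: (@real_induction _ (fun x => `|sigma x| < Phi Q) 0 t) => //.
- by rewrite (sigma_at0 st) normr0.
- move=> x x0 xt /(_ x x0 (lexx x)) Px.
  have e0 : 0 < (Phi Q - `|sigma x|) / 2 by rewrite divr_gt0// subr_gt0.
  have x1 : x <= 1 by lra.
  have [d d0 hd] := sigma_near st x0 x1 e0; exists d => // s xs sd st'.
  have [s0 s1] : 0 <= s /\ s <= 1 by lra.
  have sxd : `|s - x| <= d by rewrite ler_norml; apply/andP; split; lra.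
  have := hd s s0 s1 sxd; have := ler_normB (sigma x) (sigma x - sigma s).
  by rewrite opprB addrCA subrr addr0 distrC; lra.
- move=> x x0 xt Hx; have x1 : x < 1 by lra.
  have xQ : `|sigma x| <= Phi Q.
    rewrite leNgt; apply/negP => Qx.
    have e0 : 0 < (`|sigma x| - Phi Q) / 2 by rewrite divr_gt0// subr_gt0.
    have [d d0 hd] := sigma_near st (ltW x0) (ltW x1) e0.
    pose s := Num.max 0 (x - d).
    have s0 : 0 <= s by rewrite le_max lexx.
    have sx : s < x by rewrite gt_max x0 gtrBl.
    have sd : x - d <= s by rewrite le_max lexx orbT.
    clearbody s; have sxd : `|s - x| <= d by rewrite ler_norml; apply/andP; split; lra.
    have := hd s s0 (le_trans (ltW sx) (ltW x1)) sxd; have := Hx s s0 sx.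
    have := ler_normB (sigma s) (sigma s - sigma x).
    by rewrite opprB addrCA subrr addr0; lra.
  have sL z : 0 <= z -> z <= x -> `|sigma z| < L.
    move=> z0; rewrite le_eqVlt => /predU1P[->|zx]; first exact: le_lt_trans PQL.
    exact: lt_trans (Hx z z0 zx) PQL.
  have h := le_lt_trans (sobolev_energy_bound (ltW x0) x1 sL) BQ.
  have := W_lt_norm (ltW Q0) h; rewrite ltr_norml => /andP[h1 h2].
  rewrite -(PsiK (sL x (ltW x0) (lexx x))) ltr_norml -(PhiN hF1) !(Phi_ltE hF1 hF4).
  by rewrite h1.
Qed.

End SobolevDatum.

(** ** Regularity up to the end points *)

Lemma limit_slope f U Ul sigma a k : stationary f U Ul sigma -> 0 <= a -> a < 1 ->
  (forall y, a <= y -> y < 1 -> U y - U a <= k * (y - a)) ->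
  Ul 1 - U a <= k * (1 - a).
Proof.
move=> st a0 a1 h; apply/ler_addgt0Pr => e e0.
have k0 : 0 < `|k| + 1 by rewrite ltr_wpDl.
have e20 : 0 < e / 2 by rewrite divr_gt0.
have [d d0 hd] := rep_left st ltr01 e20.
pose y := Num.max a (Num.max (1 - d) (1 - e / 2 / (`|k| + 1))).
have ay : a <= y by rewrite le_max lexx.
have dy : 1 - d <= y by rewrite !le_max lexx orbT.
have y1 : y < 1 by rewrite !gt_max a1 !gtrDl !oppr_lt0 d0 divr_gt0.
have ey : (`|k| + 1) * (1 - y) <= e / 2.
  by rewrite mulrC -ler_pdivlMr// lerBlDr -lerBlDl !le_max lexx !orbT.
clearbody y; have := h y ay y1; have := hd y (le_trans a0 ay) dy y1.
rewrite ler_norml => /andP[u1 u2] u3.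
have : `|k * (1 - y)| <= e / 2.
  apply: le_trans ey; rewrite normrM [`|1 - y|]ger0_norm; last lra.
  by apply: ler_wpM2r; [lra|rewrite lerDl].
by rewrite ler_norml => /andP[u4 u5]; lra.
Qed.

Lemma Psi_lipschitz q : 0 < q -> exists2 M, 0 < M &
  forall y z, `|y| <= Phi q -> `|z| <= Phi q -> `|Psi y - Psi z| <= M * `|y - z|.
Proof.
move=> q0; have qL := Phi_lt_lambda_inf hF1 hF2 hF4 q.
have qq : - q <= q by lra.
have [|c _ hc] := @EVT_min R (derive1 Phi) (- q) q qq.
  by apply: continuous_subspaceT; exact: Phi_derive_continuous hF1.
have c0 := hF4 c; exists (derive1 Phi c)^-1; first by rewrite invr_gt0.
have PsiI y : `|y| <= Phi q -> - q <= Psi y <= q.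
  move=> yq; have := yq; rewrite -{1}(PsiK (le_lt_trans yq qL)) ler_norml -(PhiN hF1).
  by rewrite !(Phi_leE hF1 hF4).
have key y z : `|y| <= Phi q -> `|z| <= Phi q -> Psi y <= Psi z ->
    `|Psi y - Psi z| <= (derive1 Phi c)^-1 * `|y - z|.
  move=> yq zq yz.
  have [||w wI] := @MVT_segment R Phi (derive1 Phi) (Psi y) (Psi z) yz _ _.
  - by move=> x _; rewrite derive1E; apply: derivableP; exact: Phi_derivable hF1 _.
  - by apply: continuous_subspaceT; exact: Phi_continuous hF1.
  rewrite (PsiK (le_lt_trans yq qL)) (PsiK (le_lt_trans zq qL)) => E.
  rewrite ler_pdivlMl// distrC ger0_norm ?subr_ge0// distrC E ger0_norm.
    apply: ler_wpM2r; first by rewrite subr_ge0.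
    apply: hc; move: (PsiI y yq) (PsiI z zq) wI; rewrite !in_itv/=.
    move=> /andP[qy _] /andP[_ zq'] /andP[yw wz].
    by rewrite (le_trans qy yw) (le_trans wz zq').
  by apply: mulr_ge0; [exact: ltW (hF4 w)|rewrite subr_ge0].
move=> y z yq zq; have /orP[h|h] := le_total (Psi y) (Psi z); first exact: key.
by rewrite distrC [`|y - z|]distrC; exact: key.
Qed.

(** Extended to 1 by its left limit, U has slopes controlled by sigma up to the end
    points; and Psi is Lipschitz on the range of sigma. *)
Lemma stationary_C11 f U Ul sigma q : stationary f U Ul sigma -> 0 < q ->
  (forall t, 0 <= t -> t < 1 -> `|sigma t| < Phi q) ->
  exists2 v, C11 v & forall t, 0 < t -> t < 1 -> v t = U t.
Proof.
move=> st q0 sq; have PQL := Phi_lt_lambda_inf hF1 hF2 hF4 q.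
have sq1 t : 0 <= t -> t <= 1 -> `|sigma t| < Phi q.
  move=> t0; rewrite le_eqVlt => /predU1P[->|]; last exact: sq.
  by rewrite (sigma_at1 st) normr0 -(Phi0 hF1) (Phi_ltE hF1 hF4).
pose v t := if t < 1 then U t else Ul 1.
have vs t e : 0 <= t -> t <= 1 -> 0 < e -> exists2 d, 0 < d &
    forall a b, 0 <= a -> a <= b -> b <= 1 -> `|a - t| <= d -> `|b - t| <= d ->
    (Psi (sigma t) - e) * (b - a) <= v b - v a <= (Psi (sigma t) + e) * (b - a).
  move=> t0 t1 e0.
  have [d d0 hd] := slope_near st t0 t1 (lt_trans (sq1 t t0 t1) PQL) e0.
  exists d => // a b a0 ab b1 ad bd; have [b1'|b1'] := ltP b 1.
    by rewrite /v b1' (le_lt_trans ab b1'); exact: hd.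
  have eb : b = 1 by apply/eqP; rewrite eq_le b1.
  rewrite eb in ab bd *.
  have [a1|a1] := ltP a 1; last first.
    have -> : a = 1 by apply/eqP; rewrite eq_le a1 ab.
    by rewrite !subrr !mulr0 lexx.
  have H y : a <= y -> y < 1 ->
      (Psi (sigma t) - e) * (y - a) <= U y - U a <= (Psi (sigma t) + e) * (y - a).
    move=> ay y1; apply: hd => //.
    move: ad bd; rewrite !ler_norml => /andP[? ?] /andP[? ?]; apply/andP; split; lra.
  rewrite /v a1 ltxx; apply/andP; split; last first.
    by apply: (limit_slope st a0 a1) => y ay y1; have /andP[] := H y ay y1.
  have := @limit_slope _ _ _ _ a (- (Psi (sigma t) - e)) (stationaryN st) a0 a1.
  move=> /(_ _)/wrap[|]; last by rewrite mulNr; lra.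
  by move=> y ay y1; have /andP[h _] := H y ay y1; rewrite mulNr; lra.
exists v; last by move=> t t0 t1; rewrite /v t1.
have [M M0 HM] := Psi_lipschitz q0; have [C C0 HC] := sigma_lip st.
have lip x y : 0 <= x <= 1 -> 0 <= y <= 1 ->
    `|Psi (sigma x) - Psi (sigma y)| <= (M * C) * `|x - y|.
  move=> /andP[x0 x1] /andP[y0 y1].
  apply: (le_trans (HM _ _ (ltW (sq1 x x0 x1)) (ltW (sq1 y y0 y1)))).
  rewrite -mulrA; apply: ler_wpM2l; first exact: ltW.
  have [xy|yx] := leP x y.
    by rewrite distrC [`|x - y|]distrC [`|y - x|]ger0_norm ?subr_ge0//; exact: HC.
  rewrite [`|x - y|]ger0_norm; last by rewrite subr_ge0 ltW.
  by apply: HC => //; exact: ltW.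
exists (fun t => Psi (sigma t)); split.
- move=> t; rewrite /= in_itv/= => /andP[t0 t1].
  apply/cvgrPdist_le => e e0; have [d d0 hd] := vs t e t0 t1 e0.
  have quotient (x y : R) : y != 0 -> `|x - Psi (sigma t) * y| <= e * `|y| ->
      `|Psi (sigma t) - x / y| <= e.
    move=> y0 h; have -> : Psi (sigma t) - x / y = - ((x - Psi (sigma t) * y) / y) by field.
    by rewrite normrN normrM normfV ler_pdivrMr ?normr_gt0.
  have vs' s : 0 <= s <= 1 -> t - d < s < t + d ->
      `|v s - v t - Psi (sigma t) * (s - t)| <= e * `|s - t|.
    move=> /andP[s0 s1] /andP[ds sd].
    have sdn : `|s - t| <= d by rewrite ler_norml; apply/andP; split; lra.
    have tdn : `|t - t| <= d by rewrite subrr normr0 ltW.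
    have [ts|st'] := leP t s.
      have /andP[h1 h2] := hd t s t0 ts s1 tdn sdn.
      by rewrite [`|s - t|]ger0_norm ?subr_ge0// ler_norml; apply/andP; split; lra.
    have /andP[h1 h2] := hd s t s0 (ltW st') t1 sdn tdn.
    by rewrite [`|s - t|]ltr0_norm ?subr_lt0// ler_norml; apply/andP; split; lra.
  have near_t : \forall s \near t, t - d < s < t + d.
    by apply: near_itv; rewrite ?gtrBl ?ltrDl.
  rewrite !near_withinE; near=> s => st_ sI.
  apply: quotient; first by rewrite subr_eq0.
  apply: vs'; last by near: s.
  by move: sI; rewrite /= in_itv.
- apply/subspace_continuousP => t; rewrite /= in_itv/= => tI.
  apply/cvgrPdist_le => e e0; have MC0 : 0 < M * C by rewrite mulr_gt0.
  have r0 : 0 < e / (M * C) by rewrite divr_gt0.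
  have key s : 0 <= s <= 1 -> t - e / (M * C) < s < t + e / (M * C) ->
      `|Psi (sigma t) - Psi (sigma s)| <= e.
    move=> sI /andP[s1 s2]; apply: (le_trans (lip t s tI sI)).
    rewrite mulrC -ler_pdivlMr// ler_norml; apply/andP; split; lra.
  have near_t : \forall s \near t, t - e / (M * C) < s < t + e / (M * C).
    by apply: near_itv; rewrite ?gtrBl ?ltrDl.
  rewrite near_withinE; near=> s => sI; apply: key; last by near: s.
  by move: sI; rewrite /= in_itv.
- apply: (@klipschitzW _ _ _ (M * C)).
    apply: (@globally_properfilter _ _ (0, 0)).
    by split; rewrite /= in_itv/= lexx ler01.
  by move=> [x y] /= []; rewrite /= !in_itv/= => xI yI; exact: lip.
Unshelve. all: by end_near. Qed.

End Stationary.

(** * Regularity of the minimizer *)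

Section Regularity.
Context {R : realType}.
Local Notation mu := (@lebesgue_measure R).
Local Notation T := (measurableTypeR R).

Lemma minimizer_stationary (F f : R -> R) (nu1 lambda : R) (u : R -> R) :
  measurable_fun (I01 : set T) f -> {ae mu, forall t : R, I01 t -> 0 <= f t <= 1} ->
  (forall p, 0 <= F p) -> F1 F -> F2 F nu1 -> F4 F -> 0 < lambda ->
  minimizer F f lambda u ->
  exists U Ul sg : R -> R, stationary F lambda f U Ul sg /\ ae_eq01 u U.
Proof.
move=> f_meas f_01 F0 hF1 hF2 hF4 l0 um; have [[ui [nu dnu]] _] := um.
have [c uc] := BV_cdf ui dnu; have [gu [su dec]] := lebesgue_decomposition_exists nu.
have uU : ae_eq01 u (BV_rep nu c) by [].
exists (BV_rep nu c), (fun t => BV_rep nu c t - fine (nu [set t])),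
  (sigma lambda f_meas nu c); split => //.
have ig := sigma_increment_ge f_meas f_01 l0 (nu := nu) (c := c).
have il := sigma_increment_le f_meas f_01 l0 (nu := nu) (c := c).
split.
- move=> s t q s0 st t1 h.
  exact: (rep_slope_ge f_01 F0 hF1 hF2 hF4 l0 um dec dnu uU s0 st t1 h).
- move=> s t q s0 st t1 h.
  exact: (rep_slope_le f_01 F0 hF1 hF2 hF4 l0 um dec dnu uU s0 st t1 h).
- exact: ig.
- exact: il.
- exact: sigma0.
- exact (sigma1 f_meas f_01 F0 hF1 hF2 hF4 l0 um dec dnu uU).
- by move=> t t0 t1; apply: (sigma_bound f_meas f_01 F0 hF1 hF2 hF4 l0 um dec dnu uU); rewrite t0.
- have [B B0 HB] := rep_bounded nu c; exists (lambda * (B + 1)).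
    by rewrite mulr_gt0// ltr_wpDl.
  move=> s t s0 st t1; rewrite -mulrA ler_norml; apply/andP; split.
  + rewrite -mulrN -mulNr; apply: ig => //.
    apply: aeS f_01 => x fx sxt; have xI : I01 x by rewrite /= in_itv/=; apply/andP; split; lra.
    by have := fx xI; have := HB x; rewrite ler_norml => /andP[? ?] /andP[? ?]; lra.
  + apply: il => //.
    apply: aeS f_01 => x fx sxt; have xI : I01 x by rewrite /= in_itv/=; apply/andP; split; lra.
    by have := fx xI; have := HB x; rewrite ler_norml => /andP[? ?] /andP[? ?]; lra.
- move=> t e t0 e0; have [d d0 hd] := cdf_right_continuous nu t0 e0.
  by exists d => // s ts sd; rewrite /BV_rep opprD addrACA subrr add0r; exact: hd.
- move=> t e t0 e0; have [d d0 hd] := cdf_left_limit nu t0 e0.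
  exists d => // s s0 ts sd; rewrite /BV_rep.
  have -> : c + cdf nu s - (c + cdf nu t - fine (nu [set t])) =
    cdf nu s - (cdf nu t - fine (nu [set t])) by ring.
  exact: hd.
Qed.

(** A good representative that agrees almost everywhere with a function
    continuous at t has no jump there. *)
Lemma good_representative_continuous (u ug U : R -> R) t :
  good_representative u ug -> ae_eq01 u U -> 0 < t -> t < 1 -> near_continuous U t ->
  ug t = U t /\ {for t, continuous ug}.
Proof.
move=> [ugu lims _ cont] uU t0 t1 cU.
have tI : I01 t by rewrite /= in_itv/= t0.
have E : {ae mu, forall x, I01 x -> ug x = U x}.
  by apply: aeS2 ugu uU => x h1 h2 xI; rewrite h1// h2.
have near_eq (l e : R) (a b : R) : a < b -> 0 <= a -> b <= 1 ->
    (forall x, a < x < b -> `|ug x - l| <= e) -> (forall x, a < x < b -> `|U x - U t| <= e) ->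
    `|l - U t| <= e + e.
  move=> ab a0 b1 h1 h2; have [x [xab Ex]] := ae_ex ab E.
  have xI : I01 x by rewrite /= in_itv/=; move: xab => /andP[? ?]; apply/andP; split; lra.
  have := h1 x xab; have := h2 x xab; rewrite (Ex xI).
  rewrite !ler_norml => /andP[? ?] /andP[? ?]; apply/andP; split; lra.
have [cl cr] := lims t tI.
have L1 : lim (ug x @[x --> t^'-]) = U t.
  apply/eqP; rewrite -subr_eq0 -normr_le0; apply/ler_addgt0Pr => e e0; rewrite add0r.
  have e20 : 0 < e / 2 by rewrite divr_gt0.
  have [d d0 hd] := cU _ e20.
  have := cl => /cvgrPdist_le/(_ _ e20); rewrite near_withinE => /nbhs_normP[r /= r0 hr].
  rewrite (splitr e); pose a := Num.max 0 (Num.max (t - d) (t - r)).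
  have at_ : a < t by rewrite !gt_max t0 !gtrBl d0.
  have a0 : 0 <= a by rewrite le_max lexx.
  have ad : t - d <= a by rewrite !le_max lexx orbT.
  have ar : t - r <= a by rewrite !le_max lexx !orbT.
  clearbody a; apply: (near_eq _ _ a t) => //; first exact: ltW.
    move=> x /andP[ax xt]; rewrite distrC; apply: hr => //=.
    by rewrite ltr_norml; apply/andP; split; lra.
  move=> x /andP[ax xt]; apply: hd; [lra|lra|].
  by rewrite ler_norml; apply/andP; split; lra.
have L2 : lim (ug x @[x --> t^'+]) = U t.
  apply/eqP; rewrite -subr_eq0 -normr_le0; apply/ler_addgt0Pr => e e0; rewrite add0r.
  have e20 : 0 < e / 2 by rewrite divr_gt0.
  have [d d0 hd] := cU _ e20.
  have := cr => /cvgrPdist_le/(_ _ e20); rewrite near_withinE => /nbhs_normP[r /= r0 hr].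
  rewrite (splitr e); pose b := Num.min 1 (Num.min (t + d) (t + r)).
  have tb : t < b by rewrite !lt_min t1 !ltrDl d0.
  have b1 : b <= 1 by rewrite ge_min lexx.
  have bd : b <= t + d by rewrite !ge_min lexx orbT.
  have br : b <= t + r by rewrite !ge_min lexx !orbT.
  clearbody b; apply: (near_eq _ _ t b) => //; first exact: ltW.
    move=> x /andP[tx xb]; rewrite distrC; apply: hr => //=.
    by rewrite ltr_norml; apply/andP; split; lra.
  move=> x /andP[tx xb]; apply: hd; [lra|lra|].
  by rewrite ler_norml; apply/andP; split; lra.
have ct : {for t, continuous ug} by apply: cont => //; rewrite /jump_point L1 L2.
split => //; rewrite -L1; apply/esym/cvg_lim => //.
exact: cvg_at_left_filter.
Qed.

Lemma ae_eq_continuous_ess (f g : R -> R) t : ae_eq01 g f -> {for t, continuous g} ->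
  ess_continuous f t (g t).
Proof.
move=> gf /cvgrPdist_le cg e e0; have /nbhs_normP[r /= r0 hr] := cg e e0.
exists (r / 2); first by rewrite divr_gt0.
apply: aeS gf => x h x01 xr; rewrite -h ?/= ?in_itv//= distrC; apply: hr => /=.
by rewrite distrC; apply: (le_lt_trans xr); lra.
Qed.

Lemma cdf_near_continuous (nu : {charge set T -> \bar R}) t :
  (forall s, fine (nu [set s]) = 0) -> 0 <= t -> near_continuous (cdf nu) t.
Proof.
move=> atom t0 e e0; have [d1 d10 h1] := cdf_right_continuous nu t0 e0.
move: t0; rewrite le_eqVlt => /predU1P[t0|t0].
  exists d1 => // s s0 _ st; apply: h1; first by rewrite -t0.
  by move: st; rewrite -t0 subr0 add0r; exact: le_trans (ler_norm _).
have [d2 d20 h2] := cdf_left_limit nu t0 e0.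
exists (Num.min d1 d2); first by rewrite lt_min d10.
move=> s s0 _; rewrite le_min => /andP[]; rewrite !ler_distl => /andP[a1 b1] /andP[a2 b2].
rewrite -ler_distl; have [ts|ts] := leP t s; first exact: h1.
by have := h2 s s0 a2 ts; rewrite atom subr0.
Qed.

(** A Sobolev function is a primitive of its weak derivative. *)
Lemma W11_primitive (f fdot : R -> R) (fdi : mu.-integrable I01 (EFin \o fdot)) :
  W11 f fdot -> exists c, ae_eq01 f (fun t => c + cdf (density_charge fdi) t).
Proof.
move=> [fi [_ fw]]; set D := density_charge fdi.
have wi : mu.-integrable I01 (EFin \o (fun t => f t - cdf D t)).
  exact: (integrable_EFinB (@measurable_I01 R) fi (integrable_cdf D)).
have [|c hc] := du_bois_reymond wi; last first.
  by exists c; apply: aeS hc => x hx /hx; lra.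
move=> phi tphi; have dphi := integrable_continuous_lebesgue (test_function_deriv_continuous tphi).
have i1 := integrable_mul_test_deriv tphi fi.
have i2 := integrable_mul_test_deriv tphi (integrable_cdf D).
under eq_integral do rewrite mulrBl EFinB.
rewrite integralB// fw//.
have i3 : mu.-integrable I01 (fun x => (fdot x * phi x)%:E).
  have [B HB] := continuous_bounded_I01 (test_function_continuous tphi).
  apply: (integrable_mul_bounded (@measurable_I01 R) fdi _ HB).
  by apply: measurable_funTS; apply: continuous_measurable_fun; exact: test_function_continuous.
have e : \int[mu]_(x in I01) (cdf D x * derive1 phi x) =
    - \int[mu]_(x in I01) (fdot x * phi x).
  transitivity (\int[mu]_(t in I01) (derive1 phi t * \int[mu]_(x in `]0, t]) fdot x)).
    by apply: eq_Rintegral => t /set_mem tI; rewrite cdf_density// mulrC.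
  rewrite (triangle_Fubini dphi fdi) -mulN1r -RintegralZl//.
  apply: eq_Rintegral => x /set_mem; rewrite /= in_itv/= => /andP[x0 x1].
  by rewrite integral_test_deriv// ?(ltW x0)// mulrN mulN1r.
have mI := @measurable_I01 R.
rewrite -(fineK (integrable_fin_num mI i2)) -(fineK (integrable_fin_num mI i3)).
by move: e; rewrite /Rintegral => ->; rewrite !EFinN oppeK addeC -EFinN -EFinD subrr.
Qed.

(** g is the absolutely continuous representative of f, and V is the primitive of
    |fdot|. *)
Lemma W11_data (f fdot : R -> R) : W11 f fdot ->
  {ae mu, forall t : R, I01 t -> 0 <= f t <= 1} ->
  exists g V : R -> R, [/\ {ae mu, forall x : R, 0 < x < 1 -> g x = f x},
    forall s t, 0 <= s -> s <= t -> t < 1 -> `|g t - g s| <= V t - V s,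
    V 0 = 0 /\ forall t, 0 <= t -> t < 1 -> V t <= \int[mu]_(x in I01) `|fdot x|,
    forall t, 0 <= t -> t < 1 -> near_continuous g t &
    forall t, 0 <= t -> t < 1 -> 0 <= g t <= 1].
Proof.
move=> fW f01; have [_ [fdi _]] := fW; have [c fc] := W11_primitive fdi fW.
have adi : mu.-integrable I01 (EFin \o (fun x => `|fdot x|)) by exact: integrable_abse fdi.
pose V := cdf (density_charge adi); pose g t := c + cdf (density_charge fdi) t.
have sub s t : 0 <= s -> t < 1 -> `]s, t] `<=` (I01 : set R).
  move=> s0 t1 x /=; rewrite !in_itv/= => /andP[sx xt].
  by rewrite (le_lt_trans s0 sx) (le_lt_trans xt t1).
have V0 : V 0 = 0 by rewrite /V /cdf set_itvoc0 charge0.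
have gV s t : 0 <= s -> s <= t -> t < 1 -> `|g t - g s| <= V t - V s.
  move=> s0 st t1; rewrite /g opprD addrACA subrr add0r !cdfB//.
  have mA : measurable (`]s, t]%classic : set T) by exact: measurable_itvT.
  rewrite !density_chargeE//; [|exact: sub..].
  have fst : mu.-integrable `]s, t] (EFin \o fdot) by apply: integrableS (fdi) => //; exact: sub.
  exact: (le_normr_Rintegral mA fst).
have Vle t : 0 <= t -> t < 1 -> V t <= \int[mu]_(x in I01) `|fdot x|.
  move=> t0 t1; have -> : V t = V t - V 0 by rewrite V0 subr0.
  rewrite cdfB// density_chargeE//; [|exact: sub..].
  apply: fine_le.
  - apply: integrable_fin_num; first exact: measurable_itvT.
    by apply: integrableS (adi) => //; exact: sub.
  - exact: (integrable_fin_num (@measurable_I01 R) adi).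
  - apply: ge0_subset_integral => //; last exact: sub.
    by have /integrableP[] := adi.
have Vc t : 0 <= t -> near_continuous V t.
  move=> t0; apply: cdf_near_continuous => // s.
  exact: (congr1 fine (integral_set1 _ s)).
have gc t : 0 <= t -> t < 1 -> near_continuous g t.
  move=> t0 t1 e e0; have [d d0 hd] := Vc t t0 e e0; exists d => // s s0 s1 sd.
  apply: le_trans (hd s s0 s1 sd); have [ts|st] := leP t s.
    by apply: (le_trans (gV t s t0 ts s1)); exact: ler_norm.
  rewrite distrC [`|V s - V t|]distrC; apply: (le_trans (gV s t s0 (ltW st) t1)).
  exact: ler_norm.
have gf : {ae mu, forall x : R, 0 < x < 1 -> g x = f x}.
  by apply: aeS fc => x h x01; rewrite h//= in_itv.
exists g, V; split => // t t0 t1.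
have H e : 0 < e -> - e <= g t <= 1 + e.
  move=> e0; have [d d0 hd] := gc t t0 t1 e e0.
  have tm : t < Num.min 1 (t + d) by rewrite lt_min t1 ltrDl.
  have [x [/andP[tx]]] := ae_ex tm (aeS2 (fun x a b => conj a b) gf f01).
  rewrite lt_min => /andP[x1 xd]; rewrite /= in_itv/=.
  have x01 : 0 < x < 1 by rewrite (le_lt_trans t0 tx).
  rewrite x01 => -[/(_ isT) <- /(_ isT) /andP[g0 g1]].
  have x0 : 0 <= x by lra.
  have xtd : `|x - t| <= d by rewrite ler_distl; apply/andP; split; lra.
  by have := hd x x0 x1 xtd; rewrite ler_distl => /andP[? ?]; apply/andP; split; lra.
by apply/andP; split; apply/ler_addgt0Pr => e e0; have := H e e0; lra.
Qed.

End Regularity.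

Unset Implicit Arguments.
Set Strict Implicit.

Theorem theorem1p3 (R : realType) (F f : R -> R) (nu1 nu2 nu3 lambda : R)
    (u ug : R -> R)
    (f_meas : measurable_fun (I01 : set (measurableTypeR R)) f)
    (f_01 : {ae @lebesgue_measure R,
               forall t : R, I01 t -> 0 <= f t <= 1})
    (F_ge0 : forall p, 0 <= F p)
    (nu1_gt0 : 0 < nu1) (nu2_gt0 : 0 < nu2)
    (hF1 : F1 F) (hF2 : F2 F nu1) (hF3 : F3 F nu2 nu3) (hF4 : F4 F)
    (lambda_gt0 : 0 < lambda)
    (u_min : minimizer F f lambda u)
    (u_good : good_representative u ug) :
  [/\ (* (a) *)
      forall t0 : R, I01 t0 ->
        (exists2 g : R -> R, ae_eq01 g f & {for t0, continuous g}) ->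
        {for t0, continuous ug},
      (* (b) *)
      forall a b : R, 0 < a -> a < b -> b < 1 ->
        (exists2 g : R -> R,
           {ae @lebesgue_measure R, forall t : R, `]a, b[ t -> g t = f t} &
           [lipschitz g t | t in `]a, b[]) ->
        C2_on `]a, b[ ug
    & (* (c) *)
      forall fdot : R -> R, W11 f fdot ->
        (lambda%:E * ((1 / 2)%:E +
            \int[@lebesgue_measure R]_(t in I01) `|fdot t|%:E)
         < omega_inf F)%E ->
        exists2 v : R -> R, C11 v & forall t : R, I01 t -> v t = ug t].
Proof.
have [U [Ul [sg [st uU]]]] :=
  minimizer_stationary f_meas f_01 F_ge0 hF1 hF2 hF4 lambda_gt0 u_min.
have cU t y : 0 < t -> t < 1 -> ess_continuous f t y -> near_continuous U t.
  exact: (rep_continuous hF1 hF2 hF4 lambda_gt0 st).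
split.
- move=> t0; rewrite /= in_itv/= => /andP[t00 t01] [g gf cg].
  have [] // := good_representative_continuous u_good uU t00 t01 _.
  exact: (cU t0 (g t0) t00 t01 (ae_eq_continuous_ess gf cg)).
- move=> a b a0 ab b1 [g fg [M [_ gM]]].
  (* only constants larger than the given bound are known to be admissible *)
  have lipM x y : a < x < b -> a < y < b -> `|g x - g y| <= (M + 1) * `|x - y|.
    move=> xab yab; have := gM (M + 1) _ (x, y); rewrite /= !in_itv/=.
    by apply; rewrite ?ltrDl.
  have fg' : {ae @lebesgue_measure R, forall x : R, a < x < b -> g x = f x}.
    by apply: aeS fg => x h xab; apply: h; rewrite /= in_itv.
  apply: (lipschitz_C2 hF1 hF2 hF4 lambda_gt0 st (ltW a0) (ltW b1) fg' lipM) => x xab.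
  have [x0 x1] : 0 < x /\ x < 1 by move: xab => /andP[? ?]; split; lra.
  have := lipschitz_ess_continuous fg' lipM xab => ce.
  by have [] := good_representative_continuous u_good uU x0 x1 (cU x _ x0 x1 ce).
- move=> fdot fW lt_omega.
  have [g [V [fg gV [V0 Vle] gc g01]]] := W11_data fW f_01.
  have [_ [fdi _]] := fW.
  have [Q Q0 BQ] : exists2 q, 0 < q &
      lambda * (1 / 2 + \int[@lebesgue_measure R]_(t in I01) `|fdot t|) < W F q.
    apply: (omega_inf_gt hF1 hF4); apply: le_lt_trans lt_omega.
    have := integrable_fin_num (@measurable_I01 R) (integrable_abse fdi).
    by rewrite /Rintegral => h; rewrite -[X in (_ <= _ * (_ + X))%E](fineK h).
  have sQ t := @sobolev_sigma_lt _ _ _ _ hF1 hF2 hF4 lambda_gt0 _ _ _ _ _ _ _ st fg gV V0 Vle gc g01 Q t Q0 BQ.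
  have [v v11 vU] := stationary_C11 hF1 hF2 hF4 st Q0 sQ.
  exists v => // t; rewrite /= in_itv/= => /andP[t0 t1]; rewrite vU//.
  have ce := sobolev_ess_continuous fg gc (ltW t0) t1.
  by have [-> _] := good_representative_continuous u_good uU t0 t1 (cU t _ t0 t1 ce).
Qed.
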